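(* Suppose that $(x^*,\mu^*,\lambda^* )\in\mathbb{R}^n\times\mathbb{R}^m\times\mathcal{E}$ is a KKT triple for the nonlinear symmetric cone problem (P1): minimize $f(x)$ subject to $h(x)=0$, $g(x)\in\mathcal{K}$, such that - (second order sufficient condition) $\langle\nabla_x^2L(x^*,\mu^*,\lambda^* )v,v\rangle+2\langle w\circ w,\lambda^*\rangle>0$ for every nonzero $(v,w)\in\mathbb{R}^n\times\mathcal{E}$ such that $Jg(x^* )v-2\sqrt{g(x^* )}\circ w=0$ and $Jh(x^* )v=0$; - $x^*$ is nondegenerate. Then there are positive scalars $\delta,\epsilon,M,\overline\rho$ such that the following hold. 1. For all $(\mu,\lambda,\rho)$ in the set $$D=\{(\mu,\lambda,\rho)\in\mathbb{R}^m\times\mathcal{E}\times\mathbb{R}\mid\|\mu-\mu^*\|+\|\lambda-\lambda^*\|<\delta\rho,\ \overline\rho\leq\rho\},$$ the problem of minimizing $\mathfrak{L}^{\mathrm{Sym}}_\rho(x,\mu,\lambda)$ over $x\in B_\epsilon(x^* )$ has a unique solution. Denote it by $x(\mu,\lambda,\rho)$. Then $x(\cdot,\cdot,\cdot)$ is continuously differentiable in the interior of $D$ and satisfies $$\|x(\mu,\lambda,\rho)-x^*\|\leq\frac{M}{\rho}\|(\mu,\lambda)-(\mu^*,\lambda^* )\|\quad\text{for all }(\mu,\lambda,\rho)\in D.$$ 2. For all $(\mu,\lambda,\rho)\in D$, $$\|(\overline\mu(\mu,\lambda,\rho),\overline\lambda(\mu,\lambda,\rho))-(\mu^*,\lambda^*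 )\|\leq\frac{M}{\rho}\|(\mu,\lambda)-(\mu^*,\lambda^* )\|,$$ where $\overline\mu(\mu,\lambda,\rho)=\mu-\rho h(x(\mu,\lambda,\rho))$ and $\overline\lambda(\mu,\lambda,\rho)=[\lambda-\rho g(x(\mu,\lambda,\rho))]_+$.
   Context: $(\mathcal{E},\circ)$ is a Euclidean Jordan algebra: a finite-dimensional real inner product space with a bilinear product $\circ$ and unit $e$ such that $y\circ z=z\circ y$, $y\circ(y^2\circ z)=y^2\circ(y\circ z)$ (with $y^2=y\circ y$) and $\langle y\circ z,w\rangle=\langle y,z\circ w\rangle$. Every $y\in\mathcal{E}$ has a spectral decomposition $y=\sum_{i=1}^r\sigma_ic_i$ with real eigenvalues $\sigma_i$ (unique up to order) and a Jordan frame $c_1,\dots,c_r$ (primitive idempotents with $c_i\circ c_j=0$ for $i\neq j$ and $\sum_ic_i=e$); $\operatorname{tr}(y)=\sum_i\sigma_i$, $\langle x,y\rangle=\operatorname{tr}(x\circ y)$, and $\|\cdot\|$ is the induced norm (Euclidean norms on $\mathbb{R}^n$, $\mathbb{R}^m$ and on the product $\mathbb{R}^m\times\mathcal{E}$). $\mathcal{K}=\{y\circ y\mid y\in\mathcal{E}\}$ is the cone of squares; for $y\in\mathcal{K}$ (nonnegative eigenvalues), $\sqrt{y}=\sum_i\sqrt{\sigma_i}\,c_i$. $[y]_+$ is the orthogonal projection of $y$ onto $\mathcal{K}$. $B_\epsilon(x^* )$ is the closed ball in $\mathbb{R}^n$ of radius $\epsilon$ centered at $x^*$. $f:\mathbb{R}^n\to\mathbb{R}$,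 $h:\mathbb{R}^n\to\mathbb{R}^m$, $g:\mathbb{R}^n\to\mathcal{E}$ are twice continuously differentiable; $Jh,Jg$ are the Jacobians (derivatives), $^*$ on operators denotes adjoint. The Lagrangian is $L(x,\mu,\lambda)=f(x)-\langle h(x),\mu\rangle-\langle g(x),\lambda\rangle$. A KKT triple $(x,\mu,\lambda)$ of (P1) satisfies $\nabla f(x)-Jh(x)^*\mu-Jg(x)^*\lambda=0$, $\lambda\in\mathcal{K}$, $g(x)\in\mathcal{K}$, $\lambda\circ g(x)=0$, $h(x)=0$. Nondegeneracy: a point $x$ with $g(x)\in\mathcal{K}$ is nondegenerate if $\mathbb{R}^m\times\mathcal{E}=\{(Jh(x)d,Jg(x)d)\mid d\in\mathbb{R}^n\}+\{0\}\times\operatorname{lin}T_{\mathcal{K}}(g(x))$, where $T_{\mathcal{K}}(z)$ is the tangent cone of $\mathcal{K}$ at $z$ and $\operatorname{lin}T=T\cap(-T)$. The augmented Lagrangian for (P1) is $$\mathfrak{L}^{\mathrm{Sym}}_\rho(x,\mu,\lambda)=f(x)-\langle h(x),\mu\rangle+\frac{\rho}{2}\|h(x)\|^2+\frac{1}{2\rho}\left(-\|\lambda\|^2+\|[\lambda-\rho g(x)]_+\|^2\right).$$ *)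

(* Defs.v *)
From mathcomp Require Import all_boot all_order all_algebra.
From mathcomp Require Import all_classical all_reals all_analysis.

Set Implicit Arguments.
Unset Strict Implicit.
Unset Printing Implicit Defensive.

Import Order.TTheory GRing.Theory Num.Theory.
Import numFieldNormedType.Exports.

Local Open Scope classical_set_scope.
Local Open Scope ring_scope.

(* The canonical norm of 'rV[R]_n is the sup norm: it is used only through its
   topology (limits, differentials). All quantitative bounds on R^n use enorm. *)
Definition dot (R : realType) (n : nat) (u v : 'rV[R]_n) : R :=
  \sum_(i < n) u 0 i * v 0 i.

Definition enorm (R : realType) (n : nat) (u : 'rV[R]_n) : R :=
  Num.sqrt (dot u u).

Definition eball (R : realType) (n : nat) (x : 'rV[R]_n) (eps : R) :
  set 'rV[R]_n := [set y | enorm (y - x) <= eps].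

(* The norm of the normed module E is required to be the one induced by jip, so
   that E is an inner product space; jip is positive definite by jip_norm.
   Linearity in the second arguments follows from symmetry. *)
Record euclidean_jordan (R : realType) (E : normedModType R) := EuclideanJordan {
  jmul : E -> E -> E;
  junit : E;
  jip : E -> E -> R;
  finite_dim : exists (d : nat) (b : 'I_d -> E),
    forall y, exists a : 'I_d -> R, y = \sum_(i < d) a i *: b i;
  jip_sym : forall y z, jip y z = jip z y;
  jip_linear : forall a y z w, jip (a *: y + z) w = a * jip y w + jip z w;
  jip_norm : forall y, jip y y = `|y| ^+ 2;
  jmul_linear : forall a y z w,
    jmul (a *: y + z) w = a *: jmul y w + jmul z w;
  jmul_comm : forall y z, jmul y z = jmul z y;
  jmul_unit : forall y, jmul junit y = y;
  jmul_jordan : forall y z,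
    jmul y (jmul (jmul y y) z) = jmul (jmul y y) (jmul y z);
  jmul_assoc_ip : forall y z w, jip (jmul y z) w = jip y (jmul z w) }.

Section Spectral.
Context (R : realType) (E : normedModType R) (A : euclidean_jordan E).

Definition jidempotent (c : E) : Prop := jmul A c c = c.

Definition primitive_idempotent (c : E) : Prop :=
  [/\ jidempotent c, c <> 0 &
      forall a b, jidempotent a -> jidempotent b -> c = a + b -> a = 0 \/ b = 0].

Definition jordan_frame (r : nat) (c : 'I_r -> E) : Prop :=
  [/\ forall i, primitive_idempotent (c i),
      forall i j, i != j -> jmul A (c i) (c j) = 0 &
      \sum_(i < r) c i = junit A].

Definition spectral_decomposition (y : E) (r : nat) (sigma : 'I_r -> R)
    (c : 'I_r -> E) : Prop :=
  jordan_frame c /\ y = \sum_(i < r) sigma i *: c i.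

(* Both get's below select from a singleton: every y has a spectral
   decomposition and its eigenvalues are unique up to order. *)
Definition jtrace (y : E) : R :=
  get [set t | exists (r : nat) (sigma : 'I_r -> R) (c : 'I_r -> E),
    spectral_decomposition y sigma c /\ t = \sum_(i < r) sigma i].

(* Meaningful only on the cone of squares: Num.sqrt is 0 on negative reals. *)
Definition jsqrt (y : E) : E :=
  get [set z | exists (r : nat) (sigma : 'I_r -> R) (c : 'I_r -> E),
    spectral_decomposition y sigma c /\
    z = \sum_(i < r) Num.sqrt (sigma i) *: c i].

Definition trace_normalized : Prop :=
  forall y z, jip A y z = jtrace (jmul A y z).

Definition square_cone : set E := [set jmul A y y | y in setT].

End Spectral.

Section Cones.
Context (R : realType) (E : normedModType R).

(* Orthogonal projection; single-valued for C nonempty, closed and convex in a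
   finite-dimensional inner product space. *)
Definition cone_projection (C : set E) (y : E) : E :=
  get [set z | C z /\ forall w, C w -> `|y - z| <= `|y - w|].

(* Bouligand tangent cone. *)
Definition tangent_cone (C : set E) (z : E) : set E :=
  [set d | exists (t : nat -> R) (e : nat -> E),
    [/\ forall k, 0 < t k, t k @[k --> \oo] --> (0 : R),
        e k @[k --> \oo] --> d & forall k, C (z + t k *: e k)]].

Definition lineality (T : set E) : set E := [set d | T d /\ T (- d)].

End Cones.

(* For finite-dimensional V, continuity of the differential in operator norm is
   the same as continuity of its value on each fixed vector. *)
Definition C1_on (R : realType) (V W : normedModType R) (U : set V)
    (F : V -> W) : Prop :=
  forall x, U x -> differentiable F x /\
    forall v, {for x, continuous (fun y => 'd F y v : W)}.

Definition C2 (R : realType) (V W : normedModType R) (F : V -> W) : Prop :=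
  C1_on setT F /\ forall v, C1_on setT (fun y => 'd F y v : W).

(* The adjoint of T : R^n -> W for the inner product ip of W, in coordinates;
   see adjointP. *)
Definition adjoint (R : realType) (n : nat) (W : Type) (ip : W -> W -> R)
    (T : 'rV[R]_n -> W) (w : W) : 'rV[R]_n :=
  \row_(j < n) ip (T (delta_mx 0 j)) w.

Definition gradient (R : realType) (n : nat) (f : 'rV[R]_n -> R)
    (x : 'rV[R]_n) : 'rV[R]_n :=
  \row_(j < n) 'd f x (delta_mx 0 j).

Definition hessian (R : realType) (n : nat) (f : 'rV[R]_n -> R)
    (x v : 'rV[R]_n) : 'rV[R]_n :=
  'd (gradient f) x v.

Lemma adjointP (R : realType) (n : nat) (W : lmodType R) (ip : W -> W -> R)
    (ip_linear : forall a y z w, ip (a *: y + z) w = a * ip y w + ip z w)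
    (T : {linear 'rV[R]_n -> W}) (w : W) (v : 'rV[R]_n) :
  ip (T v) w = dot v (adjoint ip T w).
Proof.
have ip0 : ip 0 w = 0.
  have := ip_linear 1 0 0 w; rewrite scaler0 addr0 mul1r => /eqP.
  by rewrite -subr_eq0 opprD addrA subrr sub0r oppr_eq0 => /eqP.
rewrite {1}(row_sum_delta v) linear_sum /dot.
rewrite (big_morph (ip^~ w) (id1 := 0) (op1 := +%R)) //; last first.
  by move=> y z; have := ip_linear 1 y z w; rewrite scale1r mul1r.
apply: eq_bigr => i _; rewrite mxE linearZ.
by have := ip_linear (v 0 i) (T (delta_mx 0 i)) 0 w; rewrite !addr0 ip0 addr0.
Qed.

Lemma gradientP (R : realType) (n : nat) (f : 'rV[R]_n -> R)
    (x v : 'rV[R]_n) : 'd f x v = dot v (gradient f x) :> R.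
Proof.
rewrite {1}(row_sum_delta v) linear_sum /dot.
by apply: eq_bigr => i _; rewrite mxE linearZ.
Qed.

Definition is_minimizer (R : realType) (T : Type) (F : T -> R) (B : set T)
    (x : T) : Prop :=
  B x /\ forall y, B y -> F x <= F y.

Section Problem.
Context (R : realType) (E : normedModType R) (A : euclidean_jordan E).
Context (n m : nat).
Context (f : 'rV[R]_n -> R) (h : 'rV[R]_n -> 'rV[R]_m) (g : 'rV[R]_n -> E).

Definition pnorm (p : 'rV[R]_m * E) : R :=
  Num.sqrt (enorm p.1 ^+ 2 + `|p.2| ^+ 2).

Definition lagrangian (x : 'rV[R]_n) (mu : 'rV[R]_m) (lam : E) : R :=
  f x - dot (h x) mu - jip A (g x) lam.

Definition kkt (x : 'rV[R]_n) (mu : 'rV[R]_m) (lam : E) : Prop :=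
  [/\ gradient f x - adjoint (@dot R m) ('d h x) mu
        - adjoint (jip A) ('d g x) lam = 0,
      square_cone A lam, square_cone A (g x), jmul A lam (g x) = 0 &
      h x = 0].

Definition second_order_sufficient (x : 'rV[R]_n) (mu : 'rV[R]_m) (lam : E) :
    Prop :=
  forall (v : 'rV[R]_n) (w : E), (v, w) <> (0, 0) ->
    'd g x v - 2 *: jmul A (jsqrt A (g x)) w = 0 ->
    'd h x v = 0 ->
    dot (hessian (fun y => lagrangian y mu lam) x v) v
      + 2 * jip A (jmul A w w) lam > 0.

Definition nondegenerate_point (x : 'rV[R]_n) : Prop :=
  square_cone A (g x) /\
  [set: 'rV[R]_m * E] =
    [set p + q | p in [set ('d h x d : 'rV[R]_m, 'd g x d : E) | d in setT]
               & q in [set ((0 : 'rV[R]_m), z) | z in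
                        lineality (tangent_cone (square_cone A) (g x))]].

Definition augmented_lagrangian (rho : R) (x : 'rV[R]_n) (mu : 'rV[R]_m)
    (lam : E) : R :=
  f x - dot (h x) mu + rho / 2 * enorm (h x) ^+ 2
    + (2 * rho)^-1 *
      (- `|lam| ^+ 2 + `|cone_projection (square_cone A) (lam - rho *: g x)| ^+ 2).

End Problem.

Definition multiplier_region (R : realType) (E : normedModType R) (m : nat)
    (mus : 'rV[R]_m) (lams : E) (delta rhobar : R) : set ('rV[R]_m * E * R) :=
  [set p | enorm (p.1.1 - mus) + `|p.1.2 - lams| < delta * p.2 /\
           rhobar <= p.2].

(* Main.v *)
Require Import Defs.
From HB Require Import structures.
From mathcomp Require Import all_boot all_order all_algebra.
From mathcomp Require Import all_classical all_reals all_analysis.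
From mathcomp Require Import ring lra.

(* Writing the cone constraint as g(x) = y o y turns (P1) into an equality
   constrained problem H(z) = 0 in z = (x, y). At zs = (xs, sqrt g(xs)) the
   second order condition is the usual one for that problem, and nondegeneracy
   says that the derivative of H is onto. Its augmented Lagrangian, minimized
   over the slack y, is the one of the statement, because the distance from u
   to the cone is the norm of [-u]_+.
   Put s = ((mu, lam) - (mus, lams)) / rho and t = 1 / rho. A minimizer z and
   q = (H(z) - s) / t, which is the multiplier error up to sign, solve
   G(z, q, s, t) = (0, 0, s, t) with
     G(z, q, s, t) = (grad L(z) + DH(z)^T q, H(z) - s - t q, s, t),
   whose derivative at (zs, 0, 0, 0) is injective although t = 0 there. So
   |G p - G p'| >= c |p - p'| near that point, which gives uniqueness,
   differentiability in (s, t) and both estimates at once. Minimizers stay near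
   zs by the quadratic growth of L + const |H|^2 and by comparison with a point
   at which H = s. *)

Set Implicit Arguments.
Unset Strict Implicit.
Unset Printing Implicit Defensive.

Import Order.TTheory GRing.Theory Num.Theory.
Import numFieldNormedType.Exports.

Local Open Scope classical_set_scope.
Local Open Scope ring_scope.

(** * Finite-dimensional normed modules *)

(** In the variable [t = 1 / rho] the infinite penalty is the regular point [t = 0], so one
    neighbourhood of it serves all large [rho], and the constants are uniform over the unbounded
    region [D]. [G] is never inverted to produce a solution: minimizers exist by compactness, and
    the lower bound on [G] is applied to them afterwards. That bound holds only near the base point,
    so two a priori facts are required: minimizers are close to [zs], and [q], a quotient by the
    small number [t], is small. The second follows from stationarity, which reads
    [DH(z)^T q = - grad L(z)] with [DH(z)^T] bounded below. The statement confines [x] but leaves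
    the slack free. Taking the optimal slack in the cone keeps it near [sqrt g(xs)], because the
    square root is Holder continuous on the cone. Neither the projection nor the square root is
    differentiable in general; the regularity of [x] is obtained jointly with that of [y] and [q].
    Both are selected by choice, so their properties rest on the spectral theorem, which is derived
    here from the Jordan identity. *)

Lemma continuousPeps (R : realType) (V W : normedModType R) (F : V -> W) x :
  {for x, continuous F} <->
  forall e : R, 0 < e -> exists2 d : R, 0 < d & forall y, `|y - x| < d -> `|F y - F x| < e.
Proof.
split=> [Fx e e0|Fx].
  move: Fx => /cvgrPdist_lt /(_ _ e0)/nbhs_normP[d /= d0 dF]; exists d => // y yx.
  by rewrite distrC; apply: dF; rewrite /= distrC.
apply/(@cvgrPdist_lt _ _ _ (nbhs x)) => e e0; have [d d0 dF] := Fx e e0.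
by apply/nbhs_normP; exists d => //= y yx; rewrite distrC dF // distrC.
Qed.

Lemma lipschitz_continuous (R : realType) (V W : normedModType R) (F : V -> W)
    (C : R) : (forall x y, `|F y - F x| <= C * `|y - x|) -> continuous F.
Proof.
move=> FC x; apply/continuousPeps => e e0.
have C1 : 0 < `|C| + 1 by rewrite ltr_wpDl.
exists (e / (`|C| + 1)); first exact: divr_gt0.
move=> y; rewrite ltr_pdivlMr // mulrC; apply: le_lt_trans.
apply: (le_trans (FC _ _)); apply: ler_wpM2r => //.
by apply: (le_trans (ler_norm _)); rewrite lerDl.
Qed.

(** Only the boundedness of [co] is a field; that of [oc] is automatic. The coordinates are data,
    not a mere existence statement, because they determine the inner product [ip]. *)
Record fdim (R : realType) (V : normedModType R) := Fdim {
  fd : nat;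
  co : {linear V -> 'rV[R]_fd};
  oc : {linear 'rV[R]_fd -> V};
  coK : cancel co oc;
  ocK : cancel oc co;
  co_bounded : exists2 C : R, 0 < C & forall v, `|co v| <= C * `|v| }.

Section FdimTheory.
Context (R : realType).

Lemma rV_coord_le n (u : 'rV[R]_n) i : `|u 0 i| <= `|u|.
Proof.
rewrite [leRHS]/Num.norm /= mx_normrE.
exact: (le_bigmax 0 (fun ij : 'I_1 * 'I_n => `|u ij.1 ij.2|) (0, i)).
Qed.

Lemma rV_norm_le n (u : 'rV[R]_n) (M : R) :
  0 <= M -> (forall i, `|u 0 i| <= M) -> `|u| <= M.
Proof.
move=> M0 uM; rewrite [leLHS]/Num.norm /= mx_normrE; apply/bigmax_leP; split => //.
by move=> [i j] _ /=; rewrite ord1.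
Qed.

Lemma linear_rV_bounded (W : normedModType R) n (T : {linear 'rV[R]_n -> W}) :
  exists2 C : R, 0 < C & forall u, `|T u| <= C * `|u|.
Proof.
exists (1 + \sum_(i < n) `|T (delta_mx 0 i)|).
  by rewrite ltr_wpDr // sumr_ge0.
move=> u; rewrite {1}(row_sum_delta u) linear_sum mulrDl mul1r.
apply: (le_trans (ler_norm_sum _ _ _)).
apply: (@le_trans _ _ (\sum_(i < n) `|T (delta_mx 0 i)| * `|u|)); last first.
  by rewrite -mulr_suml lerDr.
apply: ler_sum => i _; rewrite linearZ normrZ mulrC.
by rewrite ler_wpM2l // rV_coord_le.
Qed.

Lemma linear_bound_continuous (V W : normedModType R) (T : {linear V -> W})
    (C : R) : (forall u, `|T u| <= C * `|u|) -> continuous T.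
Proof. by move=> TC; apply: (@lipschitz_continuous _ _ _ _ C) => x y; rewrite -linearB. Qed.

Lemma oc_continuous (V : normedModType R) (D : fdim V) : continuous (oc D).
Proof. by have [C _] := linear_rV_bounded (oc D); exact: linear_bound_continuous. Qed.

Lemma fdim_linear_bounded (V W : normedModType R) (D : fdim V)
    (T : {linear V -> W}) : exists2 C : R, 0 < C & forall u, `|T u| <= C * `|u|.
Proof.
have [C C0 coC] := co_bounded D.
have [B B0 TB] := linear_rV_bounded (T \o oc D : {linear _ -> _}).
exists (B * C); first exact: mulr_gt0.
move=> u; rewrite -{1}(coK D u).
apply: (le_trans (TB (co D u))); rewrite -mulrA; apply: ler_wpM2l; first exact: ltW.
exact: coC.
Qed.

Lemma fdim_linear_continuous (V W : normedModType R) (D : fdim V)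
    (T : {linear V -> W}) : continuous T.
Proof. by have [C _] := fdim_linear_bounded D T; exact: linear_bound_continuous. Qed.

Lemma fdim_compact (V : normedModType R) (D : fdim V) (A : set V) (M : R) :
  closed A -> (forall x, A x -> `|x| <= M) -> compact A.
Proof.
move=> Acl AM; have [C C0 coC] := co_bounded D.
have -> : A = oc D @` (oc D @^-1` A).
  apply/seteqP; split=> [x Ax|_ [u Au <-]//].
  by exists (co D x); rewrite /= coK.
apply: continuous_compact.
  exact/continuous_subspaceT/oc_continuous.
apply: bounded_closed_compact; last first.
  by apply: preimage_closed => // u _; exact: oc_continuous.
exists (C * M); split; first exact: num_real.
move=> N CN u /= Au; rewrite -(@ocK _ _ D u); apply/ltW/(le_lt_trans _ CN).
by apply: (le_trans (coC _)); rewrite ler_pM2l // AM.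
Qed.

Lemma fdim_min (V : normedModType R) (D : fdim V) (A : set V) (M : R)
    (F : V -> R) : closed A -> (forall x, A x -> `|x| <= M) -> A !=set0 ->
  (forall x, A x -> {for x, continuous F}) ->
  exists2 c, A c & forall x, A x -> F c <= F x.
Proof.
move=> Acl AM A0 Fc.
have cF : {within A, continuous F}.
  by apply: continuous_in_subspaceT => x; rewrite inE; exact: Fc.
have [c cA cm] := compact_EVT_min A0 (fdim_compact D Acl AM) cF.
by exists c; [rewrite inE in cA | move=> x Ax; apply: cm; rewrite inE].
Qed.

Lemma closed_norm_ball (V : normedModType R) (x : V) (r : R) :
  closed [set y | `|y - x| <= r].
Proof.
have c : continuous (fun y : V => `|y - x|).
  move=> y; apply: cvg_norm; apply: cvgB; [exact: cvg_id|exact: cvg_cst].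
rewrite (_ : mkset _ = (fun y : V => `|y - x|) @^-1` [set t | t <= r]) //.
by apply: preimage_closed => // y _; exact: c.
Qed.

End FdimTheory.

(** * Inner products in coordinates *)

Section Dot.
Context (R : realType) (n : nat).
Implicit Types u v w : 'rV[R]_n.

Lemma dotC u v : dot u v = dot v u.
Proof. by apply: eq_bigr => i _; rewrite mulrC. Qed.

Lemma dotDl u v w : dot (u + v) w = dot u w + dot v w.
Proof. by rewrite -big_split; apply: eq_bigr => i _; rewrite mxE mulrDl. Qed.

Lemma dotZl a u w : dot (a *: u) w = a * dot u w.
Proof. by rewrite mulr_sumr; apply: eq_bigr => i _; rewrite mxE mulrA. Qed.

Lemma dot_ge0 u : 0 <= dot u u.
Proof. by apply: sumr_ge0 => i _; rewrite -expr2 sqr_ge0. Qed.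

Lemma dot_eq0 u : dot u u = 0 -> u = 0.
Proof.
move=> /eqP; rewrite psumr_eq0 => [|i _]; last by rewrite -expr2 sqr_ge0.
move=> /allP u0; apply/rowP => i; rewrite mxE.
have := u0 i (mem_index_enum _); rewrite mulf_eq0 orbb.
by move=> /eqP.
Qed.

Lemma dot_le u v : `|dot u v| <= n%:R * `|u| * `|v|.
Proof.
apply: (le_trans (ler_norm_sum _ _ _)).
apply: (@le_trans _ _ (\sum_(i < n) `|u| * `|v|)).
  by apply: ler_sum => i _; rewrite normrM ler_pM // rV_coord_le.
by rewrite sumr_const card_ord -mulrA mulr_natl.
Qed.

Lemma norm_le_dot u : `|u| ^+ 2 <= dot u u.
Proof.
rewrite -ler_sqrt; last exact: dot_ge0.
rewrite sqrtr_sqr normr_id; apply: rV_norm_le; first exact: sqrtr_ge0.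
move=> i; rewrite -sqrtr_sqr ler_sqrt; last exact: dot_ge0.
rewrite expr2 /dot (bigD1 i) //= lerDl.
by apply: sumr_ge0 => j _; rewrite -expr2 sqr_ge0.
Qed.

End Dot.

Section Instances.
Context (R : realType).

Lemma idfun_rV_bounded n : exists2 C : R, 0 < C &
  forall v : 'rV[R]_n, `|(idfun : {linear _ -> _}) v| <= C * `|v|.
Proof. by exists 1 => // v; rewrite mul1r. Qed.

Definition fdim_rV n : fdim 'rV[R]_n :=
  @Fdim R _ n idfun idfun (fun _ => erefl) (fun _ => erefl) (idfun_rV_bounded n).

Definition fdimR_co (t : R) : 'rV[R]_1 := const_mx t.

Lemma fdimR_co_linear : linear fdimR_co.
Proof. by move=> a x y; apply/rowP => i; rewrite !mxE. Qed.

HB.instance Definition _ := GRing.isLinear.Build R R 'rV[R]_1 _ fdimR_co fdimR_co_linear.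

Definition fdimR_oc (u : 'rV[R]_1) : R := u 0 0.

Lemma fdimR_oc_linear : linear fdimR_oc.
Proof. by move=> a x y; rewrite /fdimR_oc !mxE. Qed.

HB.instance Definition _ := GRing.isLinear.Build R 'rV[R]_1 R _ fdimR_oc fdimR_oc_linear.

Lemma fdimR_coK : cancel fdimR_co fdimR_oc.
Proof. by move=> t; rewrite /fdimR_oc mxE. Qed.

Lemma fdimR_ocK : cancel fdimR_oc fdimR_co.
Proof. by move=> u; apply/rowP => i; rewrite mxE (ord1 i). Qed.

Lemma fdimR_co_bounded : exists2 C : R, 0 < C & forall v, `|fdimR_co v| <= C * `|v|.
Proof. by exists 1 => // v; rewrite mul1r; apply: rV_norm_le => // i; rewrite mxE. Qed.

Definition fdim_R : fdim R := Fdim fdimR_coK fdimR_ocK fdimR_co_bounded.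

Section Prod.
Context (V W : normedModType R) (DV : fdim V) (DW : fdim W).

Definition fdimP_co (p : V * W) : 'rV[R]_(fd DV + fd DW) :=
  row_mx (co DV p.1) (co DW p.2).

Lemma fdimP_co_linear : linear fdimP_co.
Proof.
by move=> a x y; rewrite /fdimP_co scale_row_mx add_row_mx !linearP.
Qed.

HB.instance Definition _ :=
  GRing.isLinear.Build R (V * W)%type 'rV[R]_(fd DV + fd DW) _ fdimP_co fdimP_co_linear.

Definition fdimP_oc (u : 'rV[R]_(fd DV + fd DW)) : V * W :=
  (oc DV (lsubmx u), oc DW (rsubmx u)).

Lemma fdimP_oc_linear : linear fdimP_oc.
Proof. by move=> a x y; rewrite /fdimP_oc !linearP. Qed.

HB.instance Definition _ :=
  GRing.isLinear.Build R 'rV[R]_(fd DV + fd DW) (V * W)%type _ fdimP_oc fdimP_oc_linear.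

Lemma fdimP_coK : cancel fdimP_co fdimP_oc.
Proof. by move=> [v w]; rewrite /fdimP_oc row_mxKl row_mxKr !coK. Qed.

Lemma fdimP_ocK : cancel fdimP_oc fdimP_co.
Proof. by move=> u; rewrite /fdimP_co /= !ocK hsubmxK. Qed.

Lemma prod_norm_fst (p : V * W) : `|p.1| <= `|p|.
Proof. by rewrite prod_normE le_max lexx. Qed.

Lemma prod_norm_snd (p : V * W) : `|p.2| <= `|p|.
Proof. by rewrite prod_normE le_max lexx orbT. Qed.

Lemma prod_norm_le_add (p : V * W) : `|p| <= `|p.1| + `|p.2|.
Proof. by rewrite prod_normE ge_max lerDl lerDr !normr_ge0. Qed.

Lemma fdimP_co_bounded :
  exists2 C : R, 0 < C & forall v, `|fdimP_co v| <= C * `|v|.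
Proof.
have [C1 C10 H1] := co_bounded DV; have [C2 C20 H2] := co_bounded DW.
exists (C1 + C2); first exact: addr_gt0.
move=> p; apply: rV_norm_le.
  by rewrite mulr_ge0 ?addr_ge0 // ltW.
move=> i; rewrite -(splitK i); case: (fintype.split i) => j /=.
- rewrite row_mxEl; apply: (le_trans (rV_coord_le _ _)).
  apply: (le_trans (H1 _)); rewrite mulrDl; apply: ler_wpDr.
    by rewrite mulr_ge0 // ltW.
  by rewrite ler_pM2l // prod_norm_fst.
- rewrite row_mxEr; apply: (le_trans (rV_coord_le _ _)).
  apply: (le_trans (H2 _)); rewrite mulrDl; apply: ler_wpDl.
    by rewrite mulr_ge0 // ltW.
  by rewrite ler_pM2l // prod_norm_snd.
Qed.

Definition fdim_prod : fdim (V * W)%type :=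
  @Fdim R (V * W)%type _ fdimP_co fdimP_oc fdimP_coK fdimP_ocK fdimP_co_bounded.

End Prod.
End Instances.

Section InnerProduct.
Context (R : realType) (V : normedModType R) (D : fdim V).
Implicit Types u v w : V.

(** The norm of [V] may differ from the one induced by [ip]; [ip_bound] and [norm_le_ip] compare the
    two. On row vectors [ip] is [dot], and suitable coordinates on the algebra make it [jip]. *)
Definition ip u v : R := dot (co D u) (co D v).

Lemma ipC u v : ip u v = ip v u. Proof. exact: dotC. Qed.

Lemma ipDl u v w : ip (u + v) w = ip u w + ip v w.
Proof. by rewrite /ip linearD dotDl. Qed.

Lemma ipZl a u w : ip (a *: u) w = a * ip u w.
Proof. by rewrite /ip linearZ dotZl. Qed.

Lemma ipDr u v w : ip u (v + w) = ip u v + ip u w.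
Proof. by rewrite ipC ipDl !(ipC _ u). Qed.

Lemma ipZr a u w : ip u (a *: w) = a * ip u w.
Proof. by rewrite ipC ipZl ipC. Qed.

Lemma ipNl u w : ip (- u) w = - ip u w.
Proof. by rewrite -scaleN1r ipZl mulN1r. Qed.

Lemma ipNr u w : ip u (- w) = - ip u w.
Proof. by rewrite ipC ipNl ipC. Qed.

Lemma ipBl u v w : ip (u - v) w = ip u w - ip v w.
Proof. by rewrite ipDl ipNl. Qed.

Lemma ip0l w : ip 0 w = 0.
Proof. by rewrite -(scale0r 0) ipZl mul0r. Qed.

Lemma ip0r w : ip w 0 = 0.
Proof. by rewrite ipC ip0l. Qed.

Lemma ip_ge0 u : 0 <= ip u u. Proof. exact: dot_ge0. Qed.

Lemma ip_eq0 u : ip u u = 0 -> u = 0.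
Proof. by move/dot_eq0 => u0; rewrite -(coK D u) u0 linear0. Qed.

Lemma ip_bound : exists2 C : R, 0 < C & forall u v, `|ip u v| <= C * `|u| * `|v|.
Proof.
have [C C0 coC] := co_bounded D.
exists (((fd D).+1)%:R * C * C); first by rewrite !mulr_gt0.
move=> u v; apply: (le_trans (dot_le _ _)).
apply: (@le_trans _ _ ((fd D).+1%:R * (C * `|u|) * (C * `|v|))).
  by rewrite ler_pM ?mulr_ge0 // ler_pM // ler_nat.
by rewrite le_eqVlt; apply/orP; left; apply/eqP; ring.
Qed.

Lemma norm_le_ip : exists2 C : R, 0 < C & forall u, `|u| ^+ 2 <= C * ip u u.
Proof.
have [C C0 ocC] := linear_rV_bounded (oc D).
exists (C ^+ 2); first by rewrite exprn_gt0.
move=> u; apply: (@le_trans _ _ (C ^+ 2 * `|co D u| ^+ 2)); last first.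
  by rewrite ler_pM2l ?exprn_gt0 // norm_le_dot.
rewrite -exprMn -{1}(coK D u) ler_sqr ?nnegrE ?mulr_ge0 //.
exact: ltW.
Qed.

Definition basis (i : 'I_(fd D)) : V := oc D (delta_mx 0 i).

Lemma basis_sum u : u = \sum_i co D u 0 i *: basis i.
Proof.
rewrite -{1}(coK D u) {1}(row_sum_delta (co D u)) linear_sum.
by apply: eq_bigr => i _; rewrite linearZ.
Qed.

Lemma ip_basis i u : ip (basis i) u = co D u 0 i.
Proof.
rewrite /ip /basis ocK /dot (bigD1 i) //= mxE !eqxx mul1r big1 ?addr0 // => j ji.
by rewrite mxE (negPf ji) andbF mul0r.
Qed.

Definition riesz (l : V -> R) : V := \sum_i l (basis i) *: basis i.

Lemma rieszP (l : {linear V -> R}) u : ip (riesz l) u = l u.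
Proof.
rewrite {2}(basis_sum u) linear_sum /riesz.
rewrite (big_morph (ip^~ u) (fun x y => ipDl x y u) (ip0l u)).
by apply: eq_bigr => i _; rewrite ipZl ip_basis linearZ mulrC.
Qed.

End InnerProduct.

Arguments basis {R V} D i.

Section LinearAlgebra.
Context (R : realType) (V W : normedModType R) (DV : fdim V) (DW : fdim W).

(** By compactness [|T v|] attains a minimum on the unit sphere, positive by injectivity. The sphere
    is empty when [V] is zero. *)
Lemma linear_bounded_below (T : {linear V -> W}) :
  (forall v, T v = 0 -> v = 0) ->
  exists2 c : R, 0 < c & forall v, c * `|v| <= `|T v|.
Proof.
move=> T0; pose S := [set v : V | `|v| = 1].
have cn : continuous (fun v : V => `|v|) by move=> v; apply: cvg_norm; exact: cvg_id.
have Scl : closed S.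
  rewrite (_ : S = (fun v : V => `|v|) @^-1` [set 1]) //.
  by apply: preimage_closed => // v _; exact: cn.
have normS v : v != 0 -> S (`|v|^-1 *: v).
  by move=> v0; rewrite /S /= normrZ normfV normr_id mulVf // normr_eq0.
have [S0|/set0P Sn0] := eqVneq S set0.
  exists 1 => // v; have [->|/normS] := eqVneq v 0; first by rewrite normr0 mulr0.
  by rewrite S0.
have [|x _|v0 Sv0 min] := @fdim_min R V DV S 1 (fun v => `|T v|) Scl _ Sn0.
- by move=> x ->.
- by apply: cvg_norm; exact: (fdim_linear_continuous DV).
exists `|T v0|.
  rewrite normr_gt0; apply/eqP => /T0 v00; move: Sv0.
  by rewrite /S /= v00 normr0 => /esym/eqP; rewrite oner_eq0.
move=> v; have [->|vn0] := eqVneq v 0; first by rewrite normr0 mulr0.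
have := min _ (normS _ vn0); rewrite linearZ normrZ normfV normr_id.
by rewrite mulrC ler_pdivlMr ?normr_gt0.
Qed.

Lemma linear_injective_surjective (T : {linear V -> W}) :
  fd DV = fd DW -> (forall v, T v = 0 -> v = 0) -> forall w, exists v, T v = w.
Proof.
move=> eqd T0 w; pose M := lin1_mx (co DW \o T \o oc DV).
have ME u : u *m M = co DW (T (oc DV u)) by rewrite mul_rV_lin1.
have Mfree : row_free M.
  rewrite -kermx_eq0; apply/eqP/row_matrixP => i; rewrite row0.
  have : row i (kermx M) *m M = 0 by rewrite -row_mul mulmx_ker row0.
  rewrite ME => /(congr1 (oc DW)); rewrite coK linear0 => /T0 /(congr1 (co DV)).
  by rewrite ocK linear0.
have Mfull : row_full M by rewrite /row_full (eqP Mfree) eqd.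
have [B BM] := row_fullP Mfull.
exists (oc DV (co DW w *m B)); rewrite -[LHS](coK DW) -ME -mulmxA BM mulmx1.
exact: coK.
Qed.

End LinearAlgebra.

(** * Continuously differentiable maps *)

Section Calculus.
Context (R : realType).

Lemma is_derive_line (V W : normedModType R) (F : V -> W) (p v : V) (t : R) :
  differentiable F (p + t *: v) ->
  is_derive t (1 : R) (fun s : R => F (p + s *: v)) ('d F (p + t *: v) v).
Proof.
move=> dF; have dl : is_diff t (fun s : R => p + s *: v) (fun s => s *: v).
  rewrite (_ : (fun s : R => p + s *: v) = cst p + (fun s : R => s *: v)) //.
  by apply: is_diff_eq; rewrite add0r.
have dFl : is_diff t (F \o (fun s : R => p + s *: v))
    ('d F (p + t *: v) \o (fun s => s *: v)).
  apply: is_diff_comp; exact/differentiableP.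
have dFd : differentiable (F \o (fun s : R => p + s *: v)) t by exact: ex_diff.
apply: DeriveDef; first exact: diff_derivable.
rewrite deriveE //.
rewrite (_ : (fun s : R => F (p + s *: v)) = F \o (fun s : R => p + s *: v)) //.
by rewrite diff_val /= scale1r.
Qed.

(** It suffices to control the differentials on the finitely many basis vectors. In [e] the factor
    [(fd D).+1] keeps the denominator positive in dimension 0. *)
Lemma opnorm_continuous (V W : normedModType R) (D : fdim V) (F : V -> W) x :
  (forall v, {for x, continuous (fun y => 'd F y v : W)}) ->
  forall eta : R, 0 < eta -> exists2 d : R, 0 < d &
    forall y, `|y - x| < d -> forall v, `|'d F y v - 'd F x v| <= eta * `|v|.
Proof.
move=> cF eta eta0; have [C C0 coC] := co_bounded D.
pose e := eta / (C * (fd D).+1%:R).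
have e0 : 0 < e by rewrite divr_gt0 // mulr_gt0.
have : \forall y \near x, forall i, `|'d F y (basis D i) - 'd F x (basis D i)| < e.
  apply: filter_forall => i.
  have /continuousPeps/(_ _ e0)[d d0 H] := cF (basis D i).
  by apply/nbhs_normP; exists d => // y; rewrite /= distrC; exact: H.
move/nbhs_normP => [d /= d0 H]; exists d => // y yx v.
have {}H := H y; rewrite /= distrC in H; have {yx}H := H yx.
have E z : 'd F z v = \sum_i co D v 0 i *: ('d F z (basis D i) : W).
  rewrite {1}(basis_sum D v) linear_sum.
  by apply: eq_bigr => i _; rewrite linearZ.
rewrite !E -sumrB.
apply: (le_trans (ler_norm_sum _ _ _)).
apply: (@le_trans _ _ (\sum_(i < fd D) (C * `|v|) * e)).
  apply: ler_sum => i _; rewrite -scalerBr normrZ ler_pM //; last exact/ltW.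
  by apply: (le_trans (rV_coord_le _ _)); exact: coC.
rewrite sumr_const card_ord -mulr_natl.
apply: (@le_trans _ _ ((fd D).+1%:R * (C * `|v| * e))).
  apply: ler_wpM2r; last by rewrite ler_nat.
  by apply: mulr_ge0; [apply: mulr_ge0 => //|]; exact: ltW.
rewrite /e le_eqVlt; apply/orP; left; apply/eqP.
by field; rewrite nat1r pnatr_eq0 (gt_eqF C0).
Qed.

(** The linear form [l] turns the vector-valued map into a real function on a segment, for which the
    mean value equality holds. *)
Lemma mean_value (V W : normedModType R) (DV : fdim V) (DW : fdim W) (F : V -> W)
  (l : {linear W -> R}) (p q : V) :
  (forall t : R, 0 <= t <= 1 -> differentiable F (p + t *: (q - p))) ->
  exists2 t : R, 0 < t < 1 & l (F q - F p) = l ('d F (p + t *: (q - p)) (q - p)).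
Proof.
move=> dF.
have lF (t : R) : 0 <= t <= 1 -> is_derive t (1 : R) (fun s : R => l (F (p + s *: (q - p))))
    (l ('d F (p + t *: (q - p)) (q - p))).
  move=> t01; have lc : continuous l by exact: (fdim_linear_continuous DW).
  have dl y : differentiable l y by exact: linear_differentiable.
  have := @is_derive_line V _ (l \o F) p (q - p) t.
  rewrite diff_comp //=; last exact: dF.
  rewrite diff_lin //; apply; apply: differentiable_comp => //; exact: dF.
have [||t] := @MVT R (fun s : R => l (F (p + s *: (q - p))))
   (fun s => l ('d F (p + s *: (q - p)) (q - p))) 0 1 ltr01.
- by move=> t; rewrite in_itv /= => /andP[/ltW ? /ltW ?]; apply: lF; apply/andP.
- apply: continuous_in_subspaceT => t; rewrite inE /= in_itv /= => t01.
  apply: differentiable_continuous; apply/derivable1_diffP.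
  exact: (@ex_derive _ _ _ _ _ _ _ (lF t t01)).
rewrite in_itv /= => t01 E; exists t => //.
move: E; rewrite subr0 mulr1 scale1r scale0r addr0 => <-.
by rewrite linearB /= [p + _]addrC subrK.
Qed.

End Calculus.

Section DiffEps.
Context (R : realType) (V W : normedModType R) (D : fdim V) (F : V -> W) (x : V).

Lemma is_diff_eps (df : {linear V -> W}) :
  (forall e : R, 0 < e -> exists2 d : R, 0 < d &
     forall y, `|y - x| < d -> `|F y - F x - df (y - x)| <= e * `|y - x|) ->
  is_diff x F df.
Proof.
move=> H; have dfc : continuous df by exact: (fdim_linear_continuous D).
have E : F \o shift x = cst (F x) + df +o_ (0 : V) id.
  apply/eqaddoP => e e0; have [d d0 Hd] := H _ e0.
  apply/nbhs_normP; exists d => // v; rewrite /= sub0r normrN => vd.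
  have := Hd (v + x); rewrite addrK => /(_ vd).
  by rewrite !fctE /= opprD addrA.
have E' := diff_unique dfc E.
split => //; apply/diff_locallyP; rewrite E'; split => //.
Qed.

Lemma differentiable_eps : differentiable F x ->
  forall e : R, 0 < e -> exists2 d : R, 0 < d &
    forall y, `|y - x| < d -> `|F y - F x - 'd F x (y - x)| <= e * `|y - x|.
Proof.
move=> /diff_locallyP[_ /eqaddoP H] e e0.
have /nbhs_normP[d /= d0 Hd] := H _ e0; exists d => // y yx.
have := Hd (y - x); rewrite /= sub0r normrN => /(_ yx).
by rewrite !fctE /= subrK opprD addrA.
Qed.

End DiffEps.

(** * Local inversion of continuously differentiable maps *)

Section Inverse.
Context (R : realType).

(** Strict differentiability. The mean value equality is applied to each coordinate; the
    intermediate point depends on the coordinate, but it stays in the ball by convexity. *)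
Lemma C1_strict (V W : normedModType R) (DV : fdim V) (DW : fdim W) (F : V -> W) :
  C1_on setT F -> forall x (eta : R), 0 < eta -> exists2 d : R, 0 < d &
    forall p q, `|p - x| < d -> `|q - x| < d ->
      `|F q - F p - 'd F x (q - p)| <= eta * `|q - p|.
Proof.
move=> FC1 x eta eta0.
have [C C0 coC] := co_bounded DW.
have [B B0 ocB] := linear_rV_bounded (oc DW).
pose e := eta / (B * C); have e0 : 0 < e by rewrite divr_gt0 // mulr_gt0.
have [d d0 Hd] := opnorm_continuous DV (FC1 x I).2 e0.
exists d => // p q px qx.
set w := (X in `|X|); rewrite -(coK DW w).
apply: (le_trans (ocB _)); rewrite -ler_pdivlMl //.
apply: rV_norm_le => [|i].
  by rewrite mulr_ge0 ?invr_ge0 ?mulr_ge0 // ltW.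
pose l : W -> R := fun u => co DW u 0 i.
have l_lin : linear l by move=> a u v; rewrite /l linearP !mxE.
pose lM := GRing.isLinear.Build _ _ _ _ l l_lin.
pose L : {linear W -> R} := HB.pack l lM.
have [|t /andP[t0 t1] E] := @mean_value _ _ _ DV DW F L p q.
  by move=> t _; exact: (FC1 _ I).1.
rewrite -[co DW w 0 i]/(L w) linearB E -linearB /=.
apply: (le_trans (rV_coord_le _ _)); apply: (le_trans (coC _)).
rewrite -ler_pdivlMl //.
have -> : C^-1 * (B^-1 * (eta * `|q - p|)) = e * `|q - p|.
  by rewrite /e; field; rewrite (gt_eqF C0) (gt_eqF B0).
apply: Hd.
have -> : p + t *: (q - p) - x = (1 - t) *: (p - x) + t *: (q - x).
  have -> : q - p = (q - x) - (p - x) by rewrite opprB addrA subrK.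
  by rewrite scalerBl scale1r scalerBr addrAC addrA [RHS]addrAC.
apply: (le_lt_trans (ler_normD _ _)); rewrite !normrZ.
rewrite gtr0_norm ?subr_gt0 // gtr0_norm //.
have -> : d = (1 - t) * d + t * d by ring.
by rewrite ltrD // ltr_pM2l // subr_gt0.
Qed.

(** Half of the lower bound for ['d F x] survives: the other half absorbs the linearization error of
    [F] in the first estimate and the variation of the differential in the second. *)
Lemma C1_locally_bounded_below (V W : normedModType R) (DV : fdim V) (DW : fdim W)
    (F : V -> W) x : C1_on setT F -> (forall v, 'd F x v = 0 -> v = 0) ->
  exists c d : R, [/\ 0 < c, 0 < d,
    forall p q, `|p - x| < d -> `|q - x| < d -> c * `|q - p| <= `|F q - F p| &
    forall p, `|p - x| < d -> forall v, c * `|v| <= `|'d F p v|].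
Proof.
move=> FC1 inj; have [c c0 Hc] := linear_bounded_below DV inj.
have c20 : 0 < c / 2 by rewrite divr_gt0.
have [d1 d10 H1] := C1_strict DV DW FC1 x c20.
have [d2 d20 H2] := opnorm_continuous DV (FC1 x I).2 c20.
exists (c / 2), (Num.min d1 d2); split => //.
- by rewrite lt_min d10 d20.
- move=> p q; rewrite !lt_min => /andP[p1 p2] /andP[q1 q2].
  have := H1 _ _ p1 q1; have := Hc (q - p).
  have := ler_normB (F q - F p) (F q - F p - 'd F x (q - p)).
  rewrite [X in `|X| <= _](_ : _ = 'd F x (q - p)); last by rewrite subKr.
  by lra.
- move=> p; rewrite lt_min => /andP[p1 p2] v.
  have := H2 _ p2 v; have := Hc v.
  have := ler_normB ('d F p v) ('d F p v - 'd F x v); rewrite subKr.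
  by lra.
Qed.

(** The form of the inverse function theorem that fits solutions found by minimization: [q] is
    given, and its regularity is deduced from that of [F \o q]. The derivative of [q] solves
    ['d F (q x) (A v) = 'd (F \o q) x v], which is possible since ['d F (q x)] is injective between
    spaces of equal dimension. *)
Lemma C1_inverse (P Q S : normedModType R) (DP : fdim P) (DQ : fdim Q)
    (DS : fdim S) (F : P -> Q) (c : R) (U : set P) (O : set S) (q : S -> P) :
  fd DP = fd DQ -> C1_on setT F -> 0 < c ->
  (forall p p', U p -> U p' -> c * `|p' - p| <= `|F p' - F p|) ->
  (forall p, U p -> forall v, c * `|v| <= `|'d F p v|) ->
  open O -> (forall x, O x -> U (q x)) -> C1_on O (F \o q) -> C1_on O q.
Proof.
move=> eqd FC1 c0 Hc Hd Oop qU GC1.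
have inj p : U p -> forall v, 'd F p v = 0 -> v = 0.
  move=> Up v v0; have := Hd _ Up v; rewrite v0 normr0.
  by rewrite pmulr_rle0 // normr_le0 => /eqP.
have nearO x : O x -> exists2 d : R, 0 < d & forall y, `|y - x| < d -> O y.
  move=> Ox; have /nbhs_normP[d /= d0 H] : nbhs x O by apply: open_nbhs_nbhs.
  by exists d => // y yx; apply: H; rewrite /= distrC.
have qc x : O x -> {for x, continuous q}.
  move=> Ox; apply/continuousPeps => e e0.
  have /differentiable_continuous/continuousPeps Gc := (GC1 x Ox).1.
  have [d1 d10 H1] := Gc _ (mulr_gt0 c0 e0); have [d2 d20 H2] := nearO _ Ox.
  exists (Num.min d1 d2); first by rewrite lt_min d10.
  move=> y; rewrite lt_min => /andP[/H1 y1 /H2 Oy].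
  rewrite -(ltr_pM2l c0); apply: le_lt_trans y1; apply: Hc; exact: qU.
have qd x : O x -> exists2 A : {linear S -> P}, is_diff x q A &
    forall v, 'd F (q x) (A v) = 'd (F \o q) x v.
  move=> Ox; have surj := linear_injective_surjective eqd (inj _ (qU _ Ox)).
  have /choice[A AE] : forall v, exists u, 'd F (q x) u = 'd (F \o q) x v.
    by move=> v; exact: surj.
  have A_lin : linear A.
    move=> a u v; apply/eqP; rewrite -subr_eq0; apply/eqP; apply: (inj _ (qU _ Ox)).
    by rewrite linearB linearP /= !AE linearP subrr.
  pose AM := GRing.isLinear.Build _ _ _ _ A A_lin.
  pose L : {linear S -> P} := HB.pack A AM.
  exists L => //; apply: (is_diff_eps DS) => e e0.
  have [K K0 HK] := fdim_linear_bounded DS ('d (F \o q) x).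
  (* [K'] is a Lipschitz constant of [q] at [x]: near [x] the composite moves by at most
     [(K + 1) * |y - x|]. It converts the remainder of [F] at [q x], small relative to
     [|q y - q x|], into one relative to [|y - x|]. *)
  pose K' := (K + 1) / c.
  have K'0 : 0 < K' by rewrite divr_gt0 // addr_gt0.
  pose e1 := c * e / 2 / K'; pose e2 := c * e / 2.
  have e20 : 0 < e2 by rewrite /e2 !divr_gt0 // mulr_gt0.
  have e10 : 0 < e1 by rewrite divr_gt0.
  have [d1 d10 H1] := differentiable_eps (FC1 (q x) I).1 e10.
  have [d2 d20 H2] := differentiable_eps (GC1 x Ox).1 e20.
  have [d3 d30 H3] := differentiable_eps (GC1 x Ox).1 ltr01.
  have [d4 d40 H4] := nearO _ Ox.
  have /continuousPeps/(_ _ d10)[d5 d50 H5] := qc _ Ox.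
  exists (Num.min d2 (Num.min d3 (Num.min d4 d5))); first by rewrite !lt_min d20 d30 d40.
  move=> y; rewrite !lt_min => /and4P[/H2 h2 /H3 h3 /H4 h4 /H5/H1 h1].
  rewrite -(ler_pM2l c0); apply: (le_trans (Hd _ (qU _ Ox) _)).
  rewrite linearB /= AE.
  have qyx : `|q y - q x| <= K' * `|y - x|.
    rewrite /K' mulrAC ler_pdivlMr // mulrC.
    apply: (le_trans (Hc _ _ (qU _ Ox) (qU _ h4))).
    have := ler_normD ('d (F \o q) x (y - x)) (F (q y) - F (q x) - 'd (F \o q) x (y - x)).
    rewrite [X in `|X| <= _ -> _]addrC subrK => /le_trans; apply.
    by rewrite mulrDl; apply: lerD.
  have := ler_normB (F (q y) - F (q x) - 'd (F \o q) x (y - x))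
     (F (q y) - F (q x) - 'd F (q x) (q y - q x)).
  rewrite [X in `|X| <= _ -> _](_ : _ = 'd F (q x) (q y - q x) - 'd (F \o q) x (y - x)).
    move/le_trans; apply.
    have {}h2 : `|F (q y) - F (q x) - 'd (F \o q) x (y - x)| <= e2 * `|y - x| by exact: h2.
    apply: (le_trans (lerD h2 h1)).
    have : e1 * `|q y - q x| <= e1 * (K' * `|y - x|) by rewrite ler_pM2l.
    have -> : e1 * (K' * `|y - x|) = c * e / 2 * `|y - x|.
      by rewrite /e1; field; rewrite (gt_eqF K'0).
    by rewrite /e2; lra.
  by rewrite opprB addrC subrKA.
move=> x Ox; have [A Ad AE] := qd x Ox; split; first exact: ex_diff.
(* Apply ['d F (q y)] to ['d q y v - 'd q x v]: the result is the variation of the derivative of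
   [F \o q] minus the variation of ['d F] on the fixed vector ['d q x v], and each of the two is
   small. *)
move=> v; apply/continuousPeps => e e0.
have e20 : 0 < c * e / 2 by rewrite divr_gt0 // mulr_gt0.
have /continuousPeps/(_ _ e20)[d1 d10 H1] := (GC1 x Ox).2 v.
have [d2 d20 H2] := nearO _ Ox.
have /continuousPeps/(_ _ e20)[d3 d30 H3] := (FC1 (q x) I).2 ('d q x v).
have /continuousPeps/(_ _ d30)[d4 d40 H4] := qc _ Ox.
exists (Num.min d1 (Num.min d2 d4)); first by rewrite !lt_min d10 d20.
move=> y; rewrite !lt_min => /and3P[/H1 h1 /H2 Oy /H4/H3 h3].
have [B Bd BE] := qd y Oy.
rewrite -(ltr_pM2l c0); apply: (le_lt_trans (Hd _ (qU _ Oy) _)).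
have EA : 'd F (q x) ('d q x v) = 'd (F \o q) x v by rewrite -AE [in LHS](@diff_val _ _ _ _ _ _ _ Ad).
have EB : 'd F (q y) ('d q y v) = 'd (F \o q) y v by rewrite -BE [in LHS](@diff_val _ _ _ _ _ _ _ Bd).
rewrite linearB /= EB.
have := ler_normB ('d (F \o q) y v - 'd (F \o q) x v)
   ('d F (q y) ('d q x v) - 'd F (q x) ('d q x v)).
rewrite -EA [X in `|X| <= _ -> _](_ : _ = 'd (F \o q) y v - 'd F (q y) ('d q x v)).
  by move/le_lt_trans; apply; move: h1 h3; rewrite -EA; lra.
by rewrite opprB addrA subrK.
Qed.

End Inverse.


Section C1Closure.
Context (R : realType).

(** Carrying the derivative along lets the closure properties below compute it. Returning to [C1_on]
    requires [O] open, since the differential must agree with [dF] on a neighbourhood. *)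
Definition has_C1 (V W : normedModType R) (O : set V) (F : V -> W)
    (dF : V -> V -> W) : Prop :=
  forall x, O x -> is_diff x F (dF x) /\
    forall v, {for x, continuous (fun y => dF y v)}.

Lemma C1_on_has (V W : normedModType R) (O : set V) (F : V -> W) :
  C1_on O F -> has_C1 O F (fun x => 'd F x).
Proof. by move=> FC1 x /FC1[dF cF]; split => //; exact/differentiableP. Qed.

Lemma has_C1_on (V W : normedModType R) (O : set V) (F : V -> W) dF :
  open O -> has_C1 O F dF -> C1_on O F.
Proof.
move=> Oop FC1 x Ox; have [dFx cFx] := FC1 x Ox; split; first exact: ex_diff.
move=> v; change ('d F y v @[y --> x] --> 'd F x v).
have -> : 'd F x v = dF x v by rewrite (@diff_val _ _ _ _ _ _ _ dFx).
apply: cvg_trans (cFx v); apply: near_eq_cvg.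
have : nbhs x O by apply: open_nbhs_nbhs.
by apply: filterS => y /FC1[dFy _]; rewrite (@diff_val _ _ _ _ _ _ _ dFy).
Qed.

Lemma has_C1_ext (V W : normedModType R) (O : set V) (F : V -> W) dF dF' :
  has_C1 O F dF -> (forall x v, dF x v = dF' x v) -> has_C1 O F dF'.
Proof.
move=> FC E; suff <- : dF = dF' by [].
by apply/funext => x; apply/funext => v.
Qed.

Lemma has_C1_cst (V W : normedModType R) (O : set V) (c : W) :
  has_C1 O (fun _ : V => c) (fun _ _ => 0).
Proof. by move=> x _; split=> [|v]; [exact: is_diff_cst|exact: cvg_cst]. Qed.

Lemma has_C1_add (V W : normedModType R) (O : set V) (F G : V -> W) dF dG :
  has_C1 O F dF -> has_C1 O G dG ->
  has_C1 O (fun x => F x + G x) (fun x v => dF x v + dG x v).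
Proof.
move=> FC GC x Ox; have [dFx cF] := FC x Ox; have [dGx cG] := GC x Ox.
by split=> [|v]; [exact: is_diffD|apply: cvgD; [exact: cF|exact: cG]].
Qed.

Lemma has_C1_linear (V W : normedModType R) (D : fdim V) (O : set V)
    (T : {linear V -> W}) : has_C1 O T (fun _ => T).
Proof.
move=> x _; have Tc : continuous (T : V -> W) by exact: (fdim_linear_continuous D).
split=> [|v]; last exact: cvg_cst.
by apply: DiffDef; [exact: linear_differentiable|rewrite diff_lin].
Qed.

Lemma has_C1_post (V W X : normedModType R) (D : fdim W) (T : {linear W -> X})
    (O : set V) (F : V -> W) dF :
  has_C1 O F dF -> has_C1 O (fun x => T (F x)) (fun x v => T (dF x v)).
Proof.
move=> FC x Ox; have [dFx cF] := FC x Ox.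
have [dT _] := has_C1_linear D T (I : setT (F x)).
split=> [|v]; first exact: is_diff_comp.
by apply: continuous_comp; [exact: cF|exact: (fdim_linear_continuous D)].
Qed.

Lemma has_C1_pre (V W X : normedModType R) (D : fdim X) (T : {linear X -> V})
    (O : set V) (F : V -> W) dF :
  has_C1 O F dF -> has_C1 (T @^-1` O) (fun x => F (T x)) (fun x v => dF (T x) (T v)).
Proof.
move=> FC x Ox; have [dFx cF] := FC _ Ox.
have [dT _] := has_C1_linear D T (I : setT x).
split=> [|v]; first exact: is_diff_comp.
apply: (@continuous_comp _ _ _ T (fun y => dF y (T v))).
  exact: (fdim_linear_continuous D).
exact: cF.
Qed.

Section Bilinear.
Context (V1 V2 W : normedModType R) (D1 : fdim V1) (D2 : fdim V2).
Context (B : V1 -> V2 -> W).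
Context (Bl : forall b, linear (B^~ b)) (Br : forall a, linear (B a)).

Lemma bilinear_bounded :
  exists2 C : R, 0 < C & forall a b, `|B a b| <= C * `|a| * `|b|.
Proof.
pose T i : {linear V2 -> W} := HB.pack (B (basis D1 i))
  (GRing.isLinear.Build _ _ _ _ _ (Br (basis D1 i))).
have /choice[C HC] : forall i, exists c : R, 0 < c /\ forall b, `|B (basis D1 i) b| <= c * `|b|.
  by move=> i; have [c c0 Hc] := fdim_linear_bounded D2 (T i); exists c.
have [K K0 HK] := co_bounded D1.
have S0 : 0 <= \sum_i C i by apply: sumr_ge0 => i _; exact/ltW/(HC i).1.
exists (K * (1 + \sum_i C i)); first by rewrite mulr_gt0 // ltr_wpDr.
move=> a b.
pose Tb : {linear V1 -> W} := HB.pack (B^~ b) (GRing.isLinear.Build _ _ _ _ _ (Bl b)).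
rewrite -[B a b]/(Tb a) {1}(basis_sum D1 a) linear_sum.
apply: (le_trans (ler_norm_sum _ _ _)).
apply: (@le_trans _ _ (\sum_i K * `|a| * (C i * `|b|))).
  apply: ler_sum => i _; rewrite linearZ normrZ; apply: ler_pM => //.
    by apply: (le_trans (rV_coord_le _ _)); exact: HK.
  exact: (HC i).2.
rewrite -mulr_sumr -mulr_suml.
have -> : K * (1 + \sum_i C i) * `|a| * `|b| =
  K * `|a| * ((1 + \sum_i C i) * `|b|) by ring.
apply: ler_wpM2l; first by rewrite mulr_ge0 // ltW.
by apply: ler_wpM2r => //; rewrite lerDr.
Qed.

(** The remainder is exactly [B (q.1 - p.1) (q.2 - p.2)], hence of second order. *)
Lemma is_diff_bilinear (p : V1 * V2) :
  is_diff p (fun q : V1 * V2 => B q.1 q.2) (fun q => B p.1 q.2 + B q.1 p.2).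
Proof.
have [C C0 HC] := bilinear_bounded.
pose T (q : V1 * V2) := B p.1 q.2 + B q.1 p.2.
have T_lin : linear T.
  by move=> a u v; rewrite /T /= Br Bl scalerDr addrACA.
pose L : {linear (V1 * V2)%type -> W} := HB.pack T (GRing.isLinear.Build _ _ _ _ _ T_lin).
apply: (@is_diff_eps _ _ _ (fdim_prod D1 D2) _ _ L) => e e0.
exists (e / C) => [|q qp]; first exact: divr_gt0.
rewrite /= /T.
have Bl1 a b c : B (a - b) c = B a c - B b c.
  by rewrite -[b]opprK -scaleN1r addrC opprK Bl scaleN1r addrC.
have Br1 a b c : B a (b - c) = B a b - B a c.
  by rewrite -[c]opprK -scaleN1r addrC opprK Br scaleN1r addrC.
have -> : B q.1 q.2 - B p.1 p.2 - (B p.1 (q.2 - p.2) + B (q.1 - p.1) p.2) =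
   B (q.1 - p.1) (q.2 - p.2).
  by rewrite !Br1 !Bl1 opprD !opprB addrA subrKA.
apply: (le_trans (HC _ _)).
have q1 : `|q.1 - p.1| <= `|q - p| by exact: (prod_norm_fst (q - p)).
have q2 : `|q.2 - p.2| <= `|q - p| by exact: (prod_norm_snd (q - p)).
have Ce : C * `|q - p| <= e by rewrite mulrC -ler_pdivlMr // ltW.
apply: ler_pM => //; first by rewrite mulr_ge0 // ltW.
by apply: le_trans Ce; rewrite ler_pM2l.
Qed.

Lemma has_C1_bilinear (V : normedModType R) (O : set V) (F : V -> V1) (G : V -> V2)
    dF dG : has_C1 O F dF -> has_C1 O G dG ->
  has_C1 O (fun x => B (F x) (G x)) (fun x v => B (F x) (dG x v) + B (dF x v) (G x)).
Proof.
move=> FC GC x Ox; have [dFx cF] := FC x Ox; have [dGx cG] := GC x Ox.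
have Bc : continuous (fun q : V1 * V2 => B q.1 q.2).
  move=> p; have := is_diff_bilinear p => -[dB _].
  exact: differentiable_continuous dB.
have cB (T : V -> V1) (S : V -> V2) : {for x, continuous T} -> {for x, continuous S} ->
    {for x, continuous (fun y => B (T y) (S y))}.
  move=> cT cS.
  apply: (@continuous_comp _ _ _ (fun y => (T y, S y)) (fun q : V1 * V2 => B q.1 q.2)).
    exact: cvg_pair.
  exact: Bc.
split=> [|v].
  have dP : is_diff x (fun y => (F y, G y)) (fun v => (dF x v, dG x v)).
    exact: is_diff_pair.
  exact: (@is_diff_comp _ _ _ _ (fun y => (F y, G y)) _ _ _ x dP (is_diff_bilinear _)).
have Fc : {for x, continuous F} by exact: differentiable_continuous (ex_diff (is_diff_def:=dFx)).
have Gc : {for x, continuous G} by exact: differentiable_continuous (ex_diff (is_diff_def:=dGx)).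
apply: cvgD.
  by apply: (cB F (fun y => dG y v)) => //; exact: cG.
by apply: (cB (fun y => dF y v) G) => //; exact: cF.
Qed.

End Bilinear.
End C1Closure.

Section LocalSolvability.
Context (R : realType).

Lemma has_C1_sum (V W : normedModType R) (O : set V) (I : Type) (r : seq I)
    (F : I -> V -> W) dF : (forall i, has_C1 O (F i) (dF i)) ->
  has_C1 O (fun x => \sum_(i <- r) F i x) (fun x v => \sum_(i <- r) dF i x v).
Proof.
move=> FC; elim: r => [|i r IH].
  have -> : (fun x => \sum_(i <- [::]) F i x) = fun=> 0.
    by apply/funext => x; rewrite big_nil.
  by apply: has_C1_ext (has_C1_cst _) _ => x v; rewrite big_nil.
have -> : (fun x => \sum_(j <- i :: r) F j x) = fun x => F i x + \sum_(j <- r) F j x.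
  by apply/funext => x; rewrite big_cons.
by apply: has_C1_ext (has_C1_add (FC i) IH) _ => x v; rewrite big_cons.
Qed.

Lemma diff_local_min (V : normedModType R) (phi : V -> R) (a : V) (d : R) :
  0 < d -> differentiable phi a ->
  (forall y, `|y - a| < d -> phi a <= phi y) -> forall v, 'd phi a v = 0.
Proof.
move=> d0 dphi amin.
suff ge0 v : 0 <= 'd phi a v.
  move=> v; have h1 := ge0 v; have h2 : 0 <= - ('d phi a v : R).
    by have <- : 'd phi a (- v) = - 'd phi a v by exact: linearN.
  by apply/eqP; rewrite eq_le h1 -oppr_ge0 h2.
apply/ler_addgt0Pr => e; rewrite -[e]/(e : R) => e0; have v1 : 0 < `|v| + 1 by rewrite ltr_wpDl.
have [d' d'0 H] := differentiable_eps dphi (divr_gt0 e0 v1).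
have [mm [mm0 md md']] : exists mm : R, [/\ 0 < mm, mm <= d & mm <= d'].
  by exists (Num.min d d'); rewrite lt_min d0 d'0 !ge_min !lexx orbT.
pose t : R := mm / 2 / (`|v| + 1).
have t0 : 0 < t by rewrite !divr_gt0.
have tE : t * `|v| < mm.
  apply: (@lt_le_trans _ _ (t * (`|v| + 1))); first by rewrite ltr_pM2l // ltrDl.
  by rewrite /t divfK ?(gt_eqF v1) //; lra.
have td := lt_le_trans tE md; have td' := lt_le_trans tE md'.
have E : `|a + t *: v - a| = t * `|v| by rewrite addrC addKr normrZ gtr0_norm.
have := H (a + t *: v); have := amin (a + t *: v); rewrite E => /(_ td) h1 /(_ td').
rewrite [_ + _ - a]addrC addKr linearZ /= => /(le_trans (ler_norm _)) h2.
rewrite -(ler_pM2l t0) mulr0 mulrDr.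
have h3 : e / (`|v| + 1) * (t * `|v|) <= t * e.
  have -> : e / (`|v| + 1) * (t * `|v|) = t * e * (`|v| / (`|v| + 1)).
    by rewrite mulrACA [t * e]mulrC; field; rewrite (gt_eqF v1).
  apply: ler_piMr; first by rewrite mulr_ge0 // ltW.
  by rewrite ler_pdivrMr // mul1r lerDl.
by move: h2 h3; rewrite /GRing.scale /=; lra.
Qed.

Lemma has_C1_ip_sqr (V W : normedModType R) (DW : fdim W) (O : set V) (F : V -> W) dF :
  has_C1 O F dF ->
  has_C1 O (fun x => ip DW (F x) (F x)) (fun x v => 2 * ip DW (F x) (dF x v)).
Proof.
move=> FC; have Bl (b : W) : linear (ip DW ^~ b) by move=> a u v; rewrite ipDl ipZl.
have Br (b : W) : linear (ip DW b) by move=> a u v; rewrite ipDr ipZr.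
apply: has_C1_ext (has_C1_bilinear DW DW Bl Br FC FC) _ => x v.
by rewrite (ipC DW (dF x v)) mulr_natl.
Qed.

(** Minimize [|F - s|^2] over a small closed ball. For small [s] the minimizer [a] is interior,
    because [|F a| >= c |a|] while [|F a|] is of the order of [|s|]. The residual [F a - s] is then
    orthogonal to the range of ['d F a], which is the whole space, so it vanishes. *)
Lemma C1_locally_surjective (V W : normedModType R) (DV : fdim V) (DW : fdim W)
    (F : V -> W) : fd DV = fd DW -> C1_on setT F -> F 0 = 0 ->
  (forall v, 'd F 0 v = 0 -> v = 0) ->
  forall r : R, 0 < r -> exists2 d : R, 0 < d &
    forall s, `|s| < d -> exists2 a, `|a| < r & F a = s.
Proof.
move=> eqd FC1 F0 inj r r0.
have [c [d1 [c0 d10 Hc Hd]]] := C1_locally_bounded_below DV DW FC1 inj.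
have [C1 C10 HC1] := norm_le_ip DW; have [C2 C20 HC2] := ip_bound DW.
pose d' := Num.min r (d1 / 2); have d'0 : 0 < d' by rewrite lt_min r0 divr_gt0.
have d'1 : d' < d1.
  apply: (@le_lt_trans _ _ (d1 / 2)); first by rewrite ge_min lexx orbT.
  by rewrite ltr_pdivrMr // ltr_pMr // ltr1n.
pose K := 1 + C1 * C2.
have K1 : 1 <= K by rewrite lerDl mulr_ge0 // ltW.
(* Chosen so that [c |a| <= |F a| <= (K + 1) |s| < c d']; [K] accounts for the comparison between
   the norm of [W] and [ip]. *)
exists (c * d' / (K + 1)); first by rewrite divr_gt0 ?mulr_gt0 // addr_gt0 // (lt_le_trans ltr01).
move=> s sd.
have FC : has_C1 setT (fun x => F x - s) (fun x => 'd F x).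
  have := has_C1_add (C1_on_has FC1) (has_C1_cst (- s)).
  by move=> /has_C1_ext; apply => x v; rewrite addr0.
have PC := has_C1_ip_sqr DW FC.
have Pd a : is_diff a (fun x => ip DW (F x - s) (F x - s))
    (fun v => 2 * ip DW (F a - s) ('d F a v)) by have [] := PC a I.
have [||a _|a Ba amin] := @fdim_min R V DV [set a | `|a - 0| <= d'] d'
    (fun x => ip DW (F x - s) (F x - s)) (@closed_norm_ball _ _ _ _).
- by move=> a /=; rewrite subr0.
- by exists 0; rewrite /= subrr normr0 ltW.
- have := Pd a => -[? _]; exact: differentiable_continuous.
have {}Ba : `|a| <= d' by move: Ba; rewrite /= subr0.
have FaK : `|F a - s| <= K * `|s|.
  rewrite -ler_sqr ?nnegrE ?mulr_ge0 // ?(le_trans ler01) //.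
  apply: (le_trans (HC1 _)).
  have h1 : ip DW (F a - s) (F a - s) <= C2 * `|s| ^+ 2.
    apply: (@le_trans _ _ (ip DW (F 0 - s) (F 0 - s))).
      by apply: amin; rewrite /= subrr normr0 ltW.
    apply: (le_trans (ler_norm _)); apply: (le_trans (HC2 _ _)).
    by rewrite F0 sub0r normrN expr2 mulrA.
  apply: (@le_trans _ _ (C1 * (C2 * `|s| ^+ 2))); first by rewrite ler_pM2l.
  rewrite mulrA exprMn ler_wpM2r ?sqr_ge0 //.
  apply: (@le_trans _ _ K); first by rewrite lerDr.
  by rewrite expr2 ler_peMr // (le_trans ler01).
have ad : `|a| < d'.
  rewrite -(ltr_pM2l c0).
  have hc : c * `|a| <= `|F a|.
    have := Hc 0 a; rewrite F0 !subr0 normr0; apply => //.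
    exact: le_lt_trans d'1.
  apply: (le_lt_trans hc); rewrite -(subrK s (F a)).
  apply: (le_lt_trans (ler_normD _ _)).
  apply: (@le_lt_trans _ _ ((K + 1) * `|s|)); first by rewrite mulrDl mul1r lerD2r.
  by rewrite mulrC -ltr_pdivlMr // addr_gt0 // (lt_le_trans ltr01).
exists a; first by rewrite (lt_le_trans ad) // ge_min lexx.
have da : 0 < d' - `|a| by rewrite subr_gt0.
have amin' y : `|y - a| < d' - `|a| ->
    ip DW (F a - s) (F a - s) <= ip DW (F y - s) (F y - s).
  move=> ya; apply: amin; rewrite /= subr0 -(subrK a y).
  by apply: (le_trans (ler_normD _ _)); lra.
have st := diff_local_min da (ex_diff (is_diff_def := Pd a)) amin'.
apply/eqP; rewrite -subr_eq0; apply/eqP/(@ip_eq0 _ _ DW).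
have [v vE] : exists v, 'd F a v = F a - s.
  apply: (linear_injective_surjective eqd) => v v0.
  have := Hd a; rewrite subr0 => /(_ (lt_trans ad d'1) v).
  by rewrite v0 normr0 pmulr_rle0 // normr_le0 => /eqP.
have := st v; rewrite (@diff_val _ _ _ _ _ _ _ (Pd a)) vE; lra.
Qed.

End LocalSolvability.

(** * Second order conditions *)

Section SecondOrder.
Context (R : realType) (V W : normedModType R) (DV : fdim V) (DW : fdim W).

Lemma has_C1_continuous (X Y : normedModType R) (O : set X) (F : X -> Y) dF x :
  has_C1 O F dF -> O x -> {for x, continuous F}.
Proof. by move=> FC /FC[[dFx _] _]; exact: differentiable_continuous. Qed.

Lemma ip_linearl (w : V) : linear (ip DV ^~ w).
Proof. by move=> a u v; rewrite ipDl ipZl. Qed.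

Lemma ip_linearr (w : V) : linear (ip DV w).
Proof. by move=> a u v; rewrite ipDr ipZr. Qed.

Lemma has_C1_ip (X : normedModType R) (O : set X) (F G : X -> V) dF dG :
  has_C1 O F dF -> has_C1 O G dG ->
  has_C1 O (fun x => ip DV (F x) (G x))
    (fun x v => ip DV (F x) (dG x v) + ip DV (dF x v) (G x)).
Proof. exact: (has_C1_bilinear DV DV ip_linearl ip_linearr). Qed.

(** Finsler's lemma. On the unit sphere [a + b + |a - b|] is twice the maximum of [a] and [b], and
    its minimum [m] is positive because [b = 0] forces [a > 0]. Where [a <= b], the bound
    [b >= m / 2] lets [rho] compensate [a >= - C K]; elsewhere [a >= m / 2] already. *)
Lemma coercive_on_kernel (A : {linear V -> V}) (T : {linear V -> W}) :
  (forall v, v <> 0 -> T v = 0 -> 0 < ip DV (A v) v) ->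
  exists rho k : R, [/\ 0 < rho, 0 < k & forall v,
    k * `|v| ^+ 2 <= ip DV (A v) v + rho * ip DW (T v) (T v)].
Proof.
move=> pos; pose a v := ip DV (A v) v; pose b v := ip DW (T v) (T v).
have a_ge0 v : 0 <= b v by exact: ip_ge0.
have ac : continuous a.
  move=> v; apply: (@has_C1_continuous _ _ setT _ _ _ _ I).
  exact: (has_C1_ip (has_C1_linear DV A) (has_C1_linear DV (idfun : {linear V -> V}))).
have bc : continuous b.
  move=> v; apply: (@has_C1_continuous _ _ setT _ _ _ _ I).
  exact: (has_C1_ip_sqr DW (has_C1_linear DV T)).
pose S := [set v : V | `|v| = 1].
have cn : continuous (fun v : V => `|v|) by move=> v; apply: cvg_norm; exact: cvg_id.
have Scl : closed S.
  rewrite (_ : S = (fun v : V => `|v|) @^-1` [set 1]) //.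
  by apply: preimage_closed => // v _; exact: cn.
suff [rho [k [rho0 k0 H]]] : exists rho k : R, [/\ 0 < rho, 0 < k &
    forall v, S v -> k <= a v + rho * b v].
  exists rho, k; split => // v; have [->|v0] := eqVneq v 0.
    by rewrite normr0 expr0n mulr0 linear0 ip0l add0r mulr_ge0 ?ip_ge0 // ltW.
  have nv : 0 < `|v| by rewrite normr_gt0.
  have /H : S (`|v|^-1 *: v).
    by rewrite /S /= normrZ normfV normr_id mulVf // gt_eqF.
  rewrite /a /b !linearZ !ipZl !ipZr.
  rewrite -(ler_pM2r (exprn_gt0 2 nv)) => /le_trans; apply.
  rewrite le_eqVlt; apply/orP; left; apply/eqP.
  by field; rewrite gt_eqF.
have [S0|/set0P Sn0] := eqVneq S set0.
  by exists 1, 1; split => // v; rewrite S0.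
have [v Sv|v _|v0 Sv0 min] :=
    @fdim_min R V DV S 1 (fun v => a v + b v + `|a v - b v|) Scl _ Sn0.
- by rewrite Sv.
- apply: cvgD; first by apply: cvgD; [exact: ac|exact: bc].
  by apply: cvg_norm; apply: cvgB; [exact: ac|exact: bc].
set m := a v0 + b v0 + `|a v0 - b v0| in min.
have m0 : 0 < m.
  rewrite /m; have := a_ge0 v0; rewrite le_eqVlt => /orP[/eqP b0|b0]; last first.
    by have := ler_norm (b v0 - a v0); rewrite distrC; lra.
  suff : 0 < a v0 by have := ler_norm (a v0 - b v0); lra.
  apply: pos; last by apply: (ip_eq0 (D := DW)); rewrite -/(b v0).
  by move=> v00; move: Sv0; rewrite /S /= v00 normr0 => /esym/eqP; rewrite oner_eq0.
have [C C0 HC] := ip_bound DV; have [K K0 HK] := fdim_linear_bounded DV A.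
exists ((C * K + m) / (m / 2)), (m / 2); split.
- by rewrite divr_gt0 ?divr_gt0 // addr_gt0 // mulr_gt0.
- by rewrite divr_gt0.
move=> v Sv; have aB : - (C * K) <= a v.
  rewrite lerNl; apply: (le_trans (ler_norm _)); rewrite normrN.
  apply: (le_trans (HC _ _)); rewrite Sv mulr1 ler_pM2l //.
  by apply: (le_trans (HK _)); rewrite Sv mulr1.
have := min v Sv; have [ab|ab] := lerP (a v) (b v).
  move=> mb.
  have {}mb : m / 2 <= b v by lra.
  have : (C * K + m) / (m / 2) * (m / 2) <= (C * K + m) / (m / 2) * b v.
    by rewrite ler_pM2l // divr_gt0 ?divr_gt0 // addr_gt0 // mulr_gt0.
  by rewrite divfK ?gt_eqF ?divr_gt0 //; lra.
move=> ma.
have : 0 <= (C * K + m) / (m / 2) * b v.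
  by rewrite mulr_ge0 // ltW // divr_gt0 ?divr_gt0 // addr_gt0 // mulr_gt0.
by lra.
Qed.

Context (L : V -> R) (LC2 : C2 L).

Definition grad (z : V) : V := riesz DV ('d L z).

Definition dgrad (z v : V) : V :=
  \sum_i 'd (fun y => 'd L y (basis DV i)) z v *: basis DV i.

Lemma grad_ip z v : ip DV (grad z) v = 'd L z v.
Proof. exact: rieszP. Qed.

Lemma has_C1_grad : has_C1 setT grad dgrad.
Proof.
apply: has_C1_sum => i.
have Sl : linear (fun t : R => t *: basis DV i).
  by move=> a u v; rewrite scalerDl scalerA.
pose S : {linear R -> V} := HB.pack (fun t : R => t *: basis DV i)
  (GRing.isLinear.Build _ _ _ _ _ Sl).
exact: (has_C1_post (fdim_R R) S (C1_on_has (LC2.2 (basis DV i)))).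
Qed.

Lemma dgrad_ip z v u : ip DV (dgrad z v) u = 'd (fun y => 'd L y u) z v.
Proof.
pose S : {linear V -> R} := HB.pack (ip DV ^~ u)
  (GRing.isLinear.Build _ _ _ _ _ (ip_linearl u)).
have [dE _] := has_C1_post DV S has_C1_grad (I : setT z).
have -> : (fun y => 'd L y u : R) = (fun y => S (grad y)).
  by apply/funext => y; rewrite /= grad_ip.
by rewrite (@diff_val _ _ _ _ _ _ _ dE).
Qed.

(** Mean value equality for [L] minus half of its Hessian form: at [zs + t *: u] the derivative
    along [u] is the pairing of [u] with [grad (zs + t *: u) - t *: A u], small because the gradient
    is differentiable and vanishes at [zs]. *)
Lemma taylor2_ge (zs : V) : (forall v, 'd L zs v = 0) ->
  forall e : R, 0 < e -> exists2 d : R, 0 < d & forall z, `|z - zs| < d ->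
    L zs + 'd (fun y => 'd L y (z - zs)) zs (z - zs) / 2 - e * `|z - zs| ^+ 2 <= L z.
Proof.
move=> crit e e0; have [C C0 HC] := ip_bound DV.
have [gd _] := has_C1_grad (I : setT zs).
have [d d0 Hd] := differentiable_eps (ex_diff (is_diff_def := gd)) (divr_gt0 e0 C0).
have gs0 : grad zs = 0 by apply: (ip_eq0 (D := DV)); rewrite grad_ip crit.
rewrite (@diff_val _ _ _ _ _ _ _ gd) gs0 in Hd.
exists d => // z zd; pose u := z - zs.
pose A : {linear V -> V} := 'd grad zs.
have AE v : dgrad zs v = A v by rewrite /A (@diff_val _ _ _ _ _ _ _ gd).
have FC : has_C1 setT (fun y : V => y - zs) (fun _ v => v).
  have := has_C1_add (has_C1_linear DV (idfun : {linear V -> V})) (has_C1_cst (O := setT) (- zs)).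
  by move/has_C1_ext; apply => x v; rewrite addr0.
have QC := has_C1_ip (has_C1_post DV A FC) FC.
have Sl : linear (fun t : R => - (t / 2)) by move=> a s t; rewrite /GRing.scale /=; ring.
pose S : {linear R -> R} := HB.pack (fun t : R => - (t / 2)) (GRing.isLinear.Build _ _ _ _ _ Sl).
have PC := has_C1_add (C1_on_has LC2.1) (has_C1_post (fdim_R R) S QC).
have [t _|t /andP[t0 t1]] := @mean_value _ _ _ DV (fdim_R R)
    (fun y => L y + S (ip DV (A (y - zs)) (y - zs))) (idfun : {linear R -> R}) zs z.
  by have [[? _] _] := PC (zs + t *: (z - zs)) I.
have [PCt _] := PC (zs + t *: (z - zs)) I.
rewrite (@diff_val _ _ _ _ _ _ _ PCt) /= => {PCt}.
rewrite -/u subrr linear0 ip0l -dgrad_ip AE -/u [zs + _]addrC addrK.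
have AZ : A (t *: u) = t *: A u by exact: linearZ.
rewrite AZ ipZl ipZr -grad_ip.
have := Hd (zs + t *: u); rewrite [zs + _]addrC addrK subr0 AE => Hd'.
have {}Hd' : `|grad (t *: u + zs) - A (t *: u)| <= e / C * `|t *: u|.
  apply: Hd'; rewrite normrZ gtr0_norm //; apply: le_lt_trans zd.
  by rewrite ler_piMl // ltW.
move=> E; have : `|ip DV (grad (t *: u + zs) - A (t *: u)) u| <= e * `|u| ^+ 2.
  apply: (le_trans (HC _ _)).
  apply: (@le_trans _ _ (C * (e / C * (1 * `|u|)) * `|u|)); last first.
    by rewrite le_eqVlt; apply/orP; left; apply/eqP; field; rewrite gt_eqF.
  apply: ler_wpM2r => //; rewrite ler_pM2l //; apply: (le_trans Hd').
  by rewrite ler_pM2l ?divr_gt0 // normrZ gtr0_norm // ler_wpM2r // ltW.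
rewrite ipBl AZ ipZl ler_norml => /andP[+ _]; move: E.
by lra.
Qed.

End SecondOrder.

(** * Augmented Lagrangians of equality constrained problems *)

Section MoreC1.
Context (R : realType).

Lemma has_C1_pair (V W X : normedModType R) (O : set V) (F : V -> W) (G : V -> X) dF dG :
  has_C1 O F dF -> has_C1 O G dG ->
  has_C1 O (fun x => (F x, G x)) (fun x v => (dF x v, dG x v)).
Proof.
move=> FC GC x Ox; have [dFx cF] := FC x Ox; have [dGx cG] := GC x Ox.
split=> [|v]; first exact: is_diff_pair.
by apply: cvg_pair; [exact: cF|exact: cG].
Qed.

Lemma has_C1_shift (V W : normedModType R) (c : V) (F : V -> W) dF :
  has_C1 setT F dF -> has_C1 setT (fun x => F (x + c)) (fun x => dF (x + c)).
Proof.
move=> FC x _; have [dFx cF] := FC (x + c) I.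
have sc : {for x, continuous (fun y => y + c)}.
  by apply: cvgD; [exact: cvg_id|exact: cvg_cst].
have ds : is_diff x (fun y : V => y + c) (fun v => v).
  rewrite (_ : (fun y => y + c) = (fun y : V => y) + cst c) //.
  by apply: is_diff_eq; apply/funext => v; rewrite addr0.
split=> [|v].
  exact: (@is_diff_comp _ _ _ _ (fun y => y + c) _ _ _ x ds dFx).
by apply: (@continuous_comp _ _ _ (fun y => y + c) (fun y => dF y v)) => //; exact: cF.
Qed.

End MoreC1.

Section NLP.
Context (R : realType) (V W : normedModType R) (DV : fdim V) (DW : fdim W).
Context (L : V -> R) (LC2 : C2 L) (H : V -> W) (HC2 : C2 H) (zs : V).
Context (Hzs : H zs = 0) (crit : forall v, 'd L zs v = 0).
Context (sosc : forall v, v <> 0 -> 'd H zs v = 0 -> 0 < 'd (fun z => 'd L z v) zs v).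
Context (reg : forall q, (forall v, ip DW ('d H zs v) q = 0) -> q = 0).

Lemma lagrangian_growth : exists rho k r : R, [/\ 0 < rho, 0 < k, 0 < r &
  forall z, `|z - zs| <= r ->
    L zs + k * `|z - zs| ^+ 2 <= L z + rho * ip DW (H z) (H z)].
Proof.
pose A : {linear V -> V} := 'd (grad DV L) zs.
have [gd _] := has_C1_grad DV LC2 (I : setT zs).
have AE v u : ip DV (A v) u = 'd (fun y => 'd L y u) zs v.
  by rewrite -(dgrad_ip DV LC2) /A (@diff_val _ _ _ _ _ _ _ gd).
have [|rho [k [rho0 k0 Hk]]] := @coercive_on_kernel _ _ _ DV DW A ('d H zs).
  by move=> v v0 Hv; rewrite AE; exact: sosc.
have [C C0 HC] := ip_bound DW.
(* Coercivity contributes [k / 2]; the Taylor remainder and the linearization of [H] cost [k / 8]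
   each, which leaves [k / 4]. *)
have [d1 d10 H1] := taylor2_ge DV LC2 crit (divr_gt0 k0 (ltr0Sn _ 7)).
(* The entry 1 gives [e2 ^+ 2 <= e2], so the other entry makes [rho * C * e2 ^+ 2] at most
   [k / 8]. *)
pose e2 : R := Num.min 1 (k / (8 * rho * C)).
have rC : 0 < 8 * rho * C by rewrite !mulr_gt0.
have e20 : 0 < e2 by rewrite lt_min ltr01 divr_gt0.
have e2k : rho * C * e2 ^+ 2 <= k / 8.
  apply: (@le_trans _ _ (rho * C * (k / (8 * rho * C)))); last first.
    by rewrite le_eqVlt; apply/orP; left; apply/eqP; field; rewrite !gt_eqF.
  rewrite ler_pM2l ?mulr_gt0 // expr2; apply: (@le_trans _ _ (1 * (k / (8 * rho * C)))).
    by apply: ler_pM; rewrite ?(ltW e20) // ge_min lexx ?orbT.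
  by rewrite mul1r.
have [d2 d20 H2] := differentiable_eps (HC2.1 zs I).1 e20.
pose d : R := Num.min d1 d2; have d0 : 0 < d by rewrite lt_min d10.
exists rho, (k / 4), (d / 2); split; rewrite ?divr_gt0 // => z zd.
have : `|z - zs| < d by apply: le_lt_trans zd _; rewrite ltr_pdivrMr // ltr_pMr // ltr1n.
rewrite lt_min => /andP[/H1 h1 /H2]; rewrite Hzs subr0 => h2.
have := Hk (z - zs); rewrite AE; set u := z - zs in h1 h2 *; set T := 'd H zs u in h2 *.
have h3 : ip DW (H z - T) (H z - T) <= C * e2 ^+ 2 * `|u| ^+ 2.
  apply: (le_trans (ler_norm _)); apply: (le_trans (HC _ _)).
  rewrite -mulrA -[_ * `|H z - T|]expr2 -[leRHS]mulrA ler_pM2l // -exprMn.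
  by rewrite ler_sqr ?nnegrE ?mulr_ge0 // ltW.
have h4 := ip_ge0 DW (H z + (H z - T)).
have h5 : ip DW T T <= 2 * ip DW (H z) (H z) + 2 * ip DW (H z - T) (H z - T).
  move: h4; rewrite !(ipDl, ipDr, ipNl, ipNr) (ipC DW T (H z)); lra.
have h6 : rho * ip DW T T <= rho * (2 * ip DW (H z) (H z) + 2 * (C * e2 ^+ 2 * `|u| ^+ 2)).
  by rewrite ler_pM2l //; apply: (le_trans h5); rewrite lerD2l ler_pM2l.
have h7 : rho * C * e2 ^+ 2 * `|u| ^+ 2 <= k / 8 * `|u| ^+ 2 by rewrite ler_wpM2r ?sqr_ge0.
by move: h1 h6 h7; lra.
Qed.

Definition dadj (z : V) (q : W) : V := \sum_i ip DW ('d H z (basis DV i)) q *: basis DV i.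

Lemma dadj_ip z q v : ip DV (dadj z q) v = ip DW ('d H z v) q.
Proof.
have lin : linear (fun v => ip DW ('d H z v) q).
  by move=> a u w; rewrite linearP ipDl ipZl.
pose S : {linear V -> R} := HB.pack (fun v => ip DW ('d H z v) q)
  (GRing.isLinear.Build _ _ _ _ _ lin).
exact: (rieszP DV S).
Qed.

Lemma dadj_linear z : linear (dadj z).
Proof.
move=> a u v; rewrite /dadj scaler_sumr -big_split; apply: eq_bigr => i _ /=.
by rewrite ipDr ipZr scalerDl scalerA.
Qed.

Definition dadjL z : {linear W -> V} :=
  HB.pack (dadj z) (GRing.isLinear.Build _ _ _ _ _ (dadj_linear z)).

Lemma dadj_inj q : dadj zs q = 0 -> q = 0.
Proof. by move=> q0; apply: reg => v; rewrite -dadj_ip q0 ip0l. Qed.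

(** Restricting [H] to [zs] plus the range of the adjoint yields a square system. Its derivative is
    [DH DH^T], injective because [<DH DH^T v, v>] is the square of [DH^T v] and the adjoint is
    injective by [reg]. *)
Lemma constraint_solvable (r : R) : 0 < r -> exists2 d : R, 0 < d &
  forall s, `|s| < d -> exists2 z, `|z - zs| < r & H z = s.
Proof.
move=> r0; have [K K0 HK] := fdim_linear_bounded DW (dadjL zs).
have FC := has_C1_pre DW (T := dadjL zs) (has_C1_shift zs (C1_on_has HC2.1)).
have [|v|d d0 Hd] := @C1_locally_surjective _ _ _ DW DW (fun a => H (dadjL zs a + zs))
    erefl (has_C1_on openT FC) _ _ _ (divr_gt0 r0 K0).
- by rewrite linear0 add0r.
- have [FC0 _] := FC 0 I; rewrite (@diff_val _ _ _ _ _ _ _ FC0) linear0 add0r => v0.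
  by apply: dadj_inj; apply: (ip_eq0 (D := DV)); rewrite dadj_ip v0 ip0l.
exists d => // s /Hd[a ar <-]; exists (dadjL zs a + zs) => //.
rewrite addrK; apply: (le_lt_trans (HK _)).
by rewrite mulrC -ltr_pdivlMr.
Qed.

(** Expanding the square gives, up to a term free of [z], [L - <H, s / t> + |H|^2 / (2 t)]: the
    augmented Lagrangian with penalty [1 / t] whose multipliers are shifted by [s / t]. *)
Definition penalized (s : W) (t : R) (z : V) : R :=
  L z + ip DW (H z - s) (H z - s) / (2 * t).

(** Two radii, because the problem of the statement is posed over a Euclidean ball in [x] with the
    slack eliminated: its minimizers are known to lie in one ball around [zs], and are compared with
    the points of another, possibly smaller one. *)
Definition penalized_solution (r1 r2 : R) (s : W) (t : R) (z : V) : Prop :=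
  `|z - zs| <= r1 /\ forall z', `|z' - zs| <= r2 -> penalized s t z <= penalized s t z'.

Lemma penalized_solution_near : exists2 r1 : R, 0 < r1 & forall r2 r : R,
  0 < r2 -> 0 < r -> exists d t0 : R, [/\ 0 < d, 0 < t0 & forall (s : W) (t : R) (z : V),
    `|s| < d -> 0 < t <= t0 -> penalized_solution r1 r2 s t z -> `|z - zs| < r].
Proof.
have [rho [k [r1 [rho0 k0 r10 grow]]]] := lagrangian_growth.
have [C C0 HC] := ip_bound DW.
exists r1 => // r2 r r20 r0.
have kr0 : 0 < k * r ^+ 2 / 2 by rewrite divr_gt0 // mulr_gt0 // exprn_gt0.
have /continuousPeps/(_ _ kr0)[d3 d30 H3] : {for zs, continuous L}.
  exact: differentiable_continuous (LC2.1 zs I).1.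
have m0 : 0 < Num.min d3 r2 by rewrite lt_min d30.
have [d1 d10 H1] := constraint_solvable m0.
pose d2 : R := k * r ^+ 2 / 2 / (2 * rho * C).
have rC : 0 < 2 * rho * C by rewrite !mulr_gt0.
(* For [t <= (4 rho)^-1] the weight [1 / (2 t)] is at least [2 rho], so the penalty absorbs
   [rho |H z|^2] up to a multiple of [|s|^2]. The entry 1 bounds [|s|^2] by [|s|], and [d2] keeps
   that term below half of [k r^2]; the other half is left to [L z' - L zs]. *)
exists (Num.min d1 (Num.min 1 d2)), (4 * rho)^-1; split.
- by rewrite !lt_min d10 ltr01 divr_gt0.
- by rewrite invr_gt0 mulr_gt0.
move=> s t z; rewrite !lt_min => /and3P[/H1[z' z's Hz'] s1 s2] /andP[t0 tle] [zr1 zmin].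
move: z's; rewrite lt_min => /andP[/H3 h3 /ltW/zmin].
rewrite /penalized Hz' subrr ip0l mul0r addr0 => h.
have h1 := grow z zr1.
have h2 : ip DW (H z) (H z) <= 2 * ip DW (H z - s) (H z - s) + 2 * ip DW s s.
  have := ip_ge0 DW ((H z - s) - s).
  rewrite !(ipDl, ipDr, ipNl, ipNr) (ipC DW s (H z)); lra.
have h4 : ip DW s s <= C * `|s|.
  apply: (le_trans (ler_norm _)); apply: (le_trans (HC _ _)).
  by rewrite -mulrA ler_pM2l // ler_piMl // ltW.
have h5 : 2 * rho * ip DW (H z - s) (H z - s) <= ip DW (H z - s) (H z - s) / (2 * t).
  rewrite mulrC ler_wpM2l ?ip_ge0 // -[2 * rho]invrK lef_pV2 ?posrE ?invr_gt0 ?mulr_gt0 //.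
  apply: (@le_trans _ _ (2 * (4 * rho)^-1)); first by rewrite ler_pM2l.
  by rewrite le_eqVlt; apply/orP; left; apply/eqP; field; rewrite gt_eqF.
have h6 : 2 * rho * C * `|s| < k * r ^+ 2 / 2.
  by rewrite mulrC -ltr_pdivlMr.
have h7 : rho * ip DW (H z) (H z) <= 
    rho * (2 * ip DW (H z - s) (H z - s) + 2 * (C * `|s|)).
  by rewrite ler_pM2l //; apply: (le_trans h2); rewrite lerD2l ler_pM2l.
have h8 : L z' - L zs < k * r ^+ 2 / 2 by apply: le_lt_trans h3; exact: ler_norm.
have : k * `|z - zs| ^+ 2 < k * r ^+ 2 by lra.
by rewrite ltr_pM2l // ltr_sqr ?nnegrE // ltW.
Qed.

End NLP.

(** * Stability of the stationarity system *)

Section Stability.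
Context (R : realType) (V W : normedModType R) (DV : fdim V) (DW : fdim W).

Lemma has_C1_scale (X : normedModType R) (O : set X) (f : X -> R) (F : X -> W) df dF :
  has_C1 O f df -> has_C1 O F dF ->
  has_C1 O (fun x => f x *: F x) (fun x v => f x *: dF x v + df x v *: F x).
Proof.
apply: (has_C1_bilinear (fdim_R R) DW) => [b|a] c u v.
- by rewrite scalerDl scalerA.
- by rewrite scalerDr !scalerA mulrC.
Qed.

Lemma has_C1_opp (X : normedModType R) (O : set X) (F : X -> W) dF :
  has_C1 O F dF -> has_C1 O (fun x => - F x) (fun x v => - dF x v).
Proof.
move=> FC x Ox; have [dFx cF] := FC x Ox.
by split=> [|v]; [exact: is_diffN|apply: cvgN; exact: cF].
Qed.

Context (L : V -> R) (LC2 : C2 L) (H : V -> W) (HC2 : C2 H) (zs : V).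

Let P := ((V * W) * (W * R))%type.
Let DP : fdim P := fdim_prod (fdim_prod DV DW) (fdim_prod DW (fdim_R R)).

(** The map [G] of the overview. The parameters reappear in the output so that source and target
    have the same dimension and the lower bound measures the dependence of the solution on them. *)
Definition kkt_map (p : P) : P :=
  ((grad DV L p.1.1 + dadj DV DW H p.1.1 p.1.2, H p.1.1 - p.2.1 - p.2.2 *: p.1.2), p.2).

Definition dkkt_map (p v : P) : P :=
  ((dgrad DV L p.1.1 v.1.1 + (dadj DV DW H p.1.1 v.1.2 +
      \sum_i ip DW ('d (fun z => 'd H z (basis DV i)) (p.1.1) v.1.1) p.1.2 *: basis DV i),
    'd H (p.1.1) v.1.1 - v.2.1 - (p.2.2 *: v.1.2 + v.2.2 *: p.1.2)), v.2).

Lemma has_C1_kkt_map : has_C1 setT kkt_map dkkt_map.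
Proof.
pose zL : {linear P -> V} := (fst : {linear (V * W)%type -> V}) \o (fst : {linear P -> _}).
pose qL : {linear P -> W} := (snd : {linear (V * W)%type -> W}) \o (fst : {linear P -> _}).
pose sL : {linear P -> W} := (fst : {linear (W * R)%type -> W}) \o (snd : {linear P -> _}).
pose tL : {linear P -> R} := (snd : {linear (W * R)%type -> R}) \o (snd : {linear P -> _}).
have qC : has_C1 setT qL (fun=> qL) := has_C1_linear DP qL.
apply: has_C1_pair; last exact: (has_C1_linear DP (snd : {linear P -> (W * R)%type})).
apply: has_C1_pair.
  apply: has_C1_add.
    exact: (has_C1_pre DP (T := zL) (has_C1_grad DV LC2)).
  have : has_C1 setT (fun p : P => \sum_i ip DW ('d H (zL p) (basis DV i)) (qL p) *: basis DV i)
     (fun p v => \sum_i (ip DW ('d H (zL p) (basis DV i)) (qL p) *: 0 +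
        (ip DW ('d H (zL p) (basis DV i)) (qL v) +
         ip DW ('d (fun z : V => 'd H z (basis DV i)) (zL p) (zL v)) (qL p)) *: basis DV i)).
    apply: has_C1_sum => i.
    apply: (has_C1_bilinear (fdim_R R) DV (B := fun a b => a *: b)) => [b c u v|a c u v||].
    - by rewrite scalerDl scalerA.
    - by rewrite scalerDr !scalerA mulrC.
    - apply: has_C1_ip => //.
      exact: (has_C1_pre DP (T := zL) (C1_on_has (HC2.2 (basis DV i)))).
    - exact: has_C1_cst.
  move/has_C1_ext; apply => p v; rewrite -big_split; apply: eq_bigr => i _ /=.
  by rewrite scaler0 add0r scalerDl.
have HC := has_C1_add (has_C1_add (has_C1_pre DP (T := zL) (C1_on_has HC2.1))
   (has_C1_opp (has_C1_linear DP sL)))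
   (has_C1_opp (has_C1_scale (has_C1_linear DP tL) qC)).
exact: HC.
Qed.

Context (Hzs : H zs = 0) (crit : forall v, 'd L zs v = 0).
Context (sosc : forall v, v <> 0 -> 'd H zs v = 0 -> 0 < 'd (fun z => 'd L z v) zs v).
Context (reg : forall q, (forall v, ip DW ('d H zs v) q = 0) -> q = 0).

Let p0 : P := ((zs, 0), (0, 0)).

(** At [t = 0] the equations are [DH z = 0] and [L'' z + DH^T q = 0]. Pairing the second with [z]
    gives [<L'' z, z> = 0], so [z = 0] by the second order condition; then [DH^T q = 0], and [q = 0]
    by [reg]. *)
Lemma dkkt_map_inj v : 'd kkt_map p0 v = 0 -> v = 0.
Proof.
have [dG _] := has_C1_kkt_map (I : setT p0).
rewrite (@diff_val _ _ _ _ _ _ _ dG) /dkkt_map /=.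
case: v => [[z q] [s t]] /= [E1 E2 s0 t0]; subst s t.
move: E2; rewrite !(scale0r, addr0, subr0) => E2.
have {}E1 : dgrad DV L zs z + dadj DV DW H zs q = 0.
  move: E1; rewrite big1 ?addr0 // => i _.
  by rewrite ip0r scale0r.
have z0 : z = 0.
  apply/eqP/negPn/negP => /eqP/sosc/(_ E2).
  rewrite -(dgrad_ip DV LC2) -[X in ip _ X]subr0 -{}E1 opprD addNKr ipNl.
  by rewrite dadj_ip E2 ip0l oppr0 ltxx.
suff -> : q = 0 by rewrite z0.
apply: (dadj_inj reg); rewrite -E1 z0.
suff -> : dgrad DV L zs 0 = 0 by rewrite add0r.
by rewrite /dgrad big1 // => i _; rewrite linear0 scale0r.
Qed.

(** The adjoint is injective at [zs], and half of its lower bound persists nearby by continuity of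
    the derivative of [H]. *)
Lemma multiplier_bound : exists c r : R, [/\ 0 < c, 0 < r & forall z q,
  `|z - zs| < r -> c * `|q| <= `|dadj DV DW H z q|].
Proof.
have [c c0 Hc] := linear_bounded_below DW (dadj_inj reg : forall q, dadjL DV DW H zs q = 0 -> q = 0).
have [C C0 HC] := ip_bound DW.
pose B : R := 1 + \sum_i `|basis DV i| ^+ 2.
have B0 : 0 < B by rewrite ltr_wpDr // sumr_ge0.
have e0 : 0 < c / 2 / (C * B) by rewrite !divr_gt0 // mulr_gt0.
have [d d0 Hd] := opnorm_continuous DV (HC2.1 zs I).2 e0.
exists (c / 2), d; split; rewrite ?divr_gt0 // => z q /Hd {}Hd.
have : `|dadj DV DW H z q - dadj DV DW H zs q| <= c / 2 * `|q|.
  rewrite /dadj -sumrB; apply: (le_trans (ler_norm_sum _ _ _)).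
  apply: (@le_trans _ _ (\sum_i (c / 2 / B * `|q|) * `|basis DV i| ^+ 2)).
    apply: ler_sum => i _; rewrite -scalerBl -ipBl normrZ expr2 mulrA.
    apply: ler_wpM2r => //; apply: (le_trans (HC _ _)).
    apply: (@le_trans _ _ (C * (c / 2 / (C * B) * `|basis DV i|) * `|q|)).
      by apply: ler_wpM2r => //; rewrite ler_pM2l.
    by rewrite le_eqVlt; apply/orP; left; apply/eqP; field; rewrite !gt_eqF.
  rewrite -mulr_sumr; apply: (@le_trans _ _ (c / 2 / B * `|q| * B)).
    by apply: ler_wpM2l; [rewrite mulr_ge0 // ltW // !divr_gt0|rewrite lerDr].
  by rewrite le_eqVlt; apply/orP; left; apply/eqP; field; rewrite !gt_eqF.
have := Hc q; have := ler_normB (dadj DV DW H z q) (dadj DV DW H z q - dadj DV DW H zs q).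
rewrite subKr /=; lra.
Qed.

Definition multiplier (s : W) (t : R) (z : V) : W := t^-1 *: (H z - s).

Definition stationary (s : W) (t : R) (z : V) : Prop :=
  grad DV L z + dadj DV DW H z (multiplier s t z) = 0.

Lemma stationary_kkt_map s t z : t != 0 -> stationary s t z ->
  kkt_map ((z, multiplier s t z), (s, t)) = ((0, 0), (s, t)).
Proof.
move=> t0 st; rewrite /kkt_map /= st /multiplier scalerA mulfV // scale1r.
by rewrite subrr.
Qed.

(** For [s = 0] the pair [(zs, 0)] solves the system at every [t]. Comparing with this point, at the
    same [t], makes the error proportional to [|s|] alone instead of [|s| + t]. *)
Lemma kkt_map_p0 t : kkt_map ((zs, 0), (0, t)) = ((0, 0), (0, t)).
Proof.
rewrite /kkt_map /= Hzs scaler0 !subr0; congr ((_, _), _).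
apply: (ip_eq0 (D := DV)); set w := (X in ip _ X X).
by rewrite {1}/w ipDl grad_ip crit dadj_ip ip0r addr0.
Qed.

Lemma stationary_near : exists r c d : R, [/\ 0 < r, 0 < c, 0 < d &
  [/\ forall p p', `|p - p0| < d -> `|p' - p0| < d -> c * `|p' - p| <= `|kkt_map p' - kkt_map p|,
      forall p, `|p - p0| < d -> forall v, c * `|v| <= `|'d kkt_map p v| &
      forall s t z, `|s| < d -> 0 < t < d -> `|z - zs| < r -> stationary s t z ->
        `|((z, multiplier s t z), (s, t)) - p0| < d]].
Proof.
have [c [d [c0 d0 Hc Hd]]] := C1_locally_bounded_below DP DP (has_C1_on openT has_C1_kkt_map) dkkt_map_inj.
have [c1 [r1 [c10 r10 H1]]] := multiplier_bound.
have gs0 : grad DV L zs = 0 by apply: (ip_eq0 (D := DV)); rewrite grad_ip crit.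
have /continuousPeps/(_ _ (mulr_gt0 c10 d0))[r2 r20 H2] : {for zs, continuous (grad DV L)}.
  exact: (has_C1_continuous (has_C1_grad DV LC2)).
exists (Num.min d (Num.min r1 r2)), c, d; split => //; first by rewrite !lt_min d0 r10.
split => // s t z sd /andP[t0 td]; rewrite !lt_min => /and3P[zd /H1 h1 /H2 h2] st.
have qd : `|multiplier s t z| < d.
  rewrite -(ltr_pM2l c10); apply: (le_lt_trans (h1 _)).
  by rewrite -(addKr (grad DV L z) (dadj _ _ _ _ _)) st addr0 normrN -[grad _ _ _]subr0 -gs0.
rewrite !prod_normE /= !subr0 !gt_max zd qd sd /= gtr0_norm //.
Qed.

End Stability.

Section PenalizedStability.
Context (R : realType).

Lemma C1_on_eq (X Y : normedModType R) (D : fdim X) (O : set X) (F G : X -> Y) :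
  open O -> (forall x, O x -> F x = G x) -> C1_on O F -> C1_on O G.
Proof.
move=> Oop FG FC; apply: (@has_C1_on _ _ _ _ _ (fun x => 'd F x)) => // x Ox.
have [dF cF] := FC x Ox; split => //.
have /nbhs_normP[d1 /= d10 H1] : nbhs x O by apply: open_nbhs_nbhs.
apply: (is_diff_eps D) => e e0; have [d d0 H] := differentiable_eps dF e0.
exists (Num.min d d1); first by rewrite lt_min d0.
move=> y; rewrite lt_min => /andP[yd yd1]; rewrite -!FG //; first exact: H.
by apply: H1; rewrite /= distrC.
Qed.

Context (V W : normedModType R) (DV : fdim V) (DW : fdim W).
Context (L : V -> R) (LC2 : C2 L) (H : V -> W) (HC2 : C2 H) (zs : V).
Context (Hzs : H zs = 0) (crit : forall v, 'd L zs v = 0).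
Context (sosc : forall v, v <> 0 -> 'd H zs v = 0 -> 0 < 'd (fun z => 'd L z v) zs v).
Context (reg : forall q, (forall v, ip DW ('d H zs v) q = 0) -> q = 0).

Lemma penalized_local_min_stationary s t z (d : R) : t != 0 -> 0 < d ->
  (forall y, `|y - z| < d -> penalized DW L H s t z <= penalized DW L H s t y) ->
  stationary DV DW L H s t z.
Proof.
move=> t0 d0 zmin.
have HC := has_C1_add (C1_on_has HC2.1) (has_C1_cst (- s)).
have PC := has_C1_add (C1_on_has LC2.1)
   (has_C1_scale (fdim_R R) (has_C1_cst (2 * t)^-1) (has_C1_ip_sqr DW HC)).
have [dP _] := PC z I.
have st := diff_local_min d0 (ex_diff (is_diff_def := dP)) _.
apply: (ip_eq0 (D := DV)); set w := (X in ip _ X _).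
have {}st v : ip DV w v = 0.
  have := st _ v; rewrite (@diff_val _ _ _ _ _ _ _ dP).
  have -> : ip DV w v = 'd L z v + ip DW ('d H z v) (multiplier H s t z).
    by rewrite /w ipDl grad_ip dadj_ip.
  rewrite /multiplier ipZr ipC scale0r !addr0 /GRing.scale /= => <-.
    by congr (_ + _); field; rewrite t0.
  by move=> y /zmin; rewrite /penalized ![_ / _]mulrC.
exact: st.
Qed.

Theorem penalized_solution_stable : exists2 r1 : R, 0 < r1 & forall r2 : R, 0 < r2 ->
  exists d M : R, [/\ 0 < d, 0 < M &
   let sol := penalized_solution DW L H zs r1 r2 in
   [/\ forall s t z z', `|s| < d -> 0 < t < d -> sol s t z -> sol s t z' -> z = z',
       forall s t z, `|s| < d -> 0 < t < d -> sol s t z ->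
         `|z - zs| <= M * `|s| /\ `|multiplier H s t z| <= M * `|s| &
       forall (S : normedModType R) (DS : fdim S) (O : set S) (sigma : S -> W)
         (tau : S -> R) (zeta : S -> V),
         open O -> C1_on O sigma -> C1_on O tau ->
         (forall x, O x -> [/\ `|sigma x| < d, 0 < tau x < d & sol (sigma x) (tau x) (zeta x)]) ->
         C1_on O zeta]].
Proof.
pose P := ((V * W) * (W * R))%type.
pose DP : fdim P := fdim_prod (fdim_prod DV DW) (fdim_prod DW (fdim_R R)).
have [r1 r10 near] := penalized_solution_near DV LC2 HC2 Hzs crit sosc reg.
exists r1 => // r2 r20.
have [r [c [d1 [r0 c0 d10 [Hc Hd Hs]]]]] := stationary_near DV LC2 HC2 crit sosc reg.
(* Within [r] the bounds on [kkt_map] apply; within [r2] the solution is interior to the ball of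
   competitors, hence stationary. *)
have m0 : 0 < Num.min r r2 by rewrite lt_min r0.
have [d2 [t0 [d20 t00 {}near]]] := near r2 _ r20 m0.
exists (Num.min d1 (Num.min d2 t0)), c^-1; split; rewrite ?invr_gt0 ?lt_min ?d10 ?d20 //.
set sol := penalized_solution _ _ _ _ _ _; cbv zeta.
have solP s t z : `|s| < Num.min d1 (Num.min d2 t0) -> 0 < t < Num.min d1 (Num.min d2 t0) ->
    sol s t z -> t != 0 /\ stationary DV DW L H s t z /\
    `|((z, multiplier H s t z), (s, t)) - ((zs, 0), (0, 0))| < d1.
  rewrite !lt_min => /and3P[s1 s2 s3] /andP[tp /and3P[t1 t2 t3]] zsol.
  have := near s t z s2 _ zsol; rewrite tp (ltW t3) => /(_ isT).
  rewrite lt_min => /andP[zr zr2].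
  have st : stationary DV DW L H s t z.
    apply: (@penalized_local_min_stationary _ _ _ (r2 - `|z - zs|)).
    - by rewrite gt_eqF.
    - by rewrite subr_gt0.
    - move=> y yz; apply: zsol.2; rewrite -(subrK z y) -addrA.
      by apply: (le_trans (ler_normD _ _)); lra.
  by rewrite gt_eqF //; split => //; split => //; apply: Hs => //; rewrite tp.
split.
- move=> s t z z' sd td /solP-/(_ sd td)[tn [st pz]] /solP-/(_ sd td)[_ [st' pz']].
  have := Hc _ _ pz pz'; rewrite !(stationary_kkt_map tn) // subrr normr0.
  by rewrite pmulr_rle0 // normr_le0 subr_eq0 => /eqP[].
- move=> s t z sd td /solP-/(_ sd td)[tn [st pz]].
  have pt : `|(((zs, 0), (0, t)) : P) - ((zs, 0), (0, 0))| < d1.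
    rewrite !prod_normE /= !subr0 subrr !normr0 !gt_max d10 /=.
    by move: td; rewrite !lt_min => /and4P[tp ? _ _]; rewrite gtr0_norm.
  have := Hc _ _ pt pz; rewrite (stationary_kkt_map tn) // (kkt_map_p0 _ _ Hzs crit).
  have -> : `|(((0, 0), (s, t)) : P) - ((0, 0), (0, t))| = `|s|.
    rewrite !prod_normE /= !subrr subr0 !normr0 maxxx.
    by rewrite (max_idPl (normr_ge0 s)) (max_idPr (normr_ge0 s)).
  rewrite -ler_pdivlMl // => pzs; split.
    by apply: le_trans pzs; apply: le_trans (prod_norm_fst _); exact: (prod_norm_fst (z - zs, multiplier H s t z - 0)).
  apply: le_trans pzs; apply: le_trans (prod_norm_fst _).
  rewrite -[X in `|X|]subr0.
  exact: (prod_norm_snd (z - zs, multiplier H s t z - 0)).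
- move=> S DS O sigma tau zeta Oop sC tC zsol.
  pose q x : P := ((zeta x, multiplier H (sigma x) (tau x) (zeta x)), (sigma x, tau x)).
  have qC : C1_on O q.
    apply: (C1_inverse DS (DP := DP) (DQ := DP) (F := kkt_map DV DW L H) (c := c)
      (U := [set p | `|p - ((zs, 0), (0, 0))| < d1])) => //.
    + exact: has_C1_on openT (has_C1_kkt_map DV DW LC2 HC2).
    + by move=> x /zsol[sd td /solP-/(_ sd td)[_ []]].
    apply: (@C1_on_eq _ _ DS _ (fun x => (((0, 0), (sigma x, tau x)) : P))) => //.
      by move=> x /zsol[sd td /solP-/(_ sd td)[tn [st _]]]; rewrite /= stationary_kkt_map.
    apply: has_C1_on => //; apply: has_C1_pair; first exact: has_C1_cst.
    by apply: has_C1_pair; exact: C1_on_has.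
  have := has_C1_post DP ((fst : {linear (V * W)%type -> V}) \o (fst : {linear P -> _})) (C1_on_has qC).
  exact: has_C1_on.
Qed.

End PenalizedStability.

(** * Euclidean Jordan algebras *)

Section JordanBasics.
Context (R : realType) (E : normedModType R) (A : euclidean_jordan E).
Implicit Types x y z w : E.

Local Notation ji := (jip A).
Local Notation jm := (jmul A).

Lemma jiC x y : ji x y = ji y x. Proof. exact: jip_sym. Qed.

Lemma jiDl x y w : ji (x + y) w = ji x w + ji y w.
Proof. by have := jip_linear A 1 x y w; rewrite scale1r mul1r. Qed.

Lemma ji0l w : ji 0 w = 0.
Proof. by have := jiDl 0 0 w; rewrite addr0; lra. Qed.

Lemma jiZl a x w : ji (a *: x) w = a * ji x w.
Proof. by have := jip_linear A a x 0 w; rewrite ji0l !addr0. Qed.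

Lemma jiNl x w : ji (- x) w = - ji x w.
Proof. by rewrite -scaleN1r jiZl mulN1r. Qed.

Lemma jiDr x y w : ji w (x + y) = ji w x + ji w y.
Proof. by rewrite !(jiC w) jiDl. Qed.

Lemma jiZr a x w : ji w (a *: x) = a * ji w x.
Proof. by rewrite !(jiC w) jiZl. Qed.

Lemma jiNr x w : ji w (- x) = - ji w x.
Proof. by rewrite !(jiC w) jiNl. Qed.

Lemma ji0r w : ji w 0 = 0.
Proof. by rewrite jiC ji0l. Qed.

Lemma ji_suml (I : Type) (r : seq I) (P : pred I) (F : I -> E) w :
  ji (\sum_(i <- r | P i) F i) w = \sum_(i <- r | P i) ji (F i) w.
Proof. exact: (big_morph (ji^~ w) (fun x y => jiDl x y w) (ji0l w)). Qed.

(** Pairing with an arbitrary vector turns identities of the algebra into real ones, which linear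
    arithmetic can settle. *)
Lemma ji_ext x y : (forall w, ji x w = ji y w) -> x = y.
Proof.
move=> xy; apply/eqP; rewrite -subr_eq0 -normr_eq0 -sqrf_eq0 -(jip_norm A).
by rewrite jiDl jiNl xy subrr.
Qed.

(** Read off from the triangle inequality, the norm being the one induced by the inner product. *)
Lemma ji_cauchy x y : ji x y <= `|x| * `|y|.
Proof.
have := ler_normD x y; rewrite -ler_sqr ?nnegrE ?addr_ge0 // sqrrD -!(jip_norm A).
by rewrite jiDl !jiDr (jiC y x); lra.
Qed.

Lemma ji_abs_cauchy x y : `|ji x y| <= `|x| * `|y|.
Proof.
rewrite ler_norml ji_cauchy andbT lerNl -jiNl; apply: (le_trans (ji_cauchy _ _)).
by rewrite normrN.
Qed.

Lemma jmDl x y w : jm (x + y) w = jm x w + jm y w.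
Proof. by have := jmul_linear A 1 x y w; rewrite !scale1r. Qed.

Lemma jm0l w : jm 0 w = 0.
Proof. by have /eqP := jmDl 0 0 w; rewrite addr0 -subr_eq subrr => /eqP. Qed.

Lemma jmZl a x w : jm (a *: x) w = a *: jm x w.
Proof. by have := jmul_linear A a x 0 w; rewrite jm0l !addr0. Qed.

Lemma jmNl x w : jm (- x) w = - jm x w.
Proof. by rewrite -scaleN1r jmZl scaleN1r. Qed.

Lemma jmDr x y w : jm w (x + y) = jm w x + jm w y.
Proof. by rewrite !(jmul_comm A w) jmDl. Qed.

Lemma jmZr a x w : jm w (a *: x) = a *: jm w x.
Proof. by rewrite !(jmul_comm A w) jmZl. Qed.

Lemma jmNr x w : jm w (- x) = - jm w x.
Proof. by rewrite !(jmul_comm A w) jmNl. Qed.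

Lemma jm0r w : jm w 0 = 0.
Proof. by rewrite (jmul_comm A) jm0l. Qed.

Lemma jm_linearl w : linear (jm^~ w).
Proof. by move=> a x y; rewrite jmDl jmZl. Qed.

Lemma jm_linearr w : linear (jm w).
Proof. by move=> a x y; rewrite jmDr jmZr. Qed.

Lemma jm_suml (I : Type) (r : seq I) (P : pred I) (F : I -> E) w :
  jm (\sum_(i <- r | P i) F i) w = \sum_(i <- r | P i) jm (F i) w.
Proof. exact: (big_morph (jm^~ w) (fun x y => jmDl x y w) (jm0l w)). Qed.

Lemma jm_sumr (I : Type) (r : seq I) (P : pred I) (F : I -> E) w :
  jm w (\sum_(i <- r | P i) F i) = \sum_(i <- r | P i) jm w (F i).
Proof. by rewrite (jmul_comm A) jm_suml; apply: eq_bigr => i _; rewrite (jmul_comm A). Qed.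

Lemma ji_jm x y z : ji (jm x y) z = ji y (jm x z).
Proof. by rewrite (jmul_comm A) (jmul_assoc_ip A). Qed.

Definition jE := (jmDl, jmDr, jmNl, jmNr, jmZl, jmZr, jiDl, jiDr, jiNl, jiNr, jiZl, jiZr).

(** Polarization: the difference of the Jordan identities at [y + a] and [y - a] is odd in [a], and
    the identity at [a] removes its cubic part. *)
Lemma jordan_linearized y (a : E) z :
  jm a (jm (jm y y) z) + 2 *: jm y (jm (jm y a) z) =
  jm (jm y y) (jm a z) + 2 *: jm (jm y a) (jm y z).
Proof.
apply: ji_ext => w.
have H1 := congr1 (ji^~ w) (jmul_jordan A (y + a) z).
have H2 := congr1 (ji^~ w) (jmul_jordan A (y - a) z).
have H3 := congr1 (ji^~ w) (jmul_jordan A a z).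
move: H1 H2 H3; rewrite /= !jE !(jmul_comm A a y); lra.
Qed.

(** With [L(x)] for multiplication by [x], this is [L(y^2 z) = 2 L(yz) L(y) + L(y^2) L(z) - 2 L(y)
    L(z) L(y)]: the previous identity read as one between operators. *)
Lemma jordan_quadratic y z x :
  jm (jm (jm y y) z) x =
  2 *: jm (jm y z) (jm y x) + jm (jm y y) (jm z x) - 2 *: jm y (jm z (jm y x)).
Proof.
apply: ji_ext => w; have := congr1 (ji^~ w) (jordan_linearized y x z).
rewrite /= !jE (jmul_comm A x (jm (jm y y) z)) (jmul_comm A (jm y x) z).
by rewrite (jmul_comm A x z) (jmul_comm A (jm y x) (jm y z)); lra.
Qed.

Lemma gram_schmidt (bs : seq E) : exists (k : nat) (u : nat -> E),
  (forall i j, (i < k)%N -> (j < k)%N -> ji (u i) (u j) = (i == j)%:R) /\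
  forall x, x \in bs -> x = \sum_(i < k) ji x (u i) *: u i.
Proof.
elim: bs => [|b bs [k [u [uu us]]]]; first by exists 0, (fun=> 0); split.
pose r := b - \sum_(i < k) ji b (u i) *: u i.
have [r0|r0] := eqVneq r 0.
  exists k, u; split => // x; rewrite inE => /orP[/eqP->|/us//].
  by apply/eqP; rewrite -subr_eq0 -/r r0.
have n0 : `|r| != 0 by rewrite normr_eq0.
have ro j : (j < k)%N -> ji r (u j) = 0.
  move=> jk; rewrite /r jiDl jiNl ji_suml (bigD1 (Ordinal jk)) //= jiZl uu // eqxx mulr1.
  rewrite big1 ?addr0 ?subrr // => i ij; rewrite jiZl uu //.
  by rewrite (_ : (nat_of_ord i == j) = false) ?mulr0 //; apply/negbTE.
pose r' := `|r|^-1 *: r.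
pose u' i := if i == k then r' else u i.
have u'k : u' k = r' by rewrite /u' eqxx.
have u'i i : (i < k)%N -> u' i = u i by move=> ik; rewrite /u' ltn_eqF.
have r'1 : ji r' r' = 1.
  by rewrite jiZl jiZr (jip_norm A) expr2; field.
have r'u j : (j < k)%N -> ji r' (u j) = 0 by move=> jk; rewrite jiZl ro // mulr0.
exists k.+1, u'; split=> [i j|x].
  rewrite ltnS leq_eqVlt => /orP[/eqP->|ik]; rewrite ltnS leq_eqVlt => /orP[/eqP->|jk].
  - by rewrite u'k r'1 eqxx.
  - by rewrite u'k u'i // r'u // gtn_eqF.
  - by rewrite u'k u'i // (jiC (u i)) r'u // ltn_eqF.
  - by rewrite !u'i // uu.
rewrite big_ord_recr /= u'k.
rewrite (eq_bigr (fun i : 'I_k => ji x (u i) *: u i)) => [|i _]; last by rewrite u'i.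
rewrite inE => /orP[/eqP->|/us xE].
  rewrite -[LHS](subrK (\sum_(i < k) ji b (u i) *: u i)) -/r addrC; congr (_ + _).
  have -> : ji b r' = `|r|.
    rewrite -[b](subrK (\sum_(i < k) ji b (u i) *: u i)) -/r jiDl ji_suml big1 => [|i _].
      by rewrite addr0 /r' jiZr (jip_norm A) expr2; field.
    by rewrite jiZl (jiC (u i)) r'u // mulr0.
  by rewrite /r' scalerA mulfV // scale1r.
rewrite [X in X = _]xE; suff -> : ji x r' = 0 by rewrite scale0r addr0.
by rewrite xE ji_suml big1 // => i _; rewrite jiZl (jiC (u i)) r'u // mulr0.
Qed.

(** Orthonormal coordinates, through which the results stated for [ip] apply to the inner product of
    the algebra. *)
Lemma exists_fdim : exists D : fdim E, forall x y, ip D x y = ji x y.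
Proof.
have [d [b bspan]] := finite_dim A.
have [k [u [uu us]]] := gram_schmidt (codom b).
have span y : y = \sum_(i < k) ji y (u i) *: u i.
  have [a ->] := bspan y.
  transitivity (\sum_i a i *: \sum_(j < k) ji (b i) (u j) *: u j).
    by apply: eq_bigr => i _; rewrite -us // codom_f.
  under eq_bigr do rewrite scaler_sumr.
  rewrite exchange_big; apply: eq_bigr => j _ /=.
  rewrite ji_suml scaler_suml; apply: eq_bigr => i _.
  by rewrite jiZl scalerA.
pose co_ (y : E) : 'rV[R]_k := \row_i ji y (u i).
pose oc_ (v : 'rV[R]_k) : E := \sum_(i < k) v 0 i *: u i.
have co_lin : linear co_ by move=> a x y; apply/rowP => i; rewrite !mxE jiDl jiZl.
have oc_lin : linear oc_.
  move=> a v w; rewrite /oc_ scaler_sumr -big_split; apply: eq_bigr => i _ /=.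
  by rewrite !mxE scalerDl scalerA.
pose coL : {linear E -> 'rV[R]_k} := HB.pack co_ (GRing.isLinear.Build _ _ _ _ _ co_lin).
pose ocL : {linear 'rV[R]_k -> E} := HB.pack oc_ (GRing.isLinear.Build _ _ _ _ _ oc_lin).
have cK : cancel coL ocL.
  by move=> y; rewrite [RHS]span; apply: eq_bigr => i _; rewrite mxE.
have oK : cancel ocL coL.
  move=> v; apply/rowP => j; rewrite mxE ji_suml (bigD1 j) //= jiZl uu // eqxx mulr1.
  rewrite big1 ?addr0 // => i ij; rewrite jiZl uu //.
  by rewrite (_ : (nat_of_ord i == j) = false) ?mulr0 //; apply/negbTE.
have cb : exists2 C : R, 0 < C & forall v, `|coL v| <= C * `|v|.
  exists (1 + \sum_(i < k) `|u i|); first by rewrite ltr_pwDl // sumr_ge0.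
  move=> v; apply: rV_norm_le => [|i].
    by rewrite mulr_ge0 // addr_ge0 // sumr_ge0.
  rewrite mxE; apply: (le_trans (ji_abs_cauchy _ _)); rewrite mulrC ler_wpM2r //.
  by rewrite (bigD1 i) //= addrCA lerDl addr_ge0 // sumr_ge0.
exists (Fdim cK oK cb) => x y.
rewrite [in RHS](span x) ji_suml; apply: eq_bigr => i _ /=.
by rewrite !mxE jiZl (jiC y).
Qed.

End JordanBasics.

(** * Idempotents and symmetric operators *)

Section Spectral.
Context (R : realType) (E : normedModType R) (A : euclidean_jordan E).
Implicit Types x y z w : E.

Local Notation ji := (jip A).
Local Notation jm := (jmul A).
Local Notation e := (junit A).

Lemma quadratic_nonneg_linear0 (p q : R) :
  (forall t, 0 <= 2 * t * p + t ^+ 2 * q) -> p = 0.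
Proof.
move=> H; apply/eqP; rewrite -sqrf_eq0; apply/eqP/le_anti; rewrite sqr_ge0 andbT.
have q1 : 0 < `|q| + 1 by rewrite ltr_wpDl.
have := H (- p / (`|q| + 1)).
have -> : 2 * (- p / (`|q| + 1)) * p + (- p / (`|q| + 1)) ^+ 2 * q =
   p ^+ 2 * (q - 2 * (`|q| + 1)) / (`|q| + 1) ^+ 2.
  by field; rewrite gt_eqF.
rewrite pmulr_lge0 ?invr_gt0 ?exprn_gt0 //.
have : p ^+ 2 * (q - 2 * (`|q| + 1)) <= - p ^+ 2.
  have q2 : 0 <= 2 * (`|q| + 1) - q - 1.
    by have := ler_norm q; have := normr_ge0 q; lra.
  by have := mulr_ge0 (sqr_ge0 p) q2; lra.
by lra.
Qed.

Lemma ji_eq0 x : ji x x = 0 -> x = 0.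
Proof. by rewrite (jip_norm A) => /eqP; rewrite sqrf_eq0 normr_eq0 => /eqP. Qed.

Lemma ji_ge0 x : 0 <= ji x x.
Proof. by rewrite (jip_norm A) sqr_ge0. Qed.

(** Multiplication by [c] satisfies [L = 3 L^2 - 2 L^3], so its only possible eigenvalues are 0, 1/2
    and 1. The squares of [2 *: w - v] and [v - w] draw the conclusion without diagonalizing. *)
Lemma idempotent_psd c u : jidempotent A c -> 0 <= ji (jm c u) u.
Proof.
move=> cc; have := jordan_quadratic A c c u; rewrite !cc.
set v := jm c u; set w := jm c v.
move=> vE.
have wu : ji w u = ji v v by rewrite ji_jm.
have cwu : ji (jm c w) u = ji w v by rewrite ji_jm.
have cwv : ji (jm c w) v = ji w w by rewrite ji_jm.
have := congr1 (ji^~ u) vE; have := congr1 (ji^~ v) vE; rewrite /= !jE wu cwu cwv.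
have := ji_ge0 (2 *: w - v); have := ji_ge0 (v - w); rewrite !jE (jiC A v w).
by lra.
Qed.

(** First order condition: [b] minimizes the nonnegative form [<a u, u>], tested in the direction
    [a b]. *)
Lemma psd_kernel (a : E) b : (forall u, 0 <= ji (jm a u) u) -> ji (jm a b) b = 0 -> jm a b = 0.
Proof.
move=> psd b0; apply: (ji_eq0).
apply: (@quadratic_nonneg_linear0 _ (ji (jm a (jm a b)) (jm a b))) => t.
have := psd (b + t *: jm a b); rewrite !jE b0 (ji_jm A a (jm a b) b); lra.
Qed.

Section Eigen.
Context (T : {linear E -> E}).
Context (Tsym : forall x y, ji (T x) y = ji x (T y)).

Definition orthonormal_eigenvectors (k : nat) (u : nat -> E) (l : nat -> R) : Prop :=
  (forall i j, (i < k)%N -> (j < k)%N -> ji (u i) (u j) = (i == j)%:R) /\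
  (forall i, (i < k)%N -> T (u i) = l i *: u i).

Lemma orthonormal_le_fdim (D : fdim E) (k : nat) (u : nat -> E) :
  (forall x y, ip D x y = ji x y) ->
  (forall i j, (i < k)%N -> (j < k)%N -> ji (u i) (u j) = (i == j)%:R) ->
  (k <= fd D)%N.
Proof.
move=> Dip uu; pose U := \matrix_(i < k) co D (u i).
apply: (@mulmx1_min R _ _ U U^T); apply/matrixP => i j.
rewrite !mxE; transitivity (ip D (u i) (u j)); last by rewrite Dip uu.
by apply: eq_bigr => m _; rewrite !mxE.
Qed.

(** A maximizer [v] of [<T v, v>] on the unit sphere of the orthogonal complement of the [u i],
    which [T] preserves by symmetry and which contains [r]. The residual [T v - <T v, v> v] vanishes
    by the first order condition in its own direction. *)
Lemma rayleigh_eigenvector (D : fdim E) (k : nat) (u : nat -> E) (l : nat -> R) (r : E) :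
  (forall x y, ip D x y = ji x y) ->
  orthonormal_eigenvectors k u l -> r != 0 ->
  (forall i, (i < k)%N -> ji r (u i) = 0) ->
  exists v m, [/\ ji v v = 1, T v = m *: v & forall i, (i < k)%N -> ji v (u i) = 0].
Proof.
move=> Dip [uu Tu] r0 ru.
pose S := [set v : E | forall i, (i < k)%N -> ji v (u i) = 0].
have S_lin a x y : S x -> S y -> S (a *: x + y).
  by move=> Sx Sy i ik; rewrite jiDl jiZl Sx // Sy // mulr0 addr0.
have S_T x : S x -> S (T x).
  by move=> Sx i ik; rewrite Tsym Tu // jiZr Sx // mulr0.
have Scl : closed S.
  rewrite (_ : S = \bigcap_(i in [set i | (i < k)%N]) [set v : E | ji v (u i) = 0]); last first.
    by apply/seteqP; split.
  apply: closed_bigI => i _.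
  pose li : {linear E -> R} := HB.pack (ji ^~ (u i)) (GRing.isLinear.Build _ _ _ _ _
     (fun a x y => etrans (jiDl A (a *: x) y (u i)) (congr1 (+%R^~ _) (jiZl A a x (u i))))).
  rewrite (_ : mkset _ = li @^-1` [set 0]) //.
  apply: preimage_closed => // v _; exact: (fdim_linear_continuous D).
have Ncl : closed [set v : E | `|v| = 1].
  rewrite (_ : mkset _ = (fun v : E => `|v|) @^-1` [set 1]) //.
  by apply: preimage_closed => // v _; apply: cvg_norm; exact: cvg_id.
pose Q v := - ji (T v) v.
have Qc : continuous Q.
  move=> v; have QE : Q = fun v => - ip D (T v) v by apply/funext => z; rewrite /Q Dip.
  have TC := has_C1_ip D (has_C1_linear D T) (has_C1_linear D (idfun : {linear E -> E})).
  rewrite QE; apply: cvgN; have h := has_C1_continuous (TC setT) (I : setT v); exact: h.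
have n0 : 0 < `|r| by rewrite normr_gt0.
have nS w : S w -> w != 0 -> (S `&` [set v : E | `|v| = 1]) (`|w|^-1 *: w).
  move=> Sw w0; split => /=.
    by rewrite -[_ *: _]addr0; apply: S_lin => // i ik; rewrite ji0l.
  by rewrite normrZ normfV normr_id mulVf // normr_eq0.
have [x [_ /= ->]//|||v [Sv v1] vmin] := @fdim_min R E D (S `&` [set v : E | `|v| = 1]) 1 Q
   (closedI Scl Ncl).
- by exists (`|r|^-1 *: r); exact: nS.
- by move=> x _; exact: Qc.
exists v, (ji (T v) v).
have vv : ji v v = 1 by rewrite (jip_norm A) v1 expr1n.
have max w : S w -> ji (T w) w <= ji (T v) v * ji w w.
  move=> Sw; have [->|w0] := eqVneq w 0; first by rewrite linear0 !ji0l mulr0.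
  have := vmin _ (nS w Sw w0); rewrite /Q linearZ lerN2 !jE.
  rewrite mulrA -invfM -expr2 (jip_norm A w) => h.
  by rewrite -ler_pdivrMr ?exprn_gt0 ?normr_gt0 // mulrC.
have [z zdef] : exists z, z = T v - ji (T v) v *: v by exists (T v - ji (T v) v *: v).
have Sz : S z by rewrite zdef addrC -scaleNr; apply: S_lin => //; exact: S_T.
split => //; apply/eqP; rewrite -subr_eq0 -zdef; apply/eqP/ji_eq0.
apply/eqP; rewrite -oppr_eq0; apply/eqP.
apply: (@quadratic_nonneg_linear0 _ (ji (T v) v * ji z z - ji (T z) z)) => t.
have := max (t *: z + v) (S_lin t z v Sz Sv).
have zE : ji z z = ji (T v) z - ji (T v) v * ji v z by rewrite {1}zdef !jE.
rewrite linearD linearZ !jE vv (Tsym z v) (jiC A z (T v)) (jiC A z v).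
by have := congr1 ( *%R t) zE; lra.
Qed.

(** For each [k], either an eigenbasis exists or there are [k] orthonormal eigenvectors; [k] equal
    to the dimension plus one excludes the second case. *)
Lemma eigenbasis : exists (k : nat) (u : nat -> E) (l : nat -> R),
  orthonormal_eigenvectors k u l /\ forall x, x = \sum_(i < k) ji x (u i) *: u i.
Proof.
have [D Dip] := exists_fdim A.
suff H k : (exists (k : nat) (u : nat -> E) (l : nat -> R),
    orthonormal_eigenvectors k u l /\ forall x, x = \sum_(i < k) ji x (u i) *: u i) \/
    exists u l, orthonormal_eigenvectors k u l.
  have [//|[u [l [uu _]]]] := H (fd D).+1.
  by have := orthonormal_le_fdim Dip uu; rewrite ltnn.
elim: k => [|k [|[u [l ul]]]]; [by right; exists (fun=> 0), (fun=> 0)|by left|].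
have [H|/existsNP[x /eqP]] := pselect (forall x, x = \sum_(i < k) ji x (u i) *: u i).
  by left; exists k, u, l.
rewrite -subr_eq0; set r := _ - _ => r0; right.
have ru j : (j < k)%N -> ji r (u j) = 0.
  move=> jk; rewrite /r jiDl jiNl ji_suml (bigD1 (Ordinal jk)) //= jiZl ul.1 // eqxx mulr1.
  rewrite big1 ?addr0 ?subrr // => i ij; rewrite jiZl ul.1 //.
  by rewrite (_ : (nat_of_ord i == j) = false) ?mulr0 //; apply/negbTE.
have [v [m [v1 Tv vu]]] := rayleigh_eigenvector Dip ul r0 ru.
exists (fun i => if i == k then v else u i), (fun i => if i == k then m else l i).
split=> [i j|i]; last first.
  by rewrite ltnS leq_eqVlt => /orP[/eqP->|ik]; [rewrite eqxx|rewrite ltn_eqF // ul.2].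
rewrite ltnS leq_eqVlt => /orP[/eqP->|ik]; rewrite ltnS leq_eqVlt => /orP[/eqP->|jk].
- by rewrite !eqxx v1.
- by rewrite eqxx (gtn_eqF jk) (ltn_eqF jk) vu.
- by rewrite eqxx (ltn_eqF ik) jiC vu.
- by rewrite (ltn_eqF jk) (ltn_eqF ik) ul.1.
Qed.

(** Applying [T - l0] to the sum kills the component of eigenvalue [l0] and multiplies the others by
    the nonzero numbers [l - l0]; induct on the list of eigenvalues. *)
Lemma eigenvectors_in (P : E -> Prop) (s : seq R) (U : R -> E) :
  P 0 -> (forall a x y, P x -> P y -> P (a *: x + y)) -> (forall x, P x -> P (T x)) ->
  uniq s -> (forall l, T (U l) = l *: U l) -> P (\sum_(l <- s) U l) ->
  forall l, l \in s -> P (U l).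
Proof.
move=> P0 Plin PT; elim: s U => [//|l0 s IH] U /= /andP[l0s us] TU.
rewrite big_cons => Px.
have Ps l : l \in s -> P (U l).
  move=> ls; have ll0 : l - l0 != 0.
    by rewrite subr_eq0; apply: contraNneq l0s => <-.
  suff h : P ((l - l0) *: U l).
    by have := Plin (l - l0)^-1 _ _ h P0; rewrite scalerA mulVf // scale1r addr0.
  apply: (IH (fun l => (l - l0) *: U l)) => // [l'|].
    have -> : T ((l' - l0) *: U l') = (l' - l0) *: T (U l') by exact: linearZ.
    by rewrite TU !scalerA mulrC.
  have := Plin (- l0) _ _ Px (PT _ Px); rewrite (linearD T) TU (linear_sum T).
  rewrite scalerDr scaleNr addrACA addNr add0r scaler_sumr -big_split.
  by under eq_bigr => l' _ do rewrite /= TU -scalerDl addrC.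
move=> l; rewrite inE => /orP[/eqP->|/Ps//].
have : P (\sum_(l <- s) U l).
  rewrite big_seq; elim/big_ind: _ => // x y Px' Py.
  by rewrite -[x]scale1r; exact: Plin.
move=> Psum; have := Plin (-1) _ _ Psum Px.
by rewrite scaleN1r addrCA addNr addr0.
Qed.

Lemma spectral_in (P : E -> Prop) x :
  P 0 -> (forall a x y, P x -> P y -> P (a *: x + y)) -> (forall x, P x -> P (T x)) ->
  P x -> exists (s : seq R) (U : R -> E), [/\ uniq s, forall l, T (U l) = l *: U l,
    x = \sum_(l <- s) U l & forall l, l \in s -> P (U l)].
Proof.
move=> P0 Plin PT Px; have [k [u [l [[uu Tu] uspan]]]] := eigenbasis.
pose s := undup [seq l i | i <- iota 0 k].
(* The component of [x] of eigenvalue [t]. It is an empty sum, hence 0, when [t] is not an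
   eigenvalue, so [TU] holds for every real [t]. *)
pose U t := \sum_(i < k | l i == t) ji x (u i) *: u i.
have TU t : T (U t) = t *: U t.
  rewrite /U linear_sum scaler_sumr; apply: eq_bigr => i /eqP <-.
  by rewrite linearZ /= Tu // !scalerA mulrC.
have xE : x = \sum_(t <- s) U t.
  rewrite {1}[x]uspan /U (exchange_big_dep xpredT) //=; apply: eq_bigr => i _.
  rewrite big_mkcond (bigD1_seq (l i)) ?undup_uniq //=.
    by rewrite eqxx big1 ?addr0 // => t /negPf; rewrite eq_sym => ->.
  by rewrite mem_undup; apply/mapP; exists (i : nat); rewrite // mem_iota /=.
exists s, U; split => //; first exact: undup_uniq.
by apply: eigenvectors_in => //; [exact: undup_uniq|rewrite -xE].
Qed.

End Eigen.
End Spectral.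

(** * Spectral decompositions in the algebra *)

Section SpectralTheorem.
Context (R : realType) (E : normedModType R) (A : euclidean_jordan E).
Implicit Types x y z w : E.

Local Notation ji := (jip A).
Local Notation jm := (jmul A).
Local Notation e := (junit A).

Lemma jm_unitr x : jm x e = x.
Proof. by rewrite (jmul_comm A) (jmul_unit A). Qed.

Definition jmL y : {linear E -> E} :=
  HB.pack (jm y) (GRing.isLinear.Build _ _ _ _ _ (jm_linearr A y)).

Definition jcomm x y : Prop := forall z, jm x (jm y z) = jm y (jm x z).

(* The vectors [x] satisfying these conditions form a subspace containing the
   unit and stable under multiplication by [y], so the eigenvectors of [y] whose
   sum is the unit lie in it; multiplication by such an eigenvector preserves
   the eigenspaces of [y]. *)
Definition jcompatible y x : Prop :=
  [/\ jcomm x y, jcomm (jm y x) y & jm (jm y y) x = jm y (jm y x)].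

(** By the third condition [y (y x) = y^2 x], and [jordan_quadratic] expresses multiplication by it
    through multiplications by [y x], [y], [y^2] and [x], all of which commute with multiplication
    by [y]. *)
Lemma jcompatible_jm y x : jcompatible y x -> jcompatible y (jm y x).
Proof.
move=> [c1 c2 c3]; split => //; last by rewrite -(jmul_jordan A) c3.
rewrite -c3 => z; apply: (ji_ext (A := A)) => w.
rewrite (jordan_quadratic A y x (jm y z)) (jordan_quadratic A y x z) !jE.
by rewrite -(c2 (jm y z)) (jmul_jordan A y (jm x z)) -(c1 z) -(c1 (jm y z)).
Qed.

(** A product [U l U l'] belongs to both eigenvalues [l] and [l'], so it is 0 for distinct ones;
    multiplying the decomposition of the unit by [U l] then gives idempotence. [Q] carries along any
    further subspace that contains the unit and is stable under [y]. *)
Lemma spectral_idempotents y (Q : E -> Prop) :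
  Q 0 -> (forall a x z, Q x -> Q z -> Q (a *: x + z)) ->
  (forall x, Q x -> Q (jm y x)) -> Q e ->
  exists (s : seq R) (U : R -> E), [/\ uniq s, e = \sum_(l <- s) U l,
    forall l, jm y (U l) = l *: U l & forall l, l \in s -> jidempotent A (U l) /\ Q (U l)].
Proof.
move=> Q0 Qlin Qjm Qe.
have [||||s [U [us TU eE PU]]] := @spectral_in _ _ A (jmL y) (fun x z => esym (esym (ji_jm A y x z)))
  (fun x => Q x /\ jcompatible y x) e.
- split => //; split=> [z||]; rewrite ?(jm0l, jm0r) //.
  by move=> z; rewrite !(jm0l, jm0r).
- move=> a x z [Qx [x1 x2 x3]] [Qz [z1 z2 z3]]; split; first exact: Qlin.
  split=> [t|t|]; first by rewrite !jE x1 z1.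
    by rewrite !jE x2 z2.
  by rewrite !jE x3 z3.
- by move=> x [Qx xc]; split; [exact: Qjm|exact: jcompatible_jm].
- split => //; split=> [z|z|]; rewrite ?jm_unitr ?(jmul_unit A) //.
exists s, U; split => // l ls; split; last exact: (PU l ls).1.
have orth l' : l' \in s -> l' != l -> jm (U l) (U l') = 0.
  move=> l's l'l; have [_ [c1 _ _]] := PU l ls; have [_ [c1' _ _]] := PU l' l's.
  have h1 := c1 (U l'); have h2 := c1' (U l); move: h1 h2.
  have -> : jm y (U l) = l *: U l := TU l; have -> : jm y (U l') = l' *: U l' := TU l'.
  rewrite !jE (jmul_comm A (U l') (U l)) => <- /eqP.
  rewrite -subr_eq0 -scalerBl scaler_eq0 => /orP[|/eqP//].
  by rewrite subr_eq0 eq_sym (negPf l'l).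
rewrite /jidempotent -[RHS]jm_unitr eE jm_sumr (bigD1_seq l) //= big1_seq ?addr0 //.
by move=> l' /andP[l'l l's]; exact: orth.
Qed.

(** The numbers [<c_i, c_k>] are nonnegative and add up over [k] to [<c_i, e> = <c_i, c_i>], so
    those with [k != i] vanish, and [psd_kernel] turns this into a zero product. *)
Lemma idempotents_orthogonal (r : nat) (c : 'I_r -> E) :
  (forall i, jidempotent A (c i)) -> \sum_i c i = e ->
  forall i j, i != j -> jm (c i) (c j) = 0.
Proof.
move=> cc ce i j ij.
have cE k : ji (jm (c i) (c k)) (c k) = ji (c i) (c k) by rewrite (jmul_assoc_ip A) cc.
have c0 k : 0 <= ji (c i) (c k) by rewrite -cE; exact: idempotent_psd.
apply: (psd_kernel (fun u => idempotent_psd u (cc i))); rewrite cE; apply/eqP.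
have : \sum_(k | k != i) ji (c i) (c k) = 0.
  have : \sum_k ji (c i) (c k) = ji (c i) (c i).
    rewrite -{3}[c i]jm_unitr -ji_jm cc -ce (jiC A (c i)) ji_suml.
    by apply: eq_bigr => k _; rewrite jiC.
  by rewrite (bigD1 i) //= => /(canRL (addKr _)); rewrite addNr.
move=> /eqP; rewrite psumr_eq0 => [/allP/(_ j)|k _]; last exact: c0.
by rewrite mem_index_enum eq_sym ij => /(_ isT).
Qed.

(** From [|c| = |c c| <= C |c|^2]. This makes the splitting into primitive idempotents terminate. *)
Lemma idempotent_norm_ge : exists2 m : R, 0 < m &
  forall c, jidempotent A c -> c <> 0 -> m <= ji c c.
Proof.
have [D _] := exists_fdim A.
have [C C0 HC] := bilinear_bounded D D (jm_linearl A) (jm_linearr A).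
exists (C ^- 2); first by rewrite invr_gt0 exprn_gt0.
move=> c cc /eqP; rewrite -normr_gt0 => n0.
have := HC c c; rewrite cc ler_pMl // => h.
rewrite (jip_norm A) -exprVn ler_sqr ?nnegrE ?invr_ge0 ?(ltW C0) //.
by rewrite -[leLHS]mulr1 ler_pdivrMl.
Qed.

(** In [c = a + b], pairing [c c = c] with the unit gives [<a, b> = 0], so squared norms add up and
    each nonzero part has at least [m]. The induction bounds the number of parts by [<c, c> / m]. *)
Lemma idempotent_sum_primitive c0 : jidempotent A c0 ->
  exists2 ps : seq E, (forall p, p \in ps -> primitive_idempotent A p) & c0 = \sum_(p <- ps) p.
Proof.
have [m m0 Hm] := idempotent_norm_ge.
suff H N c : jidempotent A c -> ji c c < N%:R * m ->
    exists2 ps : seq E, (forall p, p \in ps -> primitive_idempotent A p) & c = \sum_(p <- ps) p.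
  move=> cc; apply: (H (Num.truncn (ji c0 c0 / m)).+1) => //.
  by rewrite -ltr_pdivrMr // truncnS_gt.
elim: N c => [|N IH] c cc cN; first by move: cN; rewrite mul0r ltNge ji_ge0.
have [->|/eqP cn0] := eqVneq c 0; first by exists [::]; rewrite ?big_nil.
have [pc|] := pselect (primitive_idempotent A c).
  by exists [:: c]; [move=> p; rewrite inE => /eqP->|rewrite big_seq1].
move=> npc; have [a [b [aa bb cab a0 b0]]] : exists a b,
    [/\ jidempotent A a, jidempotent A b, c = a + b, a <> 0 & b <> 0].
  apply: contrapT => H; apply: npc; split => // a b aa bb cab.
  have [->|/eqP a0] := eqVneq a 0; first by left.
  have [->|/eqP b0] := eqVneq b 0; first by right.
  by exfalso; apply: H; exists a, b.
have ab : ji a b = 0.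
  have : ji (jm c c) e = ji c e by rewrite cc.
  rewrite cab !jE aa bb (jmul_comm A b a) !(jmul_assoc_ip A) !jm_unitr; lra.
have cab2 : ji c c = ji a a + ji b b by rewrite cab !jE (jiC A b a) ab; lra.
have := Hm a aa a0; have := Hm b bb b0; move: cN; rewrite -natr1 mulrDl mul1r => cN hb ha.
have [|ps1 H1 aE] := IH a aa; first by lra.
have [|ps2 H2 bE] := IH b bb; first by lra.
exists (ps1 ++ ps2); last by rewrite cab big_cat /= -aE -bE.
by move=> p; rewrite mem_cat => /orP[/H1|/H2].
Qed.

(** Each eigen-idempotent of [y] is split into primitive ones that keep its eigenvalue.
    Orthogonality within the whole list comes from its sum being the unit. *)
Theorem exists_spectral_decomposition y :
  exists (r : nat) (sigma : 'I_r -> R) (c : 'I_r -> E), spectral_decomposition A y sigma c.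
Proof.
have [//|//|//|//|s [U [_ eE yU idU]]] := @spectral_idempotents y (fun _ => True).
have [L Lp [Le Ly]] : exists2 L : seq (R * E), forall p, p \in L -> primitive_idempotent A p.2 &
    \sum_(p <- L) p.2 = \sum_(l <- s) U l /\
    \sum_(p <- L) p.1 *: p.2 = \sum_(l <- s) l *: U l.
  have {}idU l : l \in s -> jidempotent A (U l) by move=> /idU[].
  elim: s idU {eE} => [|l s IH] idU; first by exists [::]; rewrite ?big_nil.
  have [|L HL [L1 L2]] := IH; first by move=> t ts; apply: idU; rewrite inE ts orbT.
  have [ps Hps UE] := idempotent_sum_primitive (idU l (mem_head _ _)).
  exists ([seq (l, p) | p <- ps] ++ L).
    by move=> p; rewrite mem_cat => /orP[/mapP[q /Hps ? ->]|/HL].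
  rewrite !big_cat !big_map !big_cons /= L1 L2; split; first by rewrite UE.
  by rewrite -scaler_sumr -UE.
pose c i := (tnth (in_tuple L) i).2.
exists (size L), (fun i => (tnth (in_tuple L) i).1), c.
have ce : \sum_i c i = e by rewrite eE -Le [RHS]big_tnth.
have cp i : primitive_idempotent A (c i) by apply: Lp; exact: mem_tnth.
split; last first.
  rewrite -[LHS]jm_unitr eE jm_sumr; under eq_bigr do rewrite yU.
  by rewrite -Ly [LHS]big_tnth.
split => //; apply: idempotents_orthogonal => // i; by have [] := cp i.
Qed.

End SpectralTheorem.

(** * The cone of squares *)

Section SquareCone.
Context (R : realType) (E : normedModType R) (A : euclidean_jordan E).
Implicit Types x y z w u p q : E.

Local Notation ji := (jip A).
Local Notation jm := (jmul A).
Local Notation e := (junit A).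
Local Notation K := (square_cone A).

Lemma square_coneP x : K x <-> exists y, x = jm y y.
Proof. by split=> [[y _ <-]|[y ->]]; exists y. Qed.

Lemma square_cone_sqr y : K (jm y y). Proof. by exists y. Qed.

Lemma square_cone_idempotent (c : E) : jidempotent A c -> K c.
Proof. by move=> cc; apply/square_coneP; exists c. Qed.

Section Frame.
Context (r : nat) (c : 'I_r -> E) (frame : jordan_frame A c).

Lemma frame_idempotent i : jm (c i) (c i) = c i.
Proof. by have [cp _ _] := frame; have [] := cp i. Qed.

Lemma frame_mul (s t : 'I_r -> R) :
  jm (\sum_i s i *: c i) (\sum_i t i *: c i) = \sum_i (s i * t i) *: c i.
Proof.
have [_ orth _] := frame.
rewrite jm_suml; apply: eq_bigr => i _; rewrite jm_sumr (bigD1 i) //= !jE.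
rewrite frame_idempotent scalerA mulrC big1 ?addr0 // => j ji.
by rewrite !jE orth 1?eq_sym // !scaler0.
Qed.

Lemma frame_ip i j : i != j -> ji (c i) (c j) = 0.
Proof.
have [_ orth _] := frame => ij.
by rewrite -[c i]frame_idempotent (jmul_assoc_ip A) orth // ji0r.
Qed.

Lemma frame_ip_sum (s : 'I_r -> R) i : ji (\sum_j s j *: c j) (c i) = s i * ji (c i) (c i).
Proof.
rewrite ji_suml (bigD1 i) //= jiZl big1 ?addr0 // => j ji.
by rewrite jiZl frame_ip // mulr0.
Qed.

Lemma frame_gt0 i : 0 < ji (c i) (c i).
Proof.
have [cp _ _] := frame; have [_ c0 _] := cp i.
by rewrite lt_def ji_ge0 andbT; apply/eqP => /ji_eq0.
Qed.

Lemma frame_cone (s : 'I_r -> R) : (forall i, 0 <= s i) -> K (\sum_i s i *: c i).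
Proof.
move=> s0; apply/square_coneP; exists (\sum_i Num.sqrt (s i) *: c i).
by rewrite frame_mul; apply: eq_bigr => i _; rewrite -expr2 sqr_sqrtr.
Qed.

(** If the sum is [z z], then [s_i <c_i, c_i> = <z z, c_i> = <c_i z, z>], which is nonnegative. *)
Lemma frame_cone_ge0 (s : 'I_r -> R) : K (\sum_i s i *: c i) -> forall i, 0 <= s i.
Proof.
move=> /square_coneP[z zE] i; rewrite -(pmulr_lge0 _ (frame_gt0 i)) -frame_ip_sum zE.
by rewrite ji_jm (jmul_comm A) -ji_jm; exact: idempotent_psd (frame_idempotent i).
Qed.

End Frame.

Lemma square_cone_psd x : K x -> forall u, 0 <= ji (jm x u) u.
Proof.
move=> Kx u; have [r [s [c [frame xE]]]] := exists_spectral_decomposition A x.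
rewrite xE in Kx *; have s0 := frame_cone_ge0 frame Kx.
rewrite jm_suml ji_suml; apply: sumr_ge0 => i _; rewrite !jE mulr_ge0 //.
exact: idempotent_psd (frame_idempotent frame i).
Qed.

Lemma square_cone_ip_ge0 x y : K x -> K y -> 0 <= ji x y.
Proof.
by move=> Kx /square_coneP[z ->]; rewrite -(jmul_assoc_ip A); exact: square_cone_psd.
Qed.

Lemma moreau_decomposition u : exists p q, [/\ K p, K q, u = p - q & ji p q = 0].
Proof.
have [r [s [c [frame ->]]]] := exists_spectral_decomposition A u.
exists (\sum_i Num.max (s i) 0 *: c i), (\sum_i Num.max (- s i) 0 *: c i); split.
- by apply: (frame_cone frame) => i; rewrite le_max lexx orbT.
- by apply: (frame_cone frame) => i; rewrite le_max lexx orbT.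
- rewrite -sumrB; apply: eq_bigr => i _; rewrite -scalerBl; congr (_ *: _).
  case: (leP 0 (s i)) => si; first by rewrite max_r ?oppr_le0 // subr0.
  by rewrite max_l ?oppr_ge0 ?ltW // sub0r opprK.
- rewrite -[X in ji X _](jm_unitr A) ji_jm (frame_mul frame).
  rewrite big1 ?ji0r // => i _.
  case: (leP 0 (s i)) => si; last by rewrite mul0r scale0r.
  by rewrite max_r ?oppr_le0 // mulr0 scale0r.
Qed.

Lemma moreau_dist p q k : K q -> K k -> ji p q = 0 ->
  `|p - k| ^+ 2 + `|q| ^+ 2 <= `|p - q - k| ^+ 2.
Proof.
move=> Kq Kk pq; rewrite -!(jip_norm A) !jE (jiC A q p) pq (jiC A k p) (jiC A k q).
by have := square_cone_ip_ge0 Kq Kk; lra.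
Qed.

Lemma cone_projection_moreau u p q : K p -> K q -> u = p - q -> ji p q = 0 ->
  cone_projection K u = p.
Proof.
move=> Kp Kq uE pq; apply: get_subset1.
  split => // k Kk; rewrite -ler_sqr ?nnegrE //.
  have := moreau_dist Kq Kk pq; rewrite -uE.
  have -> : u - p = - q by rewrite uE addrAC subrr add0r.
  by rewrite normrN; have := sqr_ge0 `|p - k|; lra.
suff one z : [set z | K z /\ (forall w, K w -> `|u - z| <= `|u - w|)] z -> z = p.
  by move=> z z' /one-> /one->.
move=> [Kz zmin]; have := zmin _ Kp; rewrite -ler_sqr ?nnegrE //.
have -> : u - p = - q by rewrite uE addrAC subrr add0r.
have := moreau_dist Kq Kz pq; rewrite -uE normrN => h1 h2.
apply/esym/eqP; rewrite -subr_eq0 -normr_eq0 -sqrf_eq0; apply/eqP/le_anti.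
by rewrite sqr_ge0 andbT; lra.
Qed.

Lemma cone_projection_cone u : K (cone_projection K u).
Proof.
by have [p [q [Kp Kq uE pq]]] := moreau_decomposition u; rewrite (cone_projection_moreau Kp Kq uE pq).
Qed.

Lemma cone_projection_id u : K u -> cone_projection K u = u.
Proof.
move=> Ku; apply: (@cone_projection_moreau _ _ 0) => //; rewrite ?subr0 ?ji0r //.
by apply/square_coneP; exists 0; rewrite jm0l.
Qed.

Lemma cone_projection_lipschitz u u' :
  `|cone_projection K u' - cone_projection K u| <= `|u' - u|.
Proof.
have [p [q [Kp Kq uE pq]]] := moreau_decomposition u.
have [p' [q' [Kp' Kq' uE' pq']]] := moreau_decomposition u'.
rewrite (cone_projection_moreau Kp Kq uE pq) (cone_projection_moreau Kp' Kq' uE' pq').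
have h : `|p' - p| ^+ 2 <= ji (p' - p) (u' - u).
  rewrite -(jip_norm A) uE uE' !jE pq pq'.
  have := square_cone_ip_ge0 Kp' Kq; have := square_cone_ip_ge0 Kp Kq'.
  by rewrite (jiC A p p'); lra.
have [->|n0] := eqVneq (p' - p) 0; first by rewrite normr0.
rewrite -(ler_pM2l (_ : 0 < `|p' - p|)) ?normr_gt0 // -expr2.
by apply: (le_trans h); exact: ji_cauchy.
Qed.

(* With [a - b = \sum_i d_i c_i], pair [a^2 - b^2 = (a - b)(a + b)] with the
   element [\sum_i sgn(d_i) c_i], of norm at most [|e|], and use
   [|<a - b, c_i>| <= <a + b, c_i>]. *)
Lemma square_root_holder (a b : E) : K a -> K b ->
  `|a - b| ^+ 2 <= `|e| * `|jm a a - jm b b|.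
Proof.
move=> Ka Kb; have [r [d [c [frame dE]]]] := exists_spectral_decomposition A (a - b).
pose s := \sum_i Num.sg (d i) *: c i.
have [_ _ ce] := frame.
have sqE (t : 'I_r -> R) : `|\sum_i t i *: c i| ^+ 2 = \sum_i t i ^+ 2 * ji (c i) (c i).
  rewrite -(jip_norm A) ji_suml; apply: eq_bigr => i _.
  by rewrite jiZl jiC (frame_ip_sum frame) mulrA -expr2.
have sE : `|s| <= `|e|.
  rewrite -ler_sqr ?nnegrE // sqE.
  have -> : e = \sum_i 1 *: c i by rewrite -ce; apply: eq_bigr => i _; rewrite scale1r.
  rewrite sqE; apply: ler_sum => i _; rewrite ler_wpM2r ?ji_ge0 // expr1n.
  by rewrite sqr_sg; case: (d i != 0); rewrite ?ler01.
apply: (@le_trans _ _ (ji s (jm a a - jm b b))); last first.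
  by apply: (le_trans (ji_cauchy A _ _)); rewrite ler_wpM2r.
have -> : jm a a - jm b b = jm (a - b) (a + b).
  by rewrite !jE (jmul_comm A b a) addrA addrK.
rewrite dE sqE ji_suml; apply: ler_sum => i _.
rewrite jiZl -ji_jm.
have -> : jm (\sum_j d j *: c j) (c i) = d i *: c i.
  have -> : c i = \sum_j (j == i)%:R *: c j.
    rewrite (bigD1 i) //= eqxx scale1r big1 ?addr0 // => j /negPf ->.
    by rewrite scale0r.
  rewrite (frame_mul frame) (bigD1 i) //= eqxx mulr1 big1 ?addr0 => [|j /negPf ->]; last first.
    by rewrite mulr0 scale0r.
  rewrite scaler_sumr (bigD1 i) //= eqxx scale1r big1 ?addr0 // => j /negPf ->.
  by rewrite scale0r scaler0.
have Kc : K (c i) by exact: square_cone_idempotent (frame_idempotent frame i).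
have h1 := square_cone_ip_ge0 Ka Kc; have h2 := square_cone_ip_ge0 Kb Kc.
have h3 : d i * ji (c i) (c i) = ji a (c i) - ji b (c i).
  by rewrite -(frame_ip_sum frame) -dE !jE.
rewrite jiZl jiDr (jiC A (c i) a) (jiC A (c i) b) mulrA.
rewrite -normrEsg expr2 -mulrA h3.
case: (ger0P (d i)) => d0; first by rewrite ler_wpM2l //; lra.
by rewrite mulNr -mulrN ler_wnM2l ?(ltW d0) //; lra.
Qed.

(** The spectral theorem provides a candidate for the choice, and every candidate has the two
    properties, so nothing depends on which one is chosen. *)
Lemma jsqrtP y : K y -> K (jsqrt A y) /\ jm (jsqrt A y) (jsqrt A y) = y.
Proof.
move=> Ky; have [r [s [c [frame yE]]]] : exists (r : nat) (s : 'I_r -> R) (c : 'I_r -> E),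
    spectral_decomposition A y s c /\ jsqrt A y = \sum_i Num.sqrt (s i) *: c i.
  apply: (@getPex _ [set z | exists (r : nat) (s : 'I_r -> R) (c : 'I_r -> E),
    spectral_decomposition A y s c /\ z = \sum_i Num.sqrt (s i) *: c i]).
  have [r [s [c H]]] := exists_spectral_decomposition A y.
  by exists (\sum_i Num.sqrt (s i) *: c i), r, s, c.
have [fr yE'] := frame; rewrite yE; split.
  by apply: (frame_cone fr) => i; exact: sqrtr_ge0.
rewrite (frame_mul fr) [RHS]yE'; apply: eq_bigr => i _.
by rewrite -expr2 sqr_sqrtr //; apply: (frame_cone_ge0 fr); rewrite -yE'.
Qed.

(** [<a y, y> = <a, y^2> = 0] and multiplication by [a] is positive. Complementarity thus passes
    from [g(xs)] to its square root. *)
Lemma complementary_jm_sqrt a y : K a -> jm a (jm y y) = 0 -> jm a y = 0.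
Proof.
move=> Ka ay; apply: (psd_kernel (square_cone_psd Ka)).
by rewrite (jmul_assoc_ip A) -[X in ji X _](jm_unitr A) ji_jm ay ji0r.
Qed.

(** In a frame of [y], [<y b, b>] is a sum of nonnegative terms [s_i <c_i b, b>]; each vanishes, so
    [s_i = 0] or [c_i b = 0]. *)
Lemma jm_sqr_eq0 y b : K y -> jm b y = 0 -> jm b (jm y y) = 0.
Proof.
move=> Ky by0; have [r [s [c [frame yE]]]] := exists_spectral_decomposition A y.
have s0 : forall i, 0 <= s i by apply: (frame_cone_ge0 frame); rewrite -yE.
have cc i := frame_idempotent frame i.
have : \sum_i s i * ji (jm (c i) b) b = 0.
  transitivity (ji (jm y b) b); last by rewrite (jmul_comm A) by0 ji0l.
  by rewrite yE jm_suml ji_suml; apply: eq_bigr => i _; rewrite !jE.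
move=> /eqP; rewrite psumr_eq0 => [/allP H|i _]; last first.
  by rewrite mulr_ge0 // idempotent_psd.
rewrite {1 2}yE (frame_mul frame) jm_sumr big1 // => i _.
have := H i (mem_index_enum _); rewrite /= mulf_eq0 => /orP[/eqP ->|/eqP ci].
  by rewrite mul0r scale0r jm0r.
by rewrite jmZr (jmul_comm A) (psd_kernel (fun u => idempotent_psd u (cc i)) ci) scaler0.
Qed.

Lemma tangent_cone_ip_ge0 f z d : K f -> ji f z = 0 -> tangent_cone K z d -> 0 <= ji f d.
Proof.
move=> Kf fz [t [v [t0 _ vd Kv]]].
have [D _] := exists_fdim A.
have l_lin : linear (ji f) by move=> a x y; rewrite jiDr jiZr.
pose l : {linear E -> R} := HB.pack (ji f) (GRing.isLinear.Build _ _ _ _ _ l_lin).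
have lc : l (v k) @[k --> \oo] --> l d.
  by apply: continuous_cvg => //; exact: (fdim_linear_continuous D).
rewrite -[ji f d]/(l d) -(cvg_lim _ lc) //; apply: limr_ge; first by apply/cvg_ex; exists (l d).
near=> k; have := square_cone_ip_ge0 Kf (Kv k).
by rewrite !jE fz add0r pmulr_rge0.
Unshelve. all: by end_near.
Qed.

(** The idempotents annihilated by [y^2] lie in the cone and are orthogonal to [y^2], so [d] and
    [- d], both tangent, pair nonnegatively with them; [b] is a combination of such idempotents.
    This is how nondegeneracy is used. *)
Lemma lineality_orthogonal y b d : K y -> jm b y = 0 ->
  lineality (tangent_cone K (jm y y)) d -> ji b d = 0.
Proof.
move=> Ky by0 [Td TNd].
have byy := jm_sqr_eq0 Ky by0; set z := jm y y in byy Td TNd.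
(* Multiplications by [b] and [y^2] commute, so in the decomposition of the unit
   into eigenvectors of [b], those with nonzero eigenvalue are idempotents
   annihilated by [y^2]. *)
have comm x : jm z (jm b x) = jm b (jm z x).
  have := jordan_linearized A y b x; rewrite -/z (jmul_comm A y b) by0.
  by rewrite !(jm0l, jm0r) !scaler0 !addr0.
have [|a x w xQ wQ|x xQ||s [U [_ eE bU idU]]] :=
  @spectral_idempotents _ _ A b (fun x => jm z (jm b x) = 0).
- by rewrite !jm0r.
- by rewrite !jE xQ wQ scaler0 addr0.
- by rewrite comm xQ jm0r.
- by rewrite jm_unitr (jmul_comm A).
rewrite -[b](jm_unitr A) eE jm_sumr ji_suml big_seq big1 // => l ls.
have [UU zU] := idU l ls; rewrite bU jiZl; have [->|l0] := eqVneq l 0; first by rewrite mul0r.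
have {}zU : jm z (U l) = 0.
  move: zU; rewrite bU jmZr => /eqP; rewrite scaler_eq0 (negPf l0) => /eqP //.
have KU := square_cone_idempotent UU.
have Uz : ji (U l) z = 0 by rewrite -[U l](jm_unitr A) ji_jm (jmul_comm A (U l)) zU ji0r.
have h1 := tangent_cone_ip_ge0 KU Uz Td; have h2 := tangent_cone_ip_ge0 KU Uz TNd.
suff -> : ji (U l) d = 0 by rewrite mulr0.
by move: h1 h2; rewrite jiNr; lra.
Qed.

End SquareCone.

(** * The problem with squared slack variables *)

Section C2Closure.
Context (R : realType).

Lemma has_C1_diff (V W : normedModType R) (O : set V) (F : V -> W) dF x v :
  has_C1 O F dF -> O x -> 'd F x v = dF x v.
Proof. by move=> FC /FC[dFx _]; rewrite (@diff_val _ _ _ _ _ _ _ dFx). Qed.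

Lemma C2_of_has_C1 (V W : normedModType R) (F : V -> W) dF ddF :
  has_C1 setT F dF -> (forall v, has_C1 setT (fun y => dF y v) (ddF v)) -> C2 F.
Proof.
move=> FC dFC; split; first exact: has_C1_on openT FC.
move=> v; have -> : (fun y => 'd F y v : W) = (fun y => dF y v).
  by apply/funext => y; rewrite (has_C1_diff v FC).
exact: has_C1_on openT (dFC v).
Qed.

Lemma C2_has (V W : normedModType R) (F : V -> W) : C2 F ->
  has_C1 setT F (fun x => 'd F x) /\
  forall v, has_C1 setT (fun y => 'd F y v : W) (fun x => 'd (fun y => 'd F y v : W) x).
Proof. by move=> [F1 F2]; split=> [|v]; apply: C1_on_has. Qed.

Lemma C2_add (V W : normedModType R) (F G : V -> W) :
  C2 F -> C2 G -> C2 (fun x => F x + G x).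
Proof.
move=> /C2_has[F1 F2] /C2_has[G1 G2].
exact: C2_of_has_C1 (has_C1_add F1 G1) (fun v => has_C1_add (F2 v) (G2 v)).
Qed.

Lemma C2_opp (V W : normedModType R) (F : V -> W) : C2 F -> C2 (fun x => - F x).
Proof.
by move=> /C2_has[F1 F2]; exact: C2_of_has_C1 (has_C1_opp F1) (fun v => has_C1_opp (F2 v)).
Qed.

Lemma C2_pair (V W X : normedModType R) (F : V -> W) (G : V -> X) :
  C2 F -> C2 G -> C2 (fun x => (F x, G x)).
Proof.
move=> /C2_has[F1 F2] /C2_has[G1 G2].
exact: C2_of_has_C1 (has_C1_pair F1 G1) (fun v => has_C1_pair (F2 v) (G2 v)).
Qed.

Lemma C2_post (V W X : normedModType R) (D : fdim W) (T : {linear W -> X}) (F : V -> W) :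
  C2 F -> C2 (fun x => T (F x)).
Proof.
move=> /C2_has[F1 F2].
exact: C2_of_has_C1 (has_C1_post D T F1) (fun v => has_C1_post D T (F2 v)).
Qed.

Lemma C2_pre (V W X : normedModType R) (D : fdim X) (T : {linear X -> V}) (F : V -> W) :
  C2 F -> C2 (fun x => F (T x)).
Proof.
move=> /C2_has[F1 F2].
exact: C2_of_has_C1 (has_C1_pre D (T := T) F1) (fun v => has_C1_pre D (T := T) (F2 (T v))).
Qed.

Lemma ip_fdim_prod (V W : normedModType R) (DV : fdim V) (DW : fdim W) p q :
  ip (fdim_prod DV DW) p q = ip DV p.1 q.1 + ip DW p.2 q.2.
Proof.
rewrite /ip /dot /= big_split_ord /=; congr (_ + _); apply: eq_bigr => i _.
  by rewrite !row_mxEl.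
by rewrite !row_mxEr.
Qed.

Lemma gradient_grad n (F : 'rV[R]_n -> R) : gradient F = grad (fdim_rV R n) F.
Proof.
by apply/funext => x; rewrite [LHS]row_sum_delta; apply: eq_bigr => i _; rewrite mxE.
Qed.

Lemma dot_hessian n (F : 'rV[R]_n -> R) x v : C2 F ->
  dot (hessian F x v) v = 'd (fun y => 'd F y v) x v.
Proof.
move=> FC; rewrite -(dgrad_ip (fdim_rV R n) FC) /hessian gradient_grad.
by rewrite (has_C1_diff v (has_C1_grad (fdim_rV R n) FC)).
Qed.

Lemma has_C1_inv : has_C1 [set r : R | 0 < r] (@GRing.inv R) (fun r v => - r ^- 2 * v).
Proof.
move=> r /= r0; have rn : r != 0 by rewrite gt_eqF.
split=> [|v].
  apply: DiffDef.
    by apply/derivable1_diffP; exact: derivableV.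
  apply/funext => v; rewrite diff1E; last by apply/derivable1_diffP; exact: derivableV.
  by rewrite derive1E deriveV //= derive_id /GRing.scale /= mulr1 mulrC.
apply: cvgM; last exact: cvg_cst.
apply: cvgN; apply: cvgV; first by rewrite expf_neq0.
exact: exprn_continuous.
Qed.

End C2Closure.

Section SquareDerivative.
Context (R : realType) (E : normedModType R) (A : euclidean_jordan E) (D : fdim E).

Lemma has_C1_square : has_C1 setT (fun y => jmul A y y) (fun y w => 2 *: jmul A y w).
Proof.
have idC := has_C1_linear D (idfun : {linear E -> E}).
apply: has_C1_ext (has_C1_bilinear D D (jm_linearl A) (jm_linearr A) (idC setT) (idC setT)) _ => y w.
by rewrite /= (jmul_comm A w) -mulr2n scaler_nat.
Qed.

Lemma C2_square : C2 (fun y => jmul A y y).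
Proof.
have Tl (w : E) : linear (fun y => 2 *: jmul A y w).
  by move=> a y z; rewrite !jE scalerDr !scalerA mulrC.
pose T w : {linear E -> E} := HB.pack (fun y => 2 *: jmul A y w)
  (GRing.isLinear.Build _ _ _ _ _ (Tl w)).
exact: C2_of_has_C1 has_C1_square (fun w => has_C1_linear D (T w)).
Qed.

End SquareDerivative.

Section SlackProblem.
Context (R : realType) (E : normedModType R) (A : euclidean_jordan E) (n m : nat).
Context (f : 'rV[R]_n -> R) (h : 'rV[R]_n -> 'rV[R]_m) (g : 'rV[R]_n -> E).
Context (f_C2 : C2 f) (h_C2 : C2 h) (g_C2 : C2 g).
Context (xs : 'rV[R]_n) (mus : 'rV[R]_m) (lams : E).
Context (DE : fdim E) (DEip : forall x y, ip DE x y = jip A x y).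

Local Notation ji := (jip A).
Local Notation jm := (jmul A).
Local Notation K := (square_cone A).
Local Notation V := ('rV[R]_n * E)%type.
Local Notation W := ('rV[R]_m * E)%type.

Let DV : fdim V := fdim_prod (fdim_rV R n) DE.
Let DW : fdim W := fdim_prod (fdim_rV R m) DE.

Lemma dotE k (u v : 'rV[R]_k) : dot u v = ip (fdim_rV R k) u v.
Proof. by []. Qed.

Definition lag (x : 'rV[R]_n) : R := lagrangian A f h g x mus lams.
(** Equal to [f - <h, mus> - <g - y y, lams>], the Lagrangian of the problem with slack at the given
    multipliers. *)
Definition slack_lag (z : V) : R := lag z.1 + ji (jm z.2 z.2) lams.
Definition slack_eq (z : V) : W := (h z.1, g z.1 - jm z.2 z.2).

Let muL_linear : linear (fun u : 'rV[R]_m => - dot u mus).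
Proof. by move=> a u v; rewrite dotDl dotZl /GRing.scale /=; ring. Qed.
Let muL : {linear 'rV[R]_m -> R} := HB.pack (fun u : 'rV[R]_m => - dot u mus)
  (GRing.isLinear.Build _ _ _ _ _ muL_linear).

Let lamL_linear : linear (fun u : E => ji u lams).
Proof. by move=> a u v; rewrite jiDl jiZl. Qed.
Let lamL : {linear E -> R} := HB.pack (fun u : E => ji u lams)
  (GRing.isLinear.Build _ _ _ _ _ lamL_linear).

Let fstL : {linear V -> 'rV[R]_n} := (fst : {linear V -> _}).
Let sndL : {linear V -> E} := (snd : {linear V -> _}).

Lemma C2_lag : C2 lag.
Proof.
apply: C2_add; last exact: C2_opp (C2_post DE lamL g_C2).
exact: C2_add f_C2 (C2_post (fdim_rV R m) muL h_C2).
Qed.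

Lemma diff_lag x v : 'd lag x v = 'd f x v - dot ('d h x v) mus - ji ('d g x v) lams.
Proof.
have LC := has_C1_add (has_C1_add (C2_has f_C2).1 (has_C1_post (fdim_rV R m) muL (C2_has h_C2).1))
  (has_C1_opp (has_C1_post DE lamL (C2_has g_C2).1)).
exact: (has_C1_diff v LC I).
Qed.

Lemma C2_slack_lag : C2 slack_lag.
Proof.
apply: (C2_add (C2_pre DV fstL C2_lag)).
exact: (C2_pre DV sndL (C2_post DE lamL (C2_square A DE))).
Qed.

Lemma diff_slack_lag z v :
  'd slack_lag z v = 'd lag (z.1) v.1 + 2 * ji (jm z.2 v.2) lams.
Proof.
have LC := has_C1_add (has_C1_pre DV (T := fstL) (C2_has C2_lag).1)
  (has_C1_pre DV (T := sndL) (has_C1_post DE lamL (has_C1_square A DE))).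
by rewrite (has_C1_diff v LC) //= jiZl.
Qed.

Lemma diff2_slack_lag z v :
  'd (fun z => 'd slack_lag z v) z v =
  dot (hessian lag z.1 v.1) v.1 + 2 * ji (jm v.2 v.2) lams.
Proof.
have wl : linear (fun y : E => 2 * ji (jm y v.2) lams).
  by move=> a x y; rewrite !jE /GRing.scale /=; ring.
pose wL : {linear E -> R} := HB.pack (fun y : E => 2 * ji (jm y v.2) lams)
  (GRing.isLinear.Build _ _ _ _ _ wl).
have LC := has_C1_add (has_C1_pre DV (T := fstL) ((C2_has C2_lag).2 v.1))
  (has_C1_pre DV (T := sndL) (@has_C1_linear _ _ _ DE setT wL)).
have -> : (fun z => 'd slack_lag z v : R) =
    (fun z => 'd lag (z.1) v.1 + 2 * ji (jm z.2 v.2) lams).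
  by apply/funext => y; rewrite diff_slack_lag.
rewrite dot_hessian; last exact: C2_lag.
exact: (has_C1_diff v LC I).
Qed.

Lemma C2_slack_eq : C2 slack_eq.
Proof.
apply: C2_pair; first exact: (C2_pre DV fstL h_C2).
apply: C2_add; first exact: (C2_pre DV fstL g_C2).
by apply: C2_opp; exact: (C2_pre DV sndL (C2_square A DE)).
Qed.

Lemma diff_slack_eq z v :
  'd slack_eq z v = ('d h (z.1) v.1, 'd g (z.1) v.1 - 2 *: jm z.2 v.2).
Proof.
have HC := has_C1_pair (has_C1_pre DV (T := fstL) (C2_has h_C2).1)
  (has_C1_add (has_C1_pre DV (T := fstL) (C2_has g_C2).1)
    (has_C1_opp (has_C1_pre DV (T := sndL) (has_C1_square A DE)))).
exact: (has_C1_diff v HC I).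
Qed.

Section Hypotheses.
Context (kkt_s : kkt A f h g xs mus lams)
  (sosc_s : second_order_sufficient A f h g xs mus lams)
  (nondeg_s : nondegenerate_point A h g xs).

Let ys := jsqrt A (g xs).

Lemma slack_sqrt : K ys /\ jm ys ys = g xs.
Proof. by have [_ _ Kg _ _] := kkt_s; exact: jsqrtP. Qed.

Lemma slack_feasible : slack_eq (xs, ys) = 0.
Proof.
by have [_ _ _ _ h0] := kkt_s; rewrite /slack_eq /= slack_sqrt.2 h0 subrr.
Qed.

Lemma slack_critical v : 'd slack_lag (xs, ys) v = 0.
Proof.
have [L0 Kl _ lg _] := kkt_s; rewrite diff_slack_lag /= diff_lag.
have ly : jm lams ys = 0 by apply: complementary_jm_sqrt Kl _; rewrite slack_sqrt.2.
rewrite ji_jm (jmul_comm A ys) ly ji0r mulr0 addr0 gradientP.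
have dlin a (x y w : 'rV[R]_m) : dot (a *: x + y) w = a * dot x w + dot y w.
  by rewrite dotDl dotZl.
rewrite (adjointP dlin).
rewrite (adjointP (jip_linear A)).
by rewrite !(dotC v.1) -[RHS](ip0l (fdim_rV R n) v.1) -L0 /= !dotE !ipBl.
Qed.

Lemma slack_second_order v : v <> 0 -> 'd slack_eq (xs, ys) v = 0 ->
  0 < 'd (fun z => 'd slack_lag z v) (xs, ys) v.
Proof.
move=> v0; rewrite diff_slack_eq diff2_slack_lag /= => -[h0 g0].
by apply: sosc_s => //; case: v v0 {h0 g0}.
Qed.

(** Let [q = (a, b)] be orthogonal to the range. Varying the slack gives [ys b = 0], so [b] is
    orthogonal to the lineality space. Nondegeneracy writes [(a, b)] as a derivative of [(h, g)]
    plus a lineality vector, and [(a, b)] is orthogonal to both, hence to itself. *)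
Lemma slack_regular q : (forall v, ip DW ('d slack_eq (xs, ys) v) q = 0) -> q = 0.
Proof.
case: q => a b H.
have {}H u w : dot ('d h xs u) a + ji ('d g xs u - 2 *: jm ys w) b = 0.
  by have := H (u, w); rewrite diff_slack_eq /= ip_fdim_prod /= DEip.
have Hw w : ji (jm ys w) b = 0.
  have := H 0 w; have := H 0 0; rewrite jm0r scaler0 subr0 jiDl jiNl jiZl; lra.
have by0 : jm b ys = 0.
  by rewrite (jmul_comm A); apply: (ji_eq0 (A := A)); rewrite ji_jm jiC Hw.
have Hu u : dot ('d h xs u) a + ji ('d g xs u) b = 0.
  by have := H u 0; rewrite jm0r scaler0 subr0.
have [_ full] := nondeg_s.
have : [set: W] (a, b) by [].
rewrite full => -[_ [u _ <-]] [_ [z zT <-]] [aE bE].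
have bz : ji b z = 0.
  by apply: lineality_orthogonal slack_sqrt.1 by0 _; rewrite slack_sqrt.2.
have ab : dot a a + ji b b = 0.
  rewrite -{1}aE -{1}bE addr0 jiDl (jiC A z) bz addr0; exact: Hu.
have a0 : dot a a = 0 by have := dot_ge0 a; have := ji_ge0 A b; lra.
have b0 : ji b b = 0 by lra.
by rewrite (dot_eq0 a0) (ji_eq0 b0).
Qed.

Theorem slack_problem_stable : exists2 r1 : R, 0 < r1 & forall r2 : R, 0 < r2 ->
  exists d M : R, [/\ 0 < d, 0 < M &
   let sol := penalized_solution DW slack_lag slack_eq (xs, ys) r1 r2 in
   [/\ forall s t z z', `|s| < d -> 0 < t < d -> sol s t z -> sol s t z' -> z = z',
       forall s t z, `|s| < d -> 0 < t < d -> sol s t z ->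
         `|z - (xs, ys)| <= M * `|s| /\ `|multiplier slack_eq s t z| <= M * `|s| &
       forall (S : normedModType R) (DS : fdim S) (O : set S) (sigma : S -> W)
         (tau : S -> R) (zeta : S -> V),
         open O -> C1_on O sigma -> C1_on O tau ->
         (forall x, O x -> [/\ `|sigma x| < d, 0 < tau x < d & sol (sigma x) (tau x) (zeta x)]) ->
         C1_on O zeta]].
Proof.
exact: (penalized_solution_stable DV C2_slack_lag C2_slack_eq slack_feasible slack_critical
  slack_second_order slack_regular).
Qed.

End Hypotheses.
End SlackProblem.

(** * The augmented Lagrangian as a minimum over the slack *)

Section AugmentedLagrangian.
Context (R : realType) (E : normedModType R) (A : euclidean_jordan E) (n m : nat).
Context (f : 'rV[R]_n -> R) (h : 'rV[R]_n -> 'rV[R]_m) (g : 'rV[R]_n -> E).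
Context (mus : 'rV[R]_m) (lams : E).
Context (DE : fdim E) (DEip : forall x y, ip DE x y = jip A x y).

Local Notation ji := (jip A).
Local Notation jm := (jmul A).
Local Notation K := (square_cone A).
Local Notation W := ('rV[R]_m * E)%type.

Let DW : fdim W := fdim_prod (fdim_rV R m) DE.
Local Notation AL := (augmented_lagrangian A f h g).
Local Notation L := (slack_lag A f h g mus lams).
Local Notation H := (slack_eq A h g).

(** Its square is the point of the cone nearest to [g x - lam / rho]. The root in the cone is taken
    in order to stay close to [jsqrt A (g xs)]. *)
Definition optimal_slack (rho : R) (x : 'rV[R]_n) (lam : E) : E :=
  jsqrt A (cone_projection K (g x - rho^-1 *: lam)).

Definition multiplier_shift (rho : R) (mu : 'rV[R]_m) (lam : E) : W :=
  rho^-1 *: ((mu, lam) - (mus, lams)).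

(** The constant left over when the square in [penalized] is completed; it is free of [x] and of the
    slack. *)
Definition penalty_offset (rho : R) (mu : 'rV[R]_m) (lam : E) : R :=
  (dot (mu - mus) (mu - mus) + ji (lam - lams) (lam - lams)) / (2 * rho).

Lemma square_cone_scale (a : R) x : 0 <= a -> K x -> K (a *: x).
Proof.
move=> a0 /square_coneP[z ->]; apply/square_coneP; exists (Num.sqrt a *: z).
by rewrite !jE scalerA -expr2 sqr_sqrtr.
Qed.

Lemma optimal_slack_cone rho x lam : K (optimal_slack rho x lam).
Proof. by have [] := jsqrtP (cone_projection_cone A (g x - rho^-1 *: lam)). Qed.

Lemma optimal_slack_sqr rho x lam :
  jm (optimal_slack rho x lam) (optimal_slack rho x lam) =
  cone_projection K (g x - rho^-1 *: lam).
Proof. by have [] := jsqrtP (cone_projection_cone A (g x - rho^-1 *: lam)). Qed.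

(** If [u = p - q] is the Moreau decomposition, then [lam - rho *: g x = rho *: q - rho *: p] is one
    as well, so its projection is [rho *: q]. *)
Lemma cone_projection_scaled rho x lam : 0 < rho ->
  cone_projection K (lam - rho *: g x) =
  lam - rho *: (g x - cone_projection K (g x - rho^-1 *: lam)).
Proof.
move=> rho0; set u := g x - rho^-1 *: lam.
have [p [q [Kp Kq uE pq]]] := moreau_decomposition A u.
rewrite (cone_projection_moreau Kp Kq uE pq).
have lE : lam - rho *: g x = rho *: q - rho *: p.
  rewrite -scalerBr -[q - p]opprB -uE /u scalerN scalerBr scalerA mulfV ?gt_eqF //.
  by rewrite scale1r opprB.
have -> : cone_projection K (lam - rho *: g x) = rho *: q.
  apply: (cone_projection_moreau _ _ lE); rewrite ?jE ?(jiC A q) ?pq ?mulr0 //.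
    by apply: square_cone_scale => //; exact: ltW.
  by apply: square_cone_scale => //; exact: ltW.
by rewrite scalerBr opprB addrCA lE addrC subrK.
Qed.

Lemma penalized_slack rho x y mu lam : 0 < rho ->
  penalized DW L H (multiplier_shift rho mu lam) rho^-1 (x, y)
    - penalty_offset rho mu lam =
  f x - dot (h x) mu + rho / 2 * dot (h x) (h x)
    + rho / 2 * `|g x - rho^-1 *: lam - jm y y| ^+ 2 - ji lam lam / (2 * rho).
Proof.
move=> rho0; rewrite /penalized /penalty_offset ip_fdim_prod /slack_lag /lag /lagrangian /=.
rewrite DEip -(jip_norm A) !dotE !(ipDl, ipDr, ipNl, ipNr, ipZl, ipZr) !jE.
rewrite (ipC _ mu (h x)) (ipC _ mus (h x)) (ipC _ mus mu).
rewrite (jiC A lam (g x)) (jiC A lams (g x)) (jiC A lams lam).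
rewrite (jiC A (jm y y) (g x)) (jiC A (jm y y) lam) (jiC A (jm y y) lams).
by field; rewrite gt_eqF.
Qed.

Lemma augmented_lagrangianE rho x mu lam : 0 < rho ->
  AL rho x mu lam = f x - dot (h x) mu + rho / 2 * dot (h x) (h x)
    + rho / 2 * `|g x - rho^-1 *: lam - cone_projection K (g x - rho^-1 *: lam)| ^+ 2
    - ji lam lam / (2 * rho).
Proof.
move=> rho0; rewrite /augmented_lagrangian cone_projection_scaled //.
set u := g x - rho^-1 *: lam; set p := cone_projection K u.
have -> : lam - rho *: (g x - p) = rho *: (p - u).
  have uE : rho *: u = rho *: g x - lam.
    by rewrite /u scalerBr scalerA mulfV ?gt_eqF // scale1r.
  by rewrite (scalerBr _ (g x)) (scalerBr _ p u) uE !opprB addrCA.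
rewrite sqr_sqrtr ?dot_ge0 // normrZ (gtr0_norm rho0) distrC (jip_norm A).
by field; rewrite gt_eqF.
Qed.

Lemma augmented_lagrangian_slack rho x mu lam : 0 < rho ->
  AL rho x mu lam = penalized DW L H (multiplier_shift rho mu lam) rho^-1
    (x, optimal_slack rho x lam) - penalty_offset rho mu lam.
Proof.
by move=> rho0; rewrite penalized_slack // optimal_slack_sqr augmented_lagrangianE.
Qed.

(** With the equality at the optimal slack, this identifies the augmented Lagrangian as a minimum
    over [y]. *)
Lemma augmented_lagrangian_le rho x y mu lam : 0 < rho ->
  AL rho x mu lam <= penalized DW L H (multiplier_shift rho mu lam) rho^-1 (x, y)
    - penalty_offset rho mu lam.
Proof.
move=> rho0; rewrite penalized_slack // augmented_lagrangianE // lerD2r lerD2l.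
rewrite ler_pM2l ?divr_gt0 //; set u := g x - rho^-1 *: lam.
have [p [q [Kp Kq uE pq]]] := moreau_decomposition A u.
rewrite (cone_projection_moreau Kp Kq uE pq).
have := moreau_dist Kq (square_cone_sqr A y) pq; rewrite -uE.
have -> : u - p = - q by rewrite uE addrAC subrr add0r.
by rewrite normrN; have := sqr_ge0 `|p - jm y y|; lra.
Qed.

Lemma multiplier_slack rho x mu lam : 0 < rho ->
  multiplier H (multiplier_shift rho mu lam) rho^-1 (x, optimal_slack rho x lam) =
  - ((mu - rho *: h x, cone_projection K (lam - rho *: g x)) - (mus, lams)).
Proof.
move=> rho0; rewrite cone_projection_scaled // -optimal_slack_sqr.
rewrite /multiplier /multiplier_shift invrK scalerBr scalerA mulfV ?gt_eqF // scale1r.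
have pairE (p q : W) : p.1 = q.1 -> p.2 = q.2 -> p = q.
  by case: p; case: q => /= ? ? ? ? -> ->.
by apply: pairE => /=; rewrite !opprB addrCA.
Qed.

(** An a priori bound on the slack, whereas the ball of the statement bounds only [x]. It combines
    the Holder estimate for roots with the Lipschitz estimate for projections, [g xs] being its own
    projection. *)
Lemma optimal_slack_dist rho x xs lam : K (g xs) ->
  `|optimal_slack rho x lam - jsqrt A (g xs)| ^+ 2 <=
  `|junit A| * (`|g x - g xs| + `|rho^-1 *: lam|).
Proof.
move=> Kg; have [Ky yE] := jsqrtP Kg.
apply: (le_trans (square_root_holder (optimal_slack_cone rho x lam) Ky)).
rewrite ler_wpM2l // optimal_slack_sqr yE -[X in _ - X](cone_projection_id Kg).
apply: (le_trans (cone_projection_lipschitz _ _ _)).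
by rewrite addrAC; exact: ler_normB.
Qed.

Lemma continuous_augmented_lagrangian rho mu lam : C2 f -> C2 h -> C2 g ->
  continuous (fun x => AL rho x mu lam).
Proof.
move=> fC hC gC x.
have hhC := has_C1_ip (fdim_rV R m) (C2_has hC).1 (C2_has hC).1.
have hmC := has_C1_ip (fdim_rV R m) (C2_has hC).1 (has_C1_cst mu).
have c1 := has_C1_continuous (has_C1_add (has_C1_add (C2_has fC).1 (has_C1_opp hmC))
  (has_C1_scale (fdim_R R) (has_C1_cst (rho / 2)) hhC)) (I : setT x).
have cg : {for x, continuous g} by exact: has_C1_continuous (C2_has gC).1 I.
have cp : continuous (cone_projection K).
  by apply: (@lipschitz_continuous _ _ _ _ 1) => u v; rewrite mul1r; exact: cone_projection_lipschitz.
have c2 : {for x, continuous (fun z => lam - rho *: g z)}.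
  by apply: continuousB; [exact: cst_continuous|apply: continuousZ; [exact: cst_continuous|exact: cg]].
have c3 : {for x, continuous (fun z => `|cone_projection K (lam - rho *: g z)|)}.
  apply: continuous_comp; last exact: norm_continuous.
  by apply: (@continuous_comp _ _ _ (fun z => lam - rho *: g z) (cone_projection K)) => //; exact: cp.
have c4 : {for x, continuous (fun z => (2 * rho)^-1 * (- `|lam| ^+ 2 +
    `|cone_projection K (lam - rho *: g z)| * `|cone_projection K (lam - rho *: g z)|))}.
  apply: continuousM; first exact: cst_continuous.
  by apply: continuousD; [exact: cst_continuous|apply: continuousM].
have -> : (fun x => AL rho x mu lam) = (fun x => (f x - ip (fdim_rV R m) (h x) mu +
   rho / 2 *: ip (fdim_rV R m) (h x) (h x)) + (2 * rho)^-1 *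
      (- `|lam| ^+ 2 + `|cone_projection K (lam - rho *: g x)| * `|cone_projection K (lam - rho *: g x)|)).
  by apply/funext => z; rewrite /augmented_lagrangian sqr_sqrtr ?dot_ge0.
exact: continuousD c1 c4.
Qed.

End AugmentedLagrangian.

(** * Comparison of the Euclidean and maximum norms *)

Section EuclideanNorm.
Context (R : realType).

Lemma norm_le_enorm k (u : 'rV[R]_k) : `|u| <= enorm u.
Proof.
rewrite -ler_sqr ?nnegrE ?sqrtr_ge0 // sqr_sqrtr ?dot_ge0 //; exact: norm_le_dot.
Qed.

Lemma enorm_le_norm k (u : 'rV[R]_k) : enorm u <= k.+1%:R * `|u|.
Proof.
rewrite -ler_sqr ?nnegrE ?sqrtr_ge0 ?mulr_ge0 // sqr_sqrtr ?dot_ge0 //.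
apply: (le_trans (ler_norm _)); apply: (le_trans (dot_le _ _)).
rewrite -mulrA -expr2 exprMn ler_wpM2r ?sqr_ge0 // expr2.
apply: (@le_trans _ _ k.+1%:R); first by rewrite ler_nat.
by rewrite ler_peMr // ler1n.
Qed.

Lemma enormB k (u v : 'rV[R]_k) : enorm (u - v) = enorm (v - u).
Proof. by rewrite /enorm -opprB /dot; congr Num.sqrt; apply: eq_bigr => i _; rewrite !mxE mulrNN. Qed.

Lemma closed_eball k (x : 'rV[R]_k) (eps : R) : closed (eball x eps).
Proof.
have c : continuous (fun y : 'rV[R]_k => enorm (y - x)).
  move=> y; have FC := has_C1_add (has_C1_linear (fdim_rV R k) (idfun : {linear 'rV[R]_k -> _}))
    (has_C1_cst (- x)).
  have c1 := has_C1_continuous (has_C1_ip_sqr (fdim_rV R k) (FC setT)) (I : setT y).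
  exact: (continuous_comp c1 (@sqrt_continuous R _)).
rewrite (_ : eball x eps = (fun y => enorm (y - x)) @^-1` [set t | t <= eps]) //.
by apply: preimage_closed => // y _; exact: c.
Qed.

Lemma prod_norm_le_pnorm m (E : normedModType R) (w : 'rV[R]_m * E) : `|w| <= pnorm w.
Proof.
have h0 : 0 <= enorm w.1 ^+ 2 + `|w.2| ^+ 2 by rewrite addr_ge0 // sqr_ge0.
rewrite prod_normE ge_max; apply/andP; split.
  apply: (le_trans (norm_le_enorm _)).
  by rewrite -ler_sqr ?nnegrE ?sqrtr_ge0 // (sqr_sqrtr h0) lerDl sqr_ge0.
by rewrite -ler_sqr ?nnegrE ?sqrtr_ge0 // (sqr_sqrtr h0) lerDr sqr_ge0.
Qed.

Lemma pnorm_le_norm m (E : normedModType R) (w : 'rV[R]_m * E) : pnorm w <= m.+2%:R * `|w|.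
Proof.
apply: (@le_trans _ _ (enorm w.1 + `|w.2|)).
  rewrite -ler_sqr ?nnegrE ?sqrtr_ge0 ?addr_ge0 ?sqrtr_ge0 // sqr_sqrtr.
    have := mulr_ge0 (sqrtr_ge0 (dot w.1 w.1)) (normr_ge0 w.2).
    by rewrite -/(enorm w.1); lra.
  by rewrite addr_ge0 // sqr_ge0.
rewrite -natr1 mulrDl mul1r; apply: lerD; last exact: prod_norm_snd.
by apply: (le_trans (enorm_le_norm _)); rewrite ler_pM2l // prod_norm_fst.
Qed.

Lemma pnormN m (E : normedModType R) (w : 'rV[R]_m * E) : pnorm (- w) = pnorm w.
Proof. by rewrite /pnorm /= normrN -[- w.1]sub0r enormB subr0. Qed.

End EuclideanNorm.

Theorem proposition7p3 (R : realType) (E : normedModType R)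
  (A : euclidean_jordan E) (Atr : trace_normalized A) (n m : nat)
  (f : 'rV[R]_n -> R) (h : 'rV[R]_n -> 'rV[R]_m) (g : 'rV[R]_n -> E)
  (f_C2 : C2 f) (h_C2 : C2 h) (g_C2 : C2 g)
  (xs : 'rV[R]_n) (mus : 'rV[R]_m) (lams : E)
  (kkt_s : kkt A f h g xs mus lams)
  (sosc_s : second_order_sufficient A f h g xs mus lams)
  (nondeg_s : nondegenerate_point A h g xs) :
  exists delta eps M rhobar : R,
    [/\ 0 < delta, 0 < eps, 0 < M & 0 < rhobar] /\
    let D := multiplier_region mus lams delta rhobar in
    exists xsol : 'rV[R]_m * E * R -> 'rV[R]_n,
      [/\ forall mu lam rho, D (mu, lam, rho) ->
            unique (is_minimizer
                      (fun x => augmented_lagrangian A f h g rho x mu lam)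
                      (eball xs eps))
                   (xsol (mu, lam, rho)),
          C1_on D^° xsol,
          forall mu lam rho, D (mu, lam, rho) ->
            enorm (xsol (mu, lam, rho) - xs)
              <= M / rho * pnorm ((mu, lam) - (mus, lams)) &
          forall mu lam rho, D (mu, lam, rho) ->
            let x := xsol (mu, lam, rho) in
            let mubar := mu - rho *: h x in
            let lambar := cone_projection (square_cone A) (lam - rho *: g x) in
            pnorm ((mubar, lambar) - (mus, lams))
              <= M / rho * pnorm ((mu, lam) - (mus, lams))].
Proof.
have [DE DEip] := exists_fdim A.
have [_ _ Kg _ _] := kkt_s.
have [r1 r10 stab] := slack_problem_stable f_C2 h_C2 g_C2 DEip kkt_s sosc_s nondeg_s.
pose ys := jsqrt A (g xs).
have e1 : 0 < `|junit A| + 1 by rewrite ltr_wpDl.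
(* If [|g x - g xs|] and [|lam / rho|] are both at most [eta], [optimal_slack_dist] puts the slack
   within [r1] of [ys]. *)
pose eta : R := r1 ^+ 2 / (2 * (`|junit A| + 1)).
have eta0 : 0 < eta by rewrite divr_gt0 ?exprn_gt0 // mulr_gt0.
have /continuousPeps/(_ _ eta0)[dg dg0 gnear] : {for xs, continuous g}.
  exact: has_C1_continuous (C2_has g_C2).1 I.
have [eps [eps0 epsr1 epsg]] : exists eps : R, [/\ 0 < eps, eps <= r1 & eps < dg].
  exists (Num.min r1 (dg / 2)); rewrite lt_min r10 divr_gt0 // ge_min lexx; split => //.
  by apply: (@le_lt_trans _ _ (dg / 2)); [rewrite ge_min lexx orbT|lra].
(* The ball of radius [r2] in the maximum norm lies inside the Euclidean ball of radius [eps]. *)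
pose r2 : R := eps / n.+1%:R; have r20 : 0 < r2 by rewrite divr_gt0.
have [d [M0 [d0 M00 [uniq est C1z]]]] := stab r2 r20.
(* The entry [d] gives [|s| < d], and [eta / 2] bounds [|lam - lams| / rho]. *)
pose delta : R := Num.min d (eta / 2).
(* The first term gives [1 / rho <= d / 2], the second [|lams| / rho <= eta / 2]. *)
pose rhobar : R := 2 / d + 2 * (`|lams| + 1) / eta.
have delta0 : 0 < delta by rewrite lt_min d0 divr_gt0.
have lam1 : 0 < `|lams| + 1 by rewrite ltr_wpDl.
have rhobar0 : 0 < rhobar by rewrite addr_gt0 // !divr_gt0 // mulr_gt0.
(* The factor covers both changes of norm, [n.+1] for [x] and [m.+2] for the multipliers. *)
exists delta, eps, ((n + m).+2%:R * M0), rhobar; split; first by split => //; rewrite mulr_gt0.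
move=> D.
pose Y (p : 'rV[R]_m * E * R) x := optimal_slack A g p.2 x p.1.2.
pose S (p : 'rV[R]_m * E * R) := multiplier_shift mus lams p.2 p.1.1 p.1.2.
pose AL (p : 'rV[R]_m * E * R) x := augmented_lagrangian A f h g p.2 x p.1.1 p.1.2.
have DP p : D p -> [/\ 0 < p.2, 0 < p.2^-1 < d, `|S p| < d,
    `|S p| <= pnorm (p.1 - (mus, lams)) / p.2 & `|p.2^-1 *: p.1.2| <= eta].
  case: p => [[mu lam] rho] [/= Hd Hr].
  have rho0 : 0 < rho by exact: lt_le_trans Hr.
  have h1 : 0 < 2 * (`|lams| + 1) / eta by rewrite divr_gt0 // mulr_gt0.
  have h2 : 0 < 2 / d by rewrite divr_gt0.
  have Hd1 : enorm (mu - mus) + `|lam - lams| < d * rho.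
    by apply: lt_le_trans Hd _; rewrite ler_pM2r // ge_min lexx.
  have Hd2 : enorm (mu - mus) + `|lam - lams| < eta / 2 * rho.
    by apply: lt_le_trans Hd _; rewrite ler_pM2r // ge_min lexx orbT.
  have SE : `|S (mu, lam, rho)| = `|(mu, lam) - (mus, lams)| / rho.
    by rewrite /S /multiplier_shift normrZ gtr0_norm ?invr_gt0 // mulrC.
  split => //=.
  - rewrite invr_gt0 rho0 /= -[ltLHS]mul1r ltr_pdivrMr //.
    have : d * (2 / d) <= d * rho.
      by rewrite ler_pM2l //; apply: le_trans Hr; rewrite lerDl ltW.
    by rewrite mulrCA divff ?gt_eqF //; lra.
  - rewrite SE ltr_pdivrMr //; apply: le_lt_trans Hd1.
    apply: (le_trans (prod_norm_le_add _)); rewrite lerD2r; exact: norm_le_enorm.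
  - by rewrite SE ler_pM2r ?invr_gt0 // prod_norm_le_pnorm.
  - rewrite normrZ gtr0_norm ?invr_gt0 // ler_pdivrMl //.
    have h3 : `|lams| <= eta / 2 * rho.
      have : eta / 2 * (2 * (`|lams| + 1) / eta) <= eta / 2 * rho.
        apply: ler_wpM2l; first by rewrite ltW // divr_gt0.
        by apply: le_trans Hr; rewrite lerDr ltW.
      have -> : eta / 2 * (2 * (`|lams| + 1) / eta) = `|lams| + 1 by field; rewrite gt_eqF.
      by lra.
    have := ler_normD (lam - lams) lams; rewrite subrK.
    have := sqrtr_ge0 (dot (mu - mus) (mu - mus)); rewrite -/(enorm _).
    by move: h3 Hd2; lra.
(* For any [(x', y')] in the ball of radius [r2], the penalized value at [x] with its optimal slack
   is, up to the common offset, the augmented Lagrangian at [x], hence at most that at [x'], hence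
   at most the penalized value at [(x', y')]. *)
have minsol p x : D p -> is_minimizer (AL p) (eball xs eps) x ->
    penalized_solution (fdim_prod (fdim_rV R m) DE) (slack_lag A f h g mus lams)
      (slack_eq A h g) (xs, ys) r1 r2 (S p) p.2^-1 (x, Y p x).
  move=> Dp [xB xmin]; have [rho0 _ _ _ leta] := DP p Dp.
  have xeps : `|x - xs| <= eps by apply: le_trans xB; exact: norm_le_enorm.
  split.
    rewrite prod_normE /= ge_max (le_trans xeps) //=.
    rewrite -ler_sqr ?nnegrE ?(ltW r10) //.
    apply: (le_trans (optimal_slack_dist p.2 x p.1.2 Kg)).
    have gx : `|g x - g xs| < eta by apply: gnear; exact: le_lt_trans epsg.
    apply: (@le_trans _ _ ((`|junit A| + 1) * (eta + eta))).
      by apply: ler_pM; rewrite ?addr_ge0 // ?lerDl // lerD // ltW.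
    by rewrite le_eqVlt; apply/orP; left; apply/eqP; rewrite /eta; field; rewrite gt_eqF.
  move=> [x' y'] zr; have x'B : eball xs eps x'.
    rewrite /eball /=; apply: (le_trans (enorm_le_norm _)).
    rewrite -ler_pdivlMl // mulrC; apply: le_trans zr; exact: (prod_norm_fst (x' - xs, y' - ys)).
  have := xmin x' x'B; rewrite /AL (augmented_lagrangian_slack f h g mus lams DEip) //.
  by move/le_trans => /(_ _ (augmented_lagrangian_le f h g mus lams DEip x' y' p.1.1 p.1.2 rho0)); rewrite lerD2r.
have /choice[xsol xsolP] : forall p, exists x, D p -> is_minimizer (AL p) (eball xs eps) x.
  (* Outside [D] the value [xs] is an arbitrary default. *)
  move=> p; have [Dp|nDp] := pselect (D p); last by exists xs.
  have [|||x xB xmin] := @fdim_min R _ (fdim_rV R n) (eball xs eps) (`|xs| + eps) (AL p) (@closed_eball _ _ _ _).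
  - move=> x xB; rewrite -[x](subrK xs); apply: (le_trans (ler_normD _ _)).
    by rewrite addrC lerD2l; apply: le_trans xB; exact: norm_le_enorm.
  - exists xs; rewrite /eball /= subrr /enorm /dot big1 ?sqrtr0 ?ltW // => i _.
    by rewrite mxE mul0r.
  - by move=> x _; exact: continuous_augmented_lagrangian.
  by exists x.
have bound p : D p -> `|xsol p - xs| <= M0 * `|S p| /\
    `|multiplier (slack_eq A h g) (S p) p.2^-1 (xsol p, Y p (xsol p))| <= M0 * `|S p|.
  move=> Dp; have [rho0 td Sd _ _] := DP p Dp.
  have [h1 h2] := est _ _ _ Sd td (minsol p _ Dp (xsolP p Dp)); split => //.
  by apply: le_trans h1; exact: (prod_norm_fst (xsol p - xs, Y p (xsol p) - ys)).
have scale k p (a : R) : (k <= (n + m).+2)%N -> D p -> a <= M0 * `|S p| ->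
    k%:R * a <= (n + m).+2%:R * M0 / p.2 * pnorm (p.1 - (mus, lams)).
  move=> kn Dp aM; have [rho0 _ _ SM _] := DP p Dp.
  apply: (@le_trans _ _ ((n + m).+2%:R * (M0 * `|S p|))).
    apply: (@le_trans _ _ (k%:R * (M0 * `|S p|))); first by rewrite ler_wpM2l.
    by rewrite ler_wpM2r ?mulr_ge0 ?(ltW M00) // ler_nat.
  have -> : (n + m).+2%:R * M0 / p.2 * pnorm (p.1 - (mus, lams)) =
      (n + m).+2%:R * (M0 * (pnorm (p.1 - (mus, lams)) / p.2)) by ring.
  by rewrite ler_pM2l // ler_pM2l.
exists xsol; split.
- move=> mu lam rho Dp; split; first exact: xsolP Dp.
  move=> x' x'min; have [_ td Sd _ _] := DP _ Dp.
  by have [] := uniq _ _ _ _ Sd td (minsol _ _ Dp (xsolP _ Dp)) (minsol _ _ Dp x'min).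
- have DS : fdim ('rV[R]_m * E * R)%type := fdim_prod (fdim_prod (fdim_rV R m) DE) (fdim_R R).
  have OD x : D^° x -> D x by exact: interior_subset.
  have Oop : open D^° by exact: open_interior.
  pose tauL : {linear ('rV[R]_m * E * R)%type -> R} := (snd : {linear _ -> R}).
  pose pL : {linear ('rV[R]_m * E * R)%type -> ('rV[R]_m * E)%type} := (fst : {linear _ -> _}).
  have tC : has_C1 D^° (fun p : 'rV[R]_m * E * R => p.2^-1) (fun p v => - p.2 ^- 2 * v.2).
    by move=> p /OD/DP[rho0 _ _ _ _]; exact: (has_C1_pre DS (T := tauL) (@has_C1_inv R)).
  have sC := has_C1_scale (fdim_prod (fdim_rV R m) DE) tC
    (has_C1_add (has_C1_linear DS pL) (has_C1_cst (- (mus, lams)))).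
  (* The slack is a root of a projection, so its regularity cannot be read off its formula; it comes
     together with that of [xsol]. *)
  have zC : C1_on D^° (fun p => (xsol p, Y p (xsol p))).
    apply: (C1z _ DS D^° S (fun p => p.2^-1)) => //.
    + exact: (has_C1_on Oop sC).
    + exact: (has_C1_on Oop tC).
    + by move=> p /OD Dp; have [_ td Sd _ _] := DP p Dp; split => //; exact: minsol (xsolP p Dp).
  have := has_C1_post (fdim_prod (fdim_rV R n) DE)
    (fst : {linear ('rV[R]_n * E)%type -> 'rV[R]_n}) (C1_on_has zC).
  exact: has_C1_on.
- move=> mu lam rho Dp; have [h1 _] := bound _ Dp.
  apply: (le_trans (enorm_le_norm _)).
  by apply: (scale n.+1 (mu, lam, rho)) => //; rewrite ltnS leqW // leq_addr.
- move=> mu lam rho Dp; cbv zeta; have [_ h2] := bound _ Dp.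
  have [/= rho0 _ _ _ _] := DP _ Dp.
  move: h2; rewrite /S /Y /= multiplier_slack // => h2.
  rewrite -pnormN; apply: (le_trans (pnorm_le_norm _)).
  by apply: (scale m.+2 (mu, lam, rho)) => //; rewrite !ltnS leq_addl.
Qed.
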